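(* Let $F:\mathbb{C}^n\times[0,1]\to\mathbb{C}$ be a (not necessarily continuous) subanalytic function. Suppose that for each $t\in[0,1]$, $f_t:=F(\cdot,t):\mathbb{C}^n\to\mathbb{C}$ is a (not necessarily reduced) complex homogeneous polynomial, not identically zero and with $f_t(0)=0$. If $\{V(f_t)\}_{t\in[0,1]}$ is a topologically $V$-equisingular family, then it is equimultiple, i.e. $m(V(f_t),0)=m(V(f_0),0)$ for all $t\in[0,1]$.
   Context: $V(f)$ denotes the zero set of $f$. The multiplicity $m(V(f),0)$ is the multiplicity at $0$ of the zero set, i.e. the order of vanishing at $0$ of a reduced equation of the germ $(V(f),0)$. A function is subanalytic if its graph is a subanalytic set. The family $\{V(f_t)\}_{t\in[0,1]}$ is topologically $V$-equisingular if there are an open set $U\subset\mathbb{C}^n$ (a neighborhood of $0$) and a continuous map $\varphi:U\times[0,1]\to\mathbb{C}^n$ such that, for all $t\in[0,1]$, $\varphi_t:=\varphi(\cdot,t):U\to\varphi(U\times\{t\})$ is a homeomorphism, $\varphi(0,t)=0$ and $\varphi_t(V(f_t))=V(f_0)$ (understood inside $U$ and its image, i.e. $\varphi_t(V(f_t)\cap U)=V(f_0)\cap\varphi_t(U)$). *)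

(* Defs.v *)
(* The notations of mpoly clash with those of MathComp-Analysis, hence
   only the instances and constants of mpoly are imported. *)
From HB Require Import structures.
From mathcomp Require Import all_boot all_order all_algebra.
From mathcomp Require Import all_classical all_reals all_analysis.
From mathcomp Require Import complex.
From mathcomp Require Import -(notations) mpoly.

Set Implicit Arguments.
Unset Strict Implicit.
Unset Printing Implicit Defensive.

Import Order.TTheory GRing.Theory Num.Theory.
Import numFieldNormedType.Exports.

Local Open Scope classical_set_scope.
Local Open Scope ring_scope.

(* R[i] has no canonical topology of its own; packaged as a numClosedFieldType
   it receives the one defined by the modulus. *)
Definition Cplx (R : realType) : numClosedFieldType := R[i].

(* [has_power_series c p f]: the series sum_a c_a (x - p)^a over multi-indices
   a converges absolutely to f x for every x in a polydisc centred at p; the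
   first clause is absolute convergence at (r, ..., r). [ball p r] is the open
   polydisc of radius r, as matrices carry the sup distance. For K = R and
   K = C, [analytic_at] is real analyticity and holomorphy near p. *)
Definition has_power_series (K : numFieldType) (N : nat)
    (c : multinom N -> K) (p : 'rV[K]_N) (f : 'rV[K]_N -> K) : Prop :=
  exists r : K, 0 < r /\
    (exists M : K, forall m : nat,
       \sum_(a : bmultinom N m) `|c a| * r ^+ mdeg a <= M) /\
    (forall x, ball p r x ->
       (fun m : nat =>
          \sum_(a : bmultinom N m) c a * \prod_(i < N) (x 0 i - p 0 i) ^+ a i)
         @ \oo --> f x).

Definition analytic_at (K : numFieldType) (N : nat)
    (p : 'rV[K]_N) (f : 'rV[K]_N -> K) : Prop :=
  exists c, has_power_series c p f.

Definition analytic_on (K : numFieldType) (N : nat)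
    (U : set 'rV[K]_N) (f : 'rV[K]_N -> K) : Prop :=
  forall p, U p -> analytic_at p f.

(* Near every point p of R^N (not only of A), A is a finite union of sets given
   by finitely many analytic equations f = 0 and strict inequalities g > 0.
   Using the same number l of each is harmless: pad with 0 = 0 and 1 > 0. *)
Definition semianalytic (R : realType) (N : nat) (A : set 'rV[R]_N) : Prop :=
  forall p, exists U : set 'rV[R]_N, open U /\ U p /\
    exists (k l : nat) (f g : 'I_k -> 'I_l -> 'rV[R]_N -> R),
      (forall i j, analytic_on U (f i j) /\ analytic_on U (g i j)) /\
      A `&` U =
        U `&` \bigcup_i [set x | forall j, f i j x = 0 /\ 0 < g i j x].

(* Near every point of R^N, A is the projection of a relatively compact
   semianalytic subset of some R^N x R^m. *)
Definition subanalytic (R : realType) (N : nat) (A : set 'rV[R]_N) : Prop :=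
  forall p, exists U : set 'rV[R]_N, open U /\ U p /\
    exists (m : nat) (B : set 'rV[R]_(N + m)),
      semianalytic B /\ compact (closure B) /\ A `&` U = lsubmx @` B.

(* The identification of C^n with R^n x R^n. *)
Definition realify (R : realType) (n : nat) (z : 'rV[Cplx R]_n) :
    'rV[R]_(n + n) :=
  row_mx (map_mx (@complex.Re R) z) (map_mx (@complex.Im R) z).

(* Graph of the restriction of F to C^n x [0,1], inside C^n x R x C. *)
Definition real_graph (R : realType) (n : nat)
    (F : 'rV[Cplx R]_n -> R -> Cplx R) : set 'rV[R]_(n + n + (1 + (1 + 1))) :=
  [set v | exists (x : 'rV[Cplx R]_n) (t : R), 0 <= t <= 1 /\
     v = row_mx (realify x) (row_mx (const_mx t) (realify (const_mx (F x t))))].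

Definition subanalytic_fun (R : realType) (n : nat)
    (F : 'rV[Cplx R]_n -> R -> Cplx R) : Prop :=
  subanalytic (real_graph F).

Definition homogeneous_polynomial_fun (R : realType) (n : nat)
    (f : 'rV[Cplx R]_n -> Cplx R) : Prop :=
  exists (d : nat) (P : mpoly n (Cplx R)),
    P \is ishomog1 d mdeg /\ forall x, f x = meval (fun i => x 0 i) P.

Definition zero_set (R : realType) (n : nat) (f : 'rV[Cplx R]_n -> Cplx R) :
    set 'rV[Cplx R]_n :=
  [set x | f x = 0].

(* g is an equation of the germ (V,0) that generates the ideal of all
   holomorphic germs vanishing on (V,0). *)
Definition reduced_equation (R : realType) (n : nat)
    (V : set 'rV[Cplx R]_n) (g : 'rV[Cplx R]_n -> Cplx R) : Prop :=
  analytic_at 0 g /\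
  (\forall x \near (0 : 'rV[Cplx R]_n), V x <-> g x = 0) /\
  (forall h, analytic_at 0 h ->
     (\forall x \near (0 : 'rV[Cplx R]_n), V x -> h x = 0) ->
     exists q, analytic_at 0 q /\
       \forall x \near (0 : 'rV[Cplx R]_n), h x = q x * g x).

Definition vanishing_order (R : realType) (n : nat)
    (g : 'rV[Cplx R]_n -> Cplx R) (k : nat) : Prop :=
  exists c : multinom n -> Cplx R, has_power_series c 0 g /\
    (forall a, (mdeg a < k)%N -> c a = 0) /\
    (exists a, mdeg a = k /\ c a != 0).

(* m(V,0). The order does not depend on the reduced equation, since two of them
   differ by a unit; the default value 0 is not used for the germ at 0 of an
   analytic hypersurface. *)
Definition multiplicity (R : realType) (n : nat) (V : set 'rV[Cplx R]_n) :
    nat :=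
  xget 0%N [set k | exists g, reduced_equation V g /\ vanishing_order g k].

Definition homeomorphism_onto_image (S T : topologicalType)
    (U : set S) (f : S -> T) : Prop :=
  {within U, continuous f} /\
  exists g : T -> S,
    (forall x, U x -> g (f x) = x) /\ {within f @` U, continuous g}.

Definition topologically_V_equisingular (R : realType) (n : nat)
    (f : R -> 'rV[Cplx R]_n -> Cplx R) : Prop :=
  exists (U : set 'rV[Cplx R]_n)
         (phi : 'rV[Cplx R]_n * R -> 'rV[Cplx R]_n),
    open U /\ U 0 /\
    {within U `*` [set t : R | 0 <= t <= 1], continuous phi} /\
    forall t : R, 0 <= t <= 1 ->
      homeomorphism_onto_image U (fun x => phi (x, t)) /\
      phi (0, t) = 0 /\
      (fun x => phi (x, t)) @` (zero_set (f t) `&` U) =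
        zero_set (f 0) `&` ((fun x => phi (x, t)) @` U).

(* Main.v *)
(* Write V_t for the zero set of f_t and h_t for the embedding at time t, so that near 0 a point x
   lies in V_t exactly when h_t x lies in V_0.  As V_t is a cone, a power series vanishes on V_t near
   0 only if all its homogeneous parts do; by the Nullstellensatz these are divisible by the squarefree
   part g_t of f_t, so g_t is a reduced equation and the multiplicity is deg g_t, which is the number of
   points of V_t on a generic line of a fixed direction b.

   It suffices to show that deg g_t is locally constant at each s.  By homogeneity and compactness no
   root of g_t on a generic line p + C b escapes the small discs about the simple roots of g_s.  Near
   such a root, V_s is the graph w = 0 of a coordinate w, and winding numbers of loops off V_s are
   multiples of the winding number of w.  By invariance of domain psi = h_s^-1 h_t is defined there, is
   close to the identity and carries V_t to V_s, so wind (g_t o c) = a wind (w o psi o c) for one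
   integer a.  The small circle of the line gives a = number of roots of g_t in the disc > 0, and a
   small loop about a simple point of V_t gives that a divides 1, so each disc contains one root.

   Invariance of domain is obtained from Tao's argument, which needs that a map close to the
   identity of a ball has a zero; this follows from a mod 2 cup product on a grid. *)
Require Import Defs.
From HB Require Import structures.
From mathcomp Require Import all_boot all_order all_algebra all_field.
From mathcomp Require Import all_classical all_reals all_analysis.
From mathcomp Require Import complex.
From mathcomp Require Import -(notations) mpoly.
From mathcomp Require Import lra ring zify.

Set Implicit Arguments.
Unset Strict Implicit.
Unset Printing Implicit Defensive.

Import Order.TTheory GRing.Theory Num.Theory.
Import numFieldNormedType.Exports.
Local Open Scope ring_scope.

(** * Invariance of domain *)

(** Only [h] is jointly continuous in point and time; the inverses [k t] are continuous for each [t]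
    separately, with no uniformity. Compactness is therefore applied to [k s] at the fixed time [s]
    alone, and invariance of domain ensures that [h t x] lies in its domain, the image of [h s]. The
    inverse [k t] only carries [gt] over to a ball that [psi] is known to cover.

    The lines on which roots are counted may leave the given neighbourhood of 0; as the sets [V t]
    are cones, a dilation brings the needed region inside. A simple point of [V t] need not exist on
    the line through [p], so it is taken on a generic line nearby.

    Much of the algebra is replaced by size estimates. The squarefree part is a quotient of
    coefficients that is bounded because roots are bounded, and a polynomial [p] with [|p| <= K |q|]
    on bounded sets is a multiple of [q]. Likewise the quotient of a convergent series by [g]
    converges on a polydisc where one monomial of [g] outweighs the others. Working mod 2 in the cup
    product removes all orientation signs. *)

Lemma F2_addxx (x : 'F_2) : x + x = 0.
Proof. by case: x => -[|[|]] // i; apply/val_inj. Qed.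

(* For a list a_1, ..., a_r of 0-cochains, the value of the cup product
   (d a_1) ... (d a_r) mod 2 on the sum of all monotone chains starting at x
   with directions in S. *)
Fixpoint cup_sum (X : Type) (I : finType) (sh : I -> X -> X)
    (s : seq (X -> 'F_2)) (S : {set I}) (x : X) : 'F_2 :=
  if s is a :: s' then
    \sum_(j in S) (a (sh j x) + a x) * cup_sum sh s' (S :\ j) (sh j x)
  else 1.

Section CupSum.
Variables (X : Type) (I : finType) (sh : I -> X -> X).
Hypothesis shC : forall i j x, sh i (sh j x) = sh j (sh i x).
Notation cup := (cup_sum sh).

(** Every unordered pair occurs twice, and 2 = 0 in ['F_2]. This stands for the cancellation of
    boundary terms with opposite signs. *)
Lemma sum_pair_sym (S : {set I}) (F : I -> I -> 'F_2) :
  (forall i j, F i j = F j i) ->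
  \sum_(i in S) \sum_(j in S :\ i) F i j = 0.
Proof.
move=> Fsym.
rewrite (eq_bigr (fun i => \sum_(j in S | (enum_rank j < enum_rank i)%N) F i j +
  \sum_(j in S | (enum_rank i < enum_rank j)%N) F i j)); last first.
  move=> i iS; rewrite (bigID (fun j => enum_rank j < enum_rank i)%N) /=.
  congr (_ + _); apply: eq_bigl => j; rewrite !inE.
    case: (eqVneq j i) => [->|] //=; first by rewrite ltnn andbF.
  rewrite -leqNgt leq_eqVlt; case: (eqVneq j i) => [->|ne] /=.
    by rewrite ltnn andbF.
  case: eqP => // /val_inj /enum_rank_inj ije; by rewrite ije eqxx in ne.
rewrite big_split /=.
have -> : \sum_(i in S) \sum_(j in S | (enum_rank j < enum_rank i)%N) F i j =
  \sum_(i in S) \sum_(j in S | (enum_rank i < enum_rank j)%N) F i j.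
  rewrite (exchange_big_dep (mem S)) /=; last by move=> i j _ /andP[].
  apply: eq_bigr => i iS; apply: eq_big => [j|j _]; last exact: Fsym.
  by rewrite iS.
exact: F2_addxx.
Qed.

(** A product of coboundaries is a cocycle, so it vanishes on the boundary of the cube with corner
    [x] and directions [S]: its back faces start at [sh j x], its front faces at [x]. *)
Lemma cup_sum_closed s (S : {set I}) x :
  \sum_(j in S) cup s (S :\ j) (sh j x) = \sum_(j in S) cup s (S :\ j) x.
Proof.
elim: s S x => [|a s IH] S x //=.
have SC (i j : I) : S :\ i :\ j = S :\ j :\ i.
  by apply/setP => k; rewrite !inE andbCA.
under eq_bigr do under eq_bigr do rewrite mulrDl.
under eq_bigr do rewrite big_split /=.
(* The part with [a] evaluated after both shifts is symmetric in the two directions, hence zero. *)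
rewrite big_split /= sum_pair_sym ?add0r; last first.
  by move=> i j; rewrite shC SC.
under [RHS]eq_bigr do under eq_bigr do rewrite mulrDl.
under [RHS]eq_bigr do rewrite big_split /=.
rewrite [RHS]big_split /=.
(* On the right, the induction hypothesis turns the part with [a x] into one that is symmetric in
   [i] and [j]. *)
have -> : \sum_(i in S) \sum_(j in S :\ i) a x * cup s (S :\ i :\ j) (sh j x) = 0.
  under eq_bigr do rewrite -mulr_sumr IH mulr_sumr.
  by apply: sum_pair_sym => i j; rewrite SC.
rewrite addr0.
under eq_bigr do rewrite -mulr_sumr IH mulr_sumr.
rewrite (exchange_big_dep (mem S)) /=; last by move=> i j _; rewrite !inE => /andP[].
apply: eq_bigr => i iS; apply: eq_big => j.
  by rewrite !inE eq_sym iS andbT andbC.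
by move=> _; rewrite SC.
Qed.

(** As [s] gives a cocycle w, the product d a . w equals d (a w): a sum of differences across single
    directions, which telescopes on a grid. *)
Lemma cup_sum_boundary a s (S : {set I}) x :
  cup (a :: s) S x =
  \sum_(j in S) (a (sh j x) * cup s (S :\ j) (sh j x) + a x * cup s (S :\ j) x).
Proof.
rewrite /=; under eq_bigr do rewrite mulrDl.
by rewrite !big_split /= -!mulr_sumr cup_sum_closed.
Qed.

(** Chains that stay in [P] see a constant [a], whose coboundary is then a zero factor. This kills
    faces of the grid on which one of the functions is constant. *)
Lemma cup_sum0 a s s' (S : {set I}) (P : X -> Prop) x : P x ->
  (forall y j, j \in S -> P y -> P (sh j y)) ->
  (forall y z, P y -> P z -> a y = a z) ->
  cup (s ++ a :: s') S x = 0.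
Proof.
move=> Px Psh Pa; elim: s S x Px Psh => [|b s IH] S x Px Psh /=; apply: big1 => j jS.
  by rewrite (Pa _ x (Psh _ _ jS Px)) // F2_addxx mul0r.
rewrite IH ?mulr0 //; first exact: Psh.
by move=> y k; rewrite inE => /andP[_]; apply: Psh.
Qed.

(** A nonzero term of the sum is a single chain along which every factor changes its value. The
    relation [P S x y] abstracts that [y] is reachable from [x] by directions in [S]. *)
Lemma cup_sum_neq0 (J : eqType) (a : J -> X -> 'F_2) (s : seq J) (S : {set I})
    (P : {set I} -> X -> X -> Prop) (x : X) :
  (forall T x, P T x x) ->
  (forall (T : {set I}) x y j, j \in T -> P (T :\ j) (sh j x) y -> P T x y) ->
  cup [seq a j | j <- s] S x != 0 ->
  {in s, forall j, exists y z, [/\ P S x y, P S x z & a j y != a j z]}.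
Proof.
move=> P0 Psh; elim: s S x => [|b s IH] S x //= nz k.
have [j jS] : exists2 j, j \in S & (a b (sh j x) + a b x) *
    cup [seq a j | j <- s] (S :\ j) (sh j x) != 0.
  apply/exists_inP; apply: contraR nz; rewrite negb_exists_in => /forall_inP h.
  by rewrite big1 // => j /h /negbNE/eqP.
rewrite mulf_eq0 negb_or inE => /andP[nb nc] /orP[/eqP ->|/(IH _ _ nc)].
  exists (sh j x), x; split => //; first exact: (Psh _ _ _ j).
  by apply: contra nb => /eqP ->; rewrite F2_addxx.
by move=> [y [z [Py Pz yz]]]; exists y, z; split => //; exact: (Psh _ _ _ j).
Qed.
End CupSum.

Section Grid.
Variables (N m : nat).
Notation box := {ffun 'I_N -> 'I_m.+1}.
(** The cyclic successor makes the shift a bijection of the box, so that sums can be reindexed by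
    it. The points where it wraps around are removed by conditions [x j != ord_max]. *)
Definition grid_shift (j : 'I_N) (x : box) : box :=
  [ffun k => if k == j then ordS (x k) else x k].

Lemma grid_shiftC i j x : grid_shift i (grid_shift j x) = grid_shift j (grid_shift i x).
Proof. by apply/ffunP => k; rewrite !ffunE; case: ifP; case: ifP. Qed.

Lemma ordS_max : ordS (ord_max : 'I_m.+1) = ord0.
Proof. by apply/val_inj; rewrite /= modnn. Qed.

Lemma sum_grid_telescope (P : pred {ffun 'I_N -> 'I_m.+1}) (j : 'I_N) (h : box -> 'F_2) :
  (forall x, P (grid_shift j x) = P x) ->
  \sum_(x : box | P x && (x j != ord_max)) (h (grid_shift j x) + h x) =
  \sum_(x : box | P x && (x j == ord_max)) h x +
  \sum_(x : box | P x && (x j == ord0)) h x.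
Proof.
move=> Psh; rewrite big_split /=.
pose g (x : box) : box := [ffun k => if k == j then ord_pred (x k) else x k].
have gK : cancel g (grid_shift j).
  by move=> x; apply/ffunP => k; rewrite !ffunE; case: eqP => // _; rewrite ord_predK.
have Kg : cancel (grid_shift j) g.
  by move=> x; apply/ffunP => k; rewrite !ffunE; case: eqP => // _; rewrite ordSK.
have -> : \sum_(x : box | P x && (x j != ord_max)) h (grid_shift j x) =
   \sum_(x : box | P x && (x j != ord0)) h x.
  rewrite [RHS](reindex (grid_shift j)) /=; last by exists g => x _.
  apply: eq_bigl => x; rewrite Psh ffunE eqxx; congr (_ && ~~ _).
  by rewrite -ordS_max (inj_eq (can_inj (@ordSK _))).
have -> : \sum_(x : box | P x && (x j != ord_max)) h x =
   \sum_(x : box | P x) h x + \sum_(x : box | P x && (x j == ord_max)) h x.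
  rewrite (bigID (fun x : box => x j == ord_max) P) /=.
  by rewrite addrAC F2_addxx add0r.
have -> : \sum_(x : box | P x && (x j != ord0)) h x =
   \sum_(x : box | P x) h x + \sum_(x : box | P x && (x j == ord0)) h x.
  rewrite (bigID (fun x : box => x j == ord0) P) /=.
  by rewrite addrAC F2_addxx add0r.
by rewrite addrACA F2_addxx add0r addrC.
Qed.

Variable (a : 'I_N -> box -> 'F_2).
Hypothesis a0 : forall j (x : box), x j = ord0 -> a j x = 0.
Hypothesis a1 : forall j (x : box), x j = ord_max -> a j x = 1.

(** Corners of the unit cubes of a face of the grid. The remaining coordinates must not be maximal,
    so that these cubes do not wrap around. *)
Definition face (i : nat) : pred box :=
  fun x => [forall j : 'I_N, (x j == ord_max) == (j < i)%N].

(** Stokes' formula once per direction: [face i] reduces to [face i.+1] because the function of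
    direction [i] is 0 on the bottom and 1 on the top, and the last face is a single vertex. The
    number is a degree mod 2, read off the boundary values. *)
Lemma cup_sum_face i : (i <= N)%N ->
  \sum_(x : box | face i x)
    cup_sum grid_shift [seq a j | j <- drop i (enum 'I_N)] [set j : 'I_N | (i <= j)%N] x = 1.
Proof.
move=> iN; rewrite -(subKn iN); move: (N - i)%N => k.
elim: k => [|k IH] .
  rewrite subn0 drop_oversize ?size_enum_ord //= (big_pred1 [ffun=> ord_max]) // => x.
  apply/forallP/eqP => [h|-> j]; last by rewrite ffunE eqxx ltn_ord.
  by apply/ffunP => j; have := h j; rewrite ltn_ord ffunE => /eqP/eqP.
have [Nk|kN] := leqP N k.
  by move: IH; rewrite (eqP Nk) (eqP (leqW Nk)).
set i' := (N - k.+1)%N; have i'N : (i' < N)%N by rewrite /i' subnS prednK ?leq_subr ?subn_gt0.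
have Ei : (N - k)%N = i'.+1 by rewrite /i' subnS prednK // subn_gt0.
rewrite Ei in IH.
pose o := Ordinal i'N.
rewrite (drop_nth o) ?size_enum_ord //.
have -> : nth o (enum 'I_N) i' = o by apply/val_inj; rewrite /= nth_enum_ord.
rewrite [map _ _]/=.
set s := [seq a j | j <- drop i'.+1 _] in IH *.
set S := [set j : 'I_N | (i' <= j)%N].
transitivity (\sum_(j in S) \sum_(x | face i' x)
  (a o (grid_shift j x) * cup_sum grid_shift s (S :\ j) (grid_shift j x) +
   a o x * cup_sum grid_shift s (S :\ j) x)).
  rewrite [RHS]exchange_big; apply: eq_bigr => x _.
  exact: (cup_sum_boundary grid_shiftC).
(* [face i'] without its condition on coordinate [j], hence invariant under [grid_shift j]. *)
pose P (j : 'I_N) : pred box := fun x => [forall l, (l != j) ==> ((x l == ord_max) == (l < i')%N)].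
have faceP (j : 'I_N) x : (i' <= j)%N -> face i' x = P j x && (x j != ord_max).
  move=> ij; apply/forallP/andP => [h|[/forallP h xj] l]; last first.
    case: (eqVneq l j) => [->|lj]; first by rewrite (negbTE xj) ltnNge ij.
    by have := h l; rewrite lj.
  by split; [apply/forallP => l; apply/implyP|rewrite (eqP (h j)) -leqNgt].
have tele (j : 'I_N) : j \in S -> \sum_(x | face i' x)
  (a o (grid_shift j x) * cup_sum grid_shift s (S :\ j) (grid_shift j x) +
   a o x * cup_sum grid_shift s (S :\ j) x) =
  \sum_(x : box | P j x && (x j == ord_max)) a o x * cup_sum grid_shift s (S :\ j) x +
  \sum_(x : box | P j x && (x j == ord0)) a o x * cup_sum grid_shift s (S :\ j) x.
  rewrite inE => ij.
  under eq_bigl do rewrite (faceP j) //.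
  apply: (sum_grid_telescope (fun x => a o x * cup_sum grid_shift s (S :\ j) x)) => x.
  apply: eq_forallb => l; rewrite ffunE.
  by case: (l == j).
rewrite (eq_bigr _ tele) (bigD1 o) /=; last by rewrite inE.
(* For a direction [j] other than [o], the function [a j] is still a member of [s], and it is
   constant on the bottom and on the top of direction [j]; both boundary sums vanish by
   [cup_sum0]. *)
rewrite [X in _ + X]big1 ?addr0; last first.
  move=> j /andP[]; rewrite inE => ij jo.
  have ij' : (i' < j)%N.
    by rewrite ltn_neqAle ij andbT eq_sym; apply: contra jo => /eqP e; apply/eqP/val_inj.
  have js : exists s1 s2, s = s1 ++ a j :: s2.
    have : j \in drop i'.+1 (enum 'I_N).
      have : j \in enum 'I_N by rewrite mem_enum.
      rewrite -{1}(cat_take_drop i'.+1 (enum 'I_N)) mem_cat => /orP[] //.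
      move=> /(nthP o)[q]; rewrite size_takel ?size_enum_ord // => qi.
      rewrite nth_take // => /(congr1 val) /=; rewrite nth_enum_ord; last exact: leq_trans qi i'N.
      by move=> e; move: ij'; rewrite -e ltnNge -ltnS qi.
    by rewrite /s => /path.splitPr[p1 p2]; exists (map a p1), (map a p2); rewrite map_cat.
  have zz c (cst : forall y : box, y j = c -> a j y = a j [ffun=> c]) (x : box) : x j = c -> cup_sum grid_shift s (S :\ j) x = 0.
    case: js => s1 [s2 ->] xj.
    apply: (cup_sum0 s1 s2 (P := fun y => y j = c) xj).
      by move=> y l; rewrite !inE => /andP[lj _]; rewrite ffunE eq_sym (negbTE lj).
    by move=> y z yj zj; rewrite cst // [RHS]cst.
  rewrite !big1 ?addr0 // => x /andP[_ /eqP xj]; rewrite (zz _ _ _ xj) ?mulr0 // => y yj.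
    by rewrite !a0 // ffunE.
  by rewrite !a1 // ffunE.
rewrite [X in _ + X]big1 ?addr0; last first.
  by move=> x /andP[_ /eqP xj]; rewrite a0 // mul0r.
rewrite -IH; apply: eq_big => [x|x].
  apply/andP/forallP => [[/forallP h xo] l|h].
    case: (eqVneq l o) => [->|lo]; first by rewrite xo ltnSn.
    have := h l; rewrite lo /= => /eqP ->; rewrite ltnS (leq_eqVlt l).
    rewrite (_ : (l == i' :> nat) = false) //; apply: contra_neqF lo => /eqP e; exact/val_inj.
  split; last by rewrite (eqP (h o)) ltnSn.
  apply/forallP => l; apply/implyP => lo; rewrite (eqP (h l)) ltnS (leq_eqVlt l).
  rewrite (_ : (l == i' :> nat) = false) //; apply: contra_neqF lo => /eqP e; exact/val_inj.
move=> /andP[_ /eqP xo]; rewrite a1 // mul1r; congr (cup_sum _ _ _ _).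
by apply/setP => l; rewrite !inE ltn_neqAle eq_sym.
Qed.

(** Combinatorial form of the Poincare-Miranda theorem: the total over all cells is 1 by
    [cup_sum_face], so some cell contributes, and there every [a j] takes both values. *)
Lemma grid_sign_change : exists x : box, (forall j, (x j < m)%N) /\
  forall j, exists y z : box, a j y != a j z /\
    forall k, (y k = x k :> nat \/ y k = (x k).+1 :> nat) /\
              (z k = x k :> nat \/ z k = (x k).+1 :> nat).
Proof.
have := cup_sum_face (leq0n N); rewrite drop0 => h.
have [x xf nz] : exists2 x, face 0 x & cup_sum grid_shift [seq a j | j <- enum 'I_N] [set j : 'I_N | (0 <= j)%N] x != 0.
  apply/exists_inP; apply: contraPT h; rewrite negb_exists_in => /forall_inP h'.
  by rewrite big1 // => x /h' /negbNE/eqP.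
have xm j : (x j < m)%N.
  have := forallP xf j; rewrite ltn0 => /eqP/negbT xj.
  by rewrite ltn_neqAle -ltnS ltn_ord andbT; apply: contra xj => /eqP e; apply/eqP/val_inj.
exists x; split => // j.
pose P (T : {set 'I_N}) (x y : box) := (forall k, k \in T -> (x k < m)%N) ->
  forall k, y k = x k :> nat \/ k \in T /\ y k = (x k).+1 :> nat.
have [|||] := @cup_sum_neq0 _ _ _ _ a _ _ P x _ _ nz j.
- by move=> T y _ k; left.
- move=> T y z l lT hP yT k.
  have yl := yT l lT.
  have hc : forall k', k' \in T :\ l -> (grid_shift l y k' < m)%N.
    by move=> k'; rewrite !inE ffunE => /andP[/negbTE ->]; exact: yT.
  have := hP hc k; rewrite !inE ffunE; case: (eqVneq k l) => [->|kl] /=.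
    by rewrite modn_small ?ltnS // => -[|[]]; [right|].
  by [].
- by rewrite mem_enum.
move=> y [z [Py Pz yz]]; exists y, z; split=> // k.
split; first by case: (Py (fun k _ => xm k) k) => [|[_]]; [left|right].
by case: (Pz (fun k _ => xm k) k) => [|[_]]; [left|right].
Qed.
End Grid.

Local Open Scope classical_set_scope.
Local Open Scope ring_scope.

Lemma within_continuousE (R : realType) (V W : normedModType R) (A : set V) (f : V -> W) :
  {within A, continuous f} <->
  (forall x, A x -> forall e, 0 < e -> exists2 d, 0 < d &
     forall y, A y -> `|x - y| < d -> `|f x - f y| < e).
Proof.
rewrite subspace_continuousP; split=> H x Ax; last first.
  apply/cvgrPdist_lt => e e0; have [d d0 Hd] := H x Ax e e0.
  by apply/nbhs_normP; exists d => // y /= xy Ay; apply: Hd.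
move=> e e0; have /cvgrPdist_lt/(_ e e0)/nbhs_normP[d /= d0 Hd] := H x Ax.
by exists d => // y Ay xy; apply: Hd.
Qed.

(** Lebesgue number of the cover of [K] by [good] sets; a property that passes to subsets spares
    naming the cover. *)
Lemma compact_lebesgue (R : realType) (V : normedModType R) (K : set V) (good : set V -> Prop) :
  compact K -> (forall A B, A `<=` B -> good B -> good A) ->
  (forall x, K x -> exists2 d, 0 < d & good (ball x d)) ->
  exists2 d, 0 < d & forall x, K x -> good (ball x d).
Proof.
move=> /compact_near_coveringP cK mono cov.
have : \forall d \near (0 : R)^'+, K `<=` (fun x => good (ball x d)).
  apply: cK => x /cov[d d0 gd].
  exists (ball x (d / 2), [set e | e < d / 2]) => /=.
    split; first by apply: nbhsx_ballx; rewrite divr_gt0.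
    by apply: nbhs_right_lt; rewrite divr_gt0.
  move=> [y e] [/= xy ed]; apply: mono gd => z yz.
  rewrite (splitr d); apply: ball_triangle xy _.
  by apply: le_ball yz; exact: ltW.
move=> H; near (0 : R)^'+ => d; exists d => //.
by near: d.
Unshelve. all: end_near. Qed.

Lemma rV_norm_le (R : realType) n (x : 'rV[R]_n) (e : R) : 0 <= e ->
  (`|x| <= e) = [forall i, `|x 0 i| <= e].
Proof.
move=> e0; rewrite /Num.norm/= mx_normrE; apply/bigmax_leP/forallP => [[_ h] i|h].
  exact: (h (0, i)).
by split=> // -[i j] _; rewrite ord1; exact: h.
Qed.

Lemma rV_coord_le (R : realType) n (x : 'rV[R]_n) i : `|x 0 i| <= `|x|.
Proof. by have := rV_norm_le x (normr_ge0 x); rewrite lexx => /esym/forallP. Qed.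

Lemma rV_norm_lt (R : realType) n (x : 'rV[R]_n) (e : R) : 0 < e ->
  (`|x| < e) = [forall i, `|x 0 i| < e].
Proof.
move=> e0; apply/idP/forallP => [xe i|h]; first exact: le_lt_trans (rV_coord_le x i) xe.
by rewrite /Num.norm/= mx_normrE; apply/bigmax_ltP; split=> // -[i j] _; rewrite ord1; exact: h.
Qed.

Lemma closed_cube_compact (R : realType) n (c : 'rV[R]_n) (r : R) : compact [set x | `|x - c| <= r].
Proof.
apply: bounded_closed_compact.
  exists (`|c| + r); split; first exact: num_real.
  move=> M hM x /= xr; apply: le_trans (ltW hM).
  by rewrite -[x](subrK c) addrC; apply: le_trans (ler_normD _ _) _; rewrite lerD2l.
rewrite (_ : [set x | _] = (fun x => `|x - c|) @^-1` [set y | y <= r]) //.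
apply: closed_comp => [x _|]; last exact: closed_le.
by apply: continuous_comp; [apply: continuousB => //; exact: cst_continuous|exact: norm_continuous].
Qed.

(** The bound forces coordinate [j] of [f] to be at most 0 on the face where x_j = -r and at least 0
    on the opposite one. Without a zero, some coordinate would keep a strict sign on every small
    cell, against [grid_sign_change]. *)
Theorem near_identity_zero (R : realType) (N : nat) (r : R) (f : 'rV[R]_N -> 'rV[R]_N) :
  0 < r -> {within [set x | `|x| <= r], continuous f} ->
  (forall x, `|x| <= r -> `|f x - x| <= r) ->
  exists2 x, `|x| <= r & f x = 0.
Proof.
move=> r0 fc fid; apply: contrapT => nz.
set Q := [set x : 'rV[R]_N | `|x| <= r].
have cQ : compact Q.
  rewrite (_ : Q = [set x | `|x - 0| <= r]); first exact: closed_cube_compact.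
  by apply/seteqP; split=> x /=; rewrite subr0.
pose good (A : set 'rV[R]_N) := exists i, (forall x, A x -> 0 < f x 0 i) \/ (forall x, A x -> f x 0 i < 0).
have [d d0 dgood] : exists2 d, 0 < d & forall x, Q x -> good (Q `&` ball x d).
  apply: (compact_lebesgue (good := fun A => good (Q `&` A)) cQ).
    move=> A B /(@setIS _ Q _ _); move: (Q `&` A) (Q `&` B) => {}A {}B.
    by move=> AB [i [h|h]]; exists i; [left|right] => x /AB; apply: h.
  move=> x Qx.
  have [i fxi] : exists i, f x 0 i != 0.
    apply: contrapT => h; apply: nz; exists x => //; apply/rowP => i; rewrite mxE.
    by apply/eqP/negP => /negP h'; apply: h; exists i.
  have fi0 : 0 < `|f x 0 i| by rewrite normr_gt0.
  have [e e0 He] := (within_continuousE _ _).1 fc x Qx _ fi0.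
  exists e => //; exists i.
  have close y : (Q `&` ball x e) y -> `|f x 0 i - f y 0 i| < `|f x 0 i|.
    move=> [Qy]; rewrite -ball_normE /= => /(He y Qy); apply: le_lt_trans.
    by have := rV_coord_le (f x - f y) i; rewrite !mxE.
  have [fx0|fx0] := ltP 0 (f x 0 i); [left|right] => y /close.
    by rewrite (gtr0_norm fx0) ltr_norml => /andP[]; lra.
  by rewrite (ler0_norm fx0) ltr_norml => /andP[]; lra.
(* A mesh below the Lebesgue number puts each cell into a ball on which one coordinate has constant
   sign. *)
have [m m0 md] : exists2 m : nat, (0 < m)%N & 2 * r / m%:R < d.
  have [m hm] : exists m : nat, 2 * r / d < m%:R.
    by have /archi_boundP h : 0 <= 2 * r / d; [rewrite divr_ge0 ?mulr_ge0 // ltW | exists (Num.bound (2 * r / d))].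
  have m0 : 0 < m%:R :> R by apply: le_lt_trans hm; rewrite divr_ge0 ?mulr_ge0 // ltW.
  exists m; first by rewrite ltr0n in m0.
  by rewrite ltr_pdivrMr // [ltRHS]mulrC -ltr_pdivrMr.
have m0R : 0 < m%:R :> R by rewrite ltr0n.
pose pt (x : {ffun 'I_N -> 'I_m.+1}) : 'rV[R]_N := \row_i (2 * r / m%:R * (x i)%:R - r).
have Qpt x : Q (pt x).
  rewrite /Q /= rV_norm_le ?ltW //; apply/forallP => i; rewrite mxE.
  have xi : (x i)%:R <= m%:R :> R by rewrite ler_nat -ltnS.
  have : 2 * r / m%:R * (x i)%:R <= 2 * r.
    by rewrite -mulrA ler_piMr ?mulr_ge0 ?(ltW r0) // mulrC ler_pdivrMr // mul1r.
  have : 0 <= 2 * r / m%:R * (x i)%:R by rewrite !mulr_ge0 // ?invr_ge0 ?(ltW r0) // ltW.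
  by rewrite ler_norml; lra.
(* The sign of coordinate [j], with imposed values on the two extreme faces; there [fid] gives the
   weak inequality that keeps these values compatible with [f]. *)
pose a (j : 'I_N) (x : {ffun 'I_N -> 'I_m.+1}) : 'F_2 :=
  if x j == ord0 then 0 else if x j == ord_max then 1 else if 0 < f (pt x) 0 j then 1 else 0.
have [||x [xm xc]] := @grid_sign_change N m a.
- by move=> j x xj; rewrite /a xj eqxx.
- move=> j x xj; rewrite /a xj eqxx ifF // -(inj_eq val_inj) /=.
  by rewrite eqn0Ngt m0.
have fb x' j : `|f (pt x') 0 j - pt x' 0 j| <= r.
  have := le_trans (rV_coord_le (f (pt x') - pt x') j) (fid _ (Qpt x')).
  by rewrite !mxE.
have a0 j (y : {ffun 'I_N -> 'I_m.+1}) : a j y = 0 -> f (pt y) 0 j <= 0.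
  rewrite /a; case: eqP => [yj _|_].
    by have := fb y j; rewrite !mxE yj mulr0 ler_norml; lra.
  by case: eqP => // _; case: ltP.
have a1 j (y : {ffun 'I_N -> 'I_m.+1}) : a j y != 0 -> 0 <= f (pt y) 0 j.
  rewrite /a; case: (y j =P ord0) => [_|_]; first by rewrite eqxx.
  case: (y j =P ord_max) => [yj _|_]; last by case: ltP => // /ltW.
  have := fb y j; rewrite !mxE yj /= divfK ?gt_eqF // ler_norml; lra.
have close (y : {ffun 'I_N -> 'I_m.+1}) : (forall k, y k = x k :> nat \/ y k = (x k).+1 :> nat) ->
    (Q `&` ball (pt x) d) (pt y).
  move=> yx; split; first exact: Qpt.
  rewrite -ball_normE /= rV_norm_lt //; apply/forallP => k; rewrite !mxE.
  case: (yx k) => ->; first by rewrite subrr normr0.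
  rewrite (_ : _ - _ = - (2 * r / m%:R)); last by rewrite -[in X in _ - X]natr1; ring.
  rewrite normrN ger0_norm //.
  by rewrite divr_ge0 ?mulr_ge0 ?(ltW r0) // ltW.
have [j hj] := dgood _ (Qpt x).
have [y [z [yz yzx]]] := xc j.
have cy := close y (fun k => (yzx k).1); have cz := close z (fun k => (yzx k).2).
have Fy : (a j y == 0) || (a j z == 0).
  move: yz; case: (a j y) => -[|[|]] // i1; case: (a j z) => -[|[|]] // i2.
have Fz : (a j y != 0) || (a j z != 0).
  move: yz; case: (a j y) => -[|[|]] // i1; case: (a j z) => -[|[|]] // i2.
case: hj => hj; have := hj _ cy; have := hj _ cz.
  by case/orP: Fy => /eqP h; have := a0 _ _ h; lra.
by case/orP: Fz => h; have := a1 _ _ h; lra.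
Qed.

Lemma compact_pos_lower_bound (R : realType) (V : normedModType R) (K : set V) (f : V -> R) :
  compact K -> {within K, continuous f} -> (forall x, K x -> 0 < f x) ->
  exists2 m, 0 < m & forall x, K x -> m <= f x.
Proof.
move=> cK cf f0; have [K0|/set0P/negP/negPn/eqP K0] := pselect (K !=set0).
  have [c /set_mem Kc hc] := compact_EVT_min K0 cK cf.
  by exists (f c); [exact: f0|move=> x Kx; apply: hc; exact/mem_set].
by exists 1 => // x; rewrite K0.
Qed.

(** Infimal convolution with a steep cone: the infimum over [z] of [G z + L * |x - z|] is
    [L]-Lipschitz in [x], and for large [L] only points [z] near [x] matter. *)
Lemma lipschitz_approx (R : realType) (V : normedModType R) (K : set V) (G : V -> R) (M e : R) :
  compact K -> continuous G -> (forall x, `|G x| <= M) -> 0 < e ->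
  exists P : V -> R, exists2 L, 0 < L &
    (forall x y, `|P x - P y| <= L * `|x - y|) /\ (forall x, K x -> `|P x - G x| <= e).
Proof.
move=> cK cG GM e0.
have [d d0 hd] : exists2 d, 0 < d & forall x, K x -> forall y z, ball x d y -> ball x d z -> `|G y - G z| < e.
  apply: (compact_lebesgue (good := fun A => forall y z, A y -> A z -> `|G y - G z| < e) cK).
    by move=> A B AB h y z /AB Ay /AB Az; exact: h.
  move=> x Kx; have /cvgrPdist_lt/(_ (e / 2)) := cG x.
  rewrite divr_gt0 // => /(_ isT)/nbhs_normP[d /= d0 hd]; exists d => // y z.
  rewrite -ball_normE /= => /hd h1 /hd h2.
  rewrite (_ : _ - _ = (G x - G z) - (G x - G y)); last by ring.
  by rewrite (splitr e); apply: le_lt_trans (ler_normB _ _) _; rewrite ltrD.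
have M0 : 0 <= M by apply: le_trans (GM 0).
(* A point [z] at distance at least [d] costs at least [2 * M], as much as [G] can vary; closer
   points are handled by uniform continuity. *)
pose L := 2 * M / d + 1; have L0 : 0 < L by rewrite ltr_wpDl // divr_ge0 ?mulr_ge0 // ltW.
pose S x := [set G z + L * `|x - z| | z in setT].
have lbS x : has_lbound (S x).
  exists (- M) => _ [z _ <-]; rewrite -[- M]addr0; apply: lerD.
    by have := GM z; rewrite ler_norml => /andP[].
  by rewrite mulr_ge0 // ltW.
have neS x : S x !=set0 by exists (G x + L * `|x - x|); exists x.
exists (fun x => inf (S x)), L => //; split.
  suff H x y : inf (S x) <= inf (S y) + L * `|x - y|.
    move=> x y; rewrite ler_norml lerBlDl lerBrDl; apply/andP; split; last by rewrite H.
    by rewrite lerBlDr distrC H.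
  rewrite -lerBlDr; apply: lb_le_inf => // _ [z _ <-]; rewrite lerBlDr.
  apply: le_trans (_ : G z + L * `|x - z| <= _).
    by apply: ge_inf => //; exists z.
  rewrite -addrA lerD2l -mulrDr ler_wpM2l ?(ltW L0) //.
  by rewrite [leRHS]addrC; apply: ler_distD.
move=> x Kx; have P1 : inf (S x) <= G x.
  by apply: ge_inf => //; exists x => //; rewrite subrr normr0 mulr0 addr0.
rewrite distrC ger0_norm ?subr_ge0 // lerBlDr -lerBlDl; apply: lb_le_inf => // _ [z _ <-].
have [xz|xz] := ltP `|x - z| d.
  have : `|G x - G z| < e by apply: (hd x) => //; rewrite -ball_normE /= ?subrr ?normr0.
  have : 0 <= L * `|x - z| by rewrite mulr_ge0 // ltW.
  by rewrite ltr_norml; lra.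
have : 2 * M <= L * `|x - z|.
  apply: le_trans (_ : L * d <= _); last by rewrite ler_wpM2l // ltW.
  by rewrite /L [leRHS]mulrDl divfK ?gt_eqF // mul1r lerDl ltW.
by have := GM x; have := GM z; rewrite !ler_norml; lra.
Qed.

(* Pigeonhole: a fine grid of M^N points near 0 cannot be hit by the roughly
   M^(N-1) small cells that cover the sphere of the sup norm. *)
Lemma lipschitz_sphere_avoid (R : realType) (N : nat) (P : 'rV[R]_N -> 'rV[R]_N)
    (c : 'rV[R]_N) (L e d : R) :
  0 < L -> (forall x y, `|P x - P y| <= L * `|x - y|) -> 0 < e -> 0 < d ->
  exists2 v, `|v| <= d & forall y, `|y - c| = e -> P y <> v.
Proof.
move=> L0 PL e0 d0; case: N => [|N] in P c PL *.
  exists 0 => [|y]; first by rewrite normr0 ltW.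
  by rewrite [y - c]thinmx0 normr0 => /esym/eqP; rewrite gt_eqF.
apply: contrapT => hyp.
have {}hyp v : `|v| <= d -> exists2 y, `|y - c| = e & P y = v.
  move=> vd; apply: contrapT => h; apply: hyp; exists v => // y ye Py; apply: h; by exists y.
(* With [Q = q * M], a cell of side [2 * e / Q] has an image of diameter less than the grid step
   [d / M]. *)
have [q hq] : exists q : nat, 2 * e * L / d < q%:R.
  by exists (Num.bound (2 * e * L / d)); apply: archi_boundP; rewrite divr_ge0 ?mulr_ge0 // ltW.
(* Makes the number of cells, at most [N.+1 * 2 * (q.+1 * M) ^ N], smaller than the number
   [M ^ N.+1] of grid points. *)
pose M := (N.+1 * 2 * q.+1 ^ N).+1; pose Q := (q * M)%N.
have M0 : 0 < M%:R :> R by rewrite ltr0n.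
have qR : 0 < q%:R :> R by apply: le_lt_trans hq; rewrite divr_ge0 ?mulr_ge0 // ltW.
have Q0 : 0 < Q%:R :> R by rewrite natrM mulr_gt0.
pose v (k : {ffun 'I_N.+1 -> 'I_M}) : 'rV[R]_N.+1 := \row_i (d / M%:R * (k i)%:R).
have vd k : `|v k| <= d.
  rewrite rV_norm_le ?(ltW d0) //; apply/forallP => i; rewrite mxE ger0_norm; last first.
    by rewrite mulr_ge0 // divr_ge0 // ltW.
  by rewrite mulrAC ler_pdivrMr // ler_wpM2l ?(ltW d0) // ler_nat ltnW.
have /choice[y hy] : forall k, exists y, `|y - c| = e /\ P y = v k.
  by move=> k; have [z z1 z2] := hyp _ (vd k); exists z.
have /choice[fc hfc] : forall k, exists i, `|(y k - c) 0 i| = e.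
  move=> k.
  have [ye _] := hy k; apply: contrapT => h.
  suff : `|y k - c| < e by rewrite ye ltxx.
  rewrite rV_norm_lt //; apply/forallP => i; rewrite lt_neqAle; apply/andP; split.
    by apply/eqP => h'; apply: h; exists i.
  by rewrite -ye; apply: rV_coord_le.
pose w k j := ((y k - c) 0 j + e) / (2 * e) * Q%:R.
have w0 k j : 0 <= w k j.
  have := rV_coord_le (y k - c) j; rewrite (hy k).1 ler_norml => /andP[h _].
  by rewrite mulr_ge0 ?(ltW Q0) // divr_ge0 ?mulr_ge0 ?(ltW e0) // -lerBlDr sub0r.
have wQ k j : w k j <= Q%:R.
  have := rV_coord_le (y k - c) j; rewrite (hy k).1 ler_norml => /andP[_ h].
  rewrite ler_piMl ?(ltW Q0) // ler_pdivrMr ?mulr_gt0 // mul1r; lra.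
(* The face of the cube that contains [y k], by coordinate and sign, and the cell of [y k] in that
   face. *)
pose cell k := (fc k, 0 < (y k - c) 0 (fc k), [ffun j : 'I_N => inord (Num.truncn (w k (lift (fc k) j))) : 'I_Q.+1]).
have inj : injective cell.
  move=> k k' [efc esg /ffunP ecell].
  have close j : `|y k 0 j - y k' 0 j| < d / (M%:R * L).
    have lt0 : 0 < d / (M%:R * L) by rewrite divr_gt0 // mulr_gt0.
    have [->|/eqP jf] := eqVneq j (fc k).
      have h1 := hfc k; have h2 := hfc k'; rewrite -efc in h2.
      suff -> : y k 0 (fc k) = y k' 0 (fc k) by rewrite subrr normr0.
      apply: (addIr (- c 0 (fc k))).
      move: h1 h2 esg; rewrite -efc !mxE.
      by case: ltP => s1; case: ltP => s2 // h1 h2 _; rewrite ?(gtr0_norm s1) ?(gtr0_norm s2) ?(ler0_norm s1) ?(ler0_norm s2) in h1 h2; lra.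
    have [j' jj'] : exists j', j = lift (fc k) j'.
      by move/eqP: jf; rewrite eq_sym => /unlift_some[j' -> _]; exists j'.
    have := ecell j'; rewrite !ffunE -efc -jj' => /(congr1 val).
    have trQ k0 : (Num.truncn (w k0 j) < Q.+1)%N.
      by rewrite ltnS -(ler_nat R); apply: le_trans (wQ k0 j); have /andP[] := truncn_itv (w0 k0 j).
    rewrite /= !inordK // => et.
    have /andP[a1 a2] := truncn_itv (w0 k j); have /andP[b1 b2] := truncn_itv (w0 k' j).
    rewrite et -natr1 in a1 a2; rewrite -natr1 in b2.
    have ww : `|w k j - w k' j| < 1 by rewrite ltr_norml; lra.
    have -> : y k 0 j - y k' 0 j = (w k j - w k' j) * (2 * e / Q%:R).
      rewrite /w !mxE; field; rewrite !gt_eqF //.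
    rewrite normrM [X in _ * X]ger0_norm ?divr_ge0 ?mulr_ge0 ?ltW //.
    apply: le_lt_trans (_ : 1 * (2 * e / Q%:R) < _).
      by rewrite ler_wpM2r ?divr_ge0 ?mulr_ge0 ?ltW.
    rewrite mul1r ltr_pdivrMr // mulrAC ltr_pdivlMr ?mulr_gt0 // natrM.
    rewrite ltr_pdivrMr // in hq.
    have := hq; rewrite -(ltr_pM2r M0); lra.
  have vv : `|v k - v k'| < d / M%:R.
    rewrite -(hy k).2 -(hy k').2; apply: le_lt_trans (PL _ _) _.
    rewrite mulrC -ltr_pdivlMr // -mulrA -invfM rV_norm_lt; last first.
      by rewrite divr_gt0 // mulr_gt0.
    by apply/forallP => j; rewrite !mxE close.
  apply/ffunP => j; apply/val_inj.
  have := le_lt_trans (rV_coord_le (v k - v k') j) vv; rewrite !mxE -mulrBr normrM.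
  rewrite ger0_norm ?divr_ge0 ?(ltW d0) // gtr_pMr ?divr_gt0 // => h.
  move: h; rewrite ltr_norml => /andP[h1 h2].
  by apply/eqP; rewrite eqn_leq; apply/andP; split; rewrite -ltnS -(ltr_nat R) -natr1; lra.
have := leq_card cell inj; rewrite card_ffun !card_prod !card_ffun !card_ord card_bool.
apply/negP; rewrite -ltnNge.
apply: (@leq_ltn_trans (N.+1 * 2 * (q.+1 * M) ^ N)%N).
  rewrite leq_mul2l; apply/orP; right; case: (N) => [|N'] //.
  by rewrite leq_exp2r // mulSn -addn1 addnC leq_add.
by rewrite expnMn expnS mulnA ltn_pmul2r ?expn_gt0.
Qed.

Lemma tietze_rV (R : realType) (N : nat) (V : normedModType R) (K : set V) (g : V -> 'rV[R]_N) (r : R) :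
  0 < r -> closed K -> {within K, continuous g} -> (forall x, K x -> `|g x| <= r) ->
  exists G : V -> 'rV[R]_N, [/\ forall x, K x -> G x = g x, continuous G & forall x, `|G x| <= r].
Proof.
move=> r0 cK cg gr.
have /choice[G hG] : forall i, exists Gi : V -> R,
    [/\ {in K, (fun x => g x 0 i) =1 Gi}, continuous Gi & forall x, `|Gi x| <= r].
  move=> i; apply: (continuous_bounded_extension (@pseudometric_normal _ _)) => //.
    apply/within_continuousE => x Kx e e0.
    have [d d0 hd] := (within_continuousE _ _).1 cg x Kx e e0.
    exists d => // y Ky /(hd y Ky); apply: le_lt_trans.
    by have := rV_coord_le (g x - g y) i; rewrite !mxE.
  by move=> x /gr; apply: le_trans; exact: rV_coord_le.
exists (fun x => \row_i G i x); split.
- move=> x Kx; apply/rowP => i; rewrite mxE; have [h _ _] := hG i.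
  by rewrite -h //; exact/mem_set.
- move=> x; apply/cvgrPdist_lt => e e0; near=> y.
  rewrite rV_norm_lt //; apply/forallP; near: y; apply: filter_forall => i.
  have [_ /(_ x)/cvgrPdist_lt/(_ e e0) h _] := hG i.
  by apply: filterS h => y; rewrite !mxE.
- move=> x; rewrite rV_norm_le ?ltW //; apply/forallP => i; rewrite mxE.
  by have [_ _ ] := hG i.
Unshelve. all: end_near. Qed.

Lemma within_continuous_comp (R : realType) (U V W : normedModType R) (A : set U) (B : set V)
    (f : U -> V) (g : V -> W) : (forall x, A x -> B (f x)) ->
  {within A, continuous f} -> {within B, continuous g} -> {within A, continuous (g \o f)}.
Proof.
move=> AB /within_continuousE cf /within_continuousE cg; apply/within_continuousE => x Ax e e0.
have [d d0 hd] := cg _ (AB x Ax) e e0; have [d' d'0 hd'] := cf x Ax d d0.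
by exists d' => // y Ay /(hd' y Ay) /hd; apply; exact: AB.
Qed.

(* Tao's argument: were h 0 not interior, the identity g o h could be perturbed
   to a map without zeros, by pushing the image off a small sphere around a
   missed point c and using that P avoids some v on that sphere. *)
Lemma embedding_interior0 (R : realType) (N : nat) (r : R) (h g : 'rV[R]_N -> 'rV[R]_N) :
  let B := [set x : 'rV[R]_N | `|x| <= r] in
  0 < r -> {within B, continuous h} -> (forall x, B x -> g (h x) = x) ->
  {within h @` B, continuous g} -> nbhs (h 0) (h @` B).
Proof.
move=> B r0 ch gh cg; set K := h @` B.
have cB : compact B.
  rewrite (_ : B = [set x | `|x - 0| <= r]); first exact: closed_cube_compact.
  by apply/seteqP; split=> x; rewrite /B /= subr0.
have cK : compact K by apply: continuous_compact.
have clK : closed K by apply: compact_closed => //; exact: norm_hausdorff.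
have [G [Gg cG Gr]] : exists G : 'rV[R]_N -> 'rV[R]_N,
    [/\ forall x, K x -> G x = g x, continuous G & forall x, `|G x| <= r].
  by apply: tietze_rV => // _ [x Bx <-]; rewrite gh.
have Gh x : B x -> G (h x) = x by move=> Bx; rewrite Gg ?gh //; exists x.
have B0 : B 0 by rewrite /B /= normr0 ltW.
apply: contrapT => ni.
(* Near [h 0] the map [G] is small, so moving points there to a small sphere changes [G] by less
   than the tolerance [r]. *)
have [e e0 he] : exists2 e, 0 < e & forall y, `|h 0 - y| < 2 * e -> `|G y| < r / 4.
  have r4 : 0 < r / 4 by rewrite divr_gt0.
  have /cvgrPdist_lt/(_ _ r4)/nbhs_normP[d /= d0 hd] := cG (h 0).
  exists (d / 2) => [|y]; first by rewrite divr_gt0.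
  rewrite mulrC divfK // => /hd; by rewrite Gh // sub0r normrN.
have [c cK' hc] : exists2 c, ~ K c & `|h 0 - c| < e.
  apply: contrapT => H; apply: ni; apply/nbhs_ballP; exists e => //= y; rewrite -ball_normE /= => ye.
  by apply: contrapT => Ky; apply: H; exists y.
(* On [K] the map [G] vanishes only at [h 0], which the condition [e <= |y - c|] excludes. *)
have [m m0 hm] : exists2 m, 0 < m & forall y, (K `&` [set y | e <= `|y - c|]) y -> m <= `|G y|.
  apply: compact_pos_lower_bound.
  - apply: (subclosed_compact _ cK) => [|y []//]; apply: closedI => //.
    rewrite (_ : [set y | _] = (fun x => `|x - c|) @^-1` [set y | e <= y]) //.
    apply: closed_comp => [x _|]; last exact: closed_ge.
    by apply: continuous_comp; [apply: continuousB => //; exact: cst_continuous|exact: norm_continuous].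
  - by apply: continuous_subspaceT => x; apply: continuous_comp; [exact: cG|exact: norm_continuous].
  - move=> _ [[x Bx <-] /= xc]; rewrite Gh // normr_gt0; apply/eqP => x0.
    by move: xc; rewrite x0 leNgt hc.
pose d := Num.min (m / 4) (r / 8).
have d0 : 0 < d by rewrite lt_min !divr_gt0.
have [dm dr] : d <= m / 4 /\ d <= r / 8 by split; rewrite ge_min lexx ?orbT.
have cS : compact (K `|` [set y | `|y - c| <= e]).
  by apply: compactU => //; exact: closed_cube_compact.
have /choice[P hP] : forall i, exists P : 'rV[R]_N -> R, exists2 L, 0 < L &
    (forall x y, `|P x - P y| <= L * `|x - y|) /\
    (forall x, (K `|` [set y | `|y - c| <= e]) x -> `|P x - G x 0 i| <= d).
  move=> i; apply: (lipschitz_approx (M := r) cS _ _ d0).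
    move=> x; apply: (@continuous_comp _ _ _ G (fun M : 'rV[R]_N => M 0 i)); first exact: cG.
    exact: coord_continuous.
  by move=> x; apply: le_trans (rV_coord_le _ _) (Gr x).
pose Pv y : 'rV[R]_N := \row_i P i y.
have [L L0 PvL] : exists2 L, 0 < L & forall x y, `|Pv x - Pv y| <= L * `|x - y|.
  have /choice[Ls hL] : forall i, exists L, 0 < L /\ forall x y, `|P i x - P i y| <= L * `|x - y|.
    by move=> i; have [L L0 [h1 _]] := hP i; exists L.
  have L0 : 0 <= \sum_i Ls i by apply: sumr_ge0 => i _; exact: ltW (hL i).1.
  exists (1 + \sum_i Ls i); first by rewrite ltr_pwDl.
  move=> x y; rewrite rV_norm_le ?mulr_ge0 ?addr_ge0 //; apply/forallP => i; rewrite !mxE.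
  apply: le_trans ((hL i).2 x y) _; rewrite ler_wpM2r //.
  rewrite (bigD1 i) //= addrCA lerDl addr_ge0 // sumr_ge0 // => j _; exact: ltW (hL j).1.
have PvG y : (K `|` [set y | `|y - c| <= e]) y -> `|Pv y - G y| <= d.
  move=> hy; rewrite rV_norm_le ?ltW //; apply/forallP => i; rewrite !mxE.
  by have [_ _ [_ ]] := hP i; apply.
have [v vd hv] := lipschitz_sphere_avoid c L0 PvL e0 d0.
have yc y : K y -> 0 < `|y - c|.
  by move=> Ky; rewrite normr_gt0 subr_eq0; apply/eqP => yc; apply: cK'; rewrite -yc.
(* Radial push out of the ball of radius [e] about [c]; continuous on [K] because [c] is not in
   [K]. *)
pose Phi y := c + Num.max 1 (e / `|y - c|) *: (y - c).
have Phi1 y : e <= `|y - c| -> Phi y = y.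
  move=> ey; rewrite /Phi max_l; first by rewrite scale1r addrC subrK.
  by rewrite ler_pdivrMr ?mul1r //; exact: lt_le_trans e0 ey.
have Phi2 y : K y -> `|y - c| < e -> `|Phi y - c| = e.
  move=> Ky ye; rewrite /Phi max_r; last by rewrite ler_pdivlMr ?mul1r ?ltW // yc.
  rewrite addrAC subrr add0r normrZ ger0_norm ?divfK ?gt_eqF ?yc // divr_ge0 // ltW //.
have cPhi : {within K, continuous Phi}.
  apply: continuous_in_subspaceT => y /set_mem Ky.
  have cyc : (fun z => z - c) @ y --> y - c.
    by apply: (@continuousB _ _ _ id (fun=> c)) => //; exact: cst_continuous.
  have cc (k : R) : (fun=> k) @ y --> k by exact: cst_continuous.
  have yc0 : `|y - c| != 0 by rewrite gt_eqF // yc.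
  have ce : (fun z => e / `|z - c|) @ y --> e / `|y - c|.
    exact: (cvgM (cc e) (cvgV yc0 (cvg_norm cyc))).
  have cv : (fun=> c) @ y --> c by exact: (@cst_continuous _ _ c y).
  have cm : (fun z => Num.max 1 (e / `|z - c|)) @ y --> Num.max 1 (e / `|y - c|).
    under eq_fun do rewrite maxr_absE; rewrite maxr_absE.
    exact: (cvgM (cvgD (cvgD (cc 1) ce) (cvg_norm (cvgB (cc 1) ce))) (cc 2^-1)).
  exact: (cvgD cv (cvgZ cm cyc)).
(* A zero of [f] means that [Pv] takes the value [v] at [Phi (h x)]: impossible on the sphere by the
   choice of [v], and elsewhere because [|G| >= m] while [Pv - G] and [v] are at most
   [d <= m / 4]. *)
pose f x := Pv (Phi (h x)) - v.
have [||x xr fx0] := near_identity_zero (f := f) r0.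
- apply/within_continuousE => x Bx eps eps0.
  have : {within B, continuous (Phi \o h)} by apply: within_continuous_comp ch cPhi => y By; exists y.
  move=> /within_continuousE/(_ x Bx (eps / L)); rewrite divr_gt0 // => /(_ isT)[d' d'0 hd'].
  exists d' => // y By /(hd' y By) /= hh; rewrite /f opprB addrA subrK.
  by apply: le_lt_trans (PvL _ _) _; rewrite mulrC -ltr_pdivlMr.
- move=> x xr; have Kx : K (h x) by exists x.
  have Ghx := Gh x xr.
  have [hxc|hxc] := leP e `|h x - c|.
    rewrite /f Phi1 // -{2}Ghx (_ : _ - v - _ = (Pv (h x) - G (h x)) - v); last by rewrite addrAC.
    have := PvG (h x) (or_introl Kx); have := ler_normB (Pv (h x) - G (h x)) v; lra.
  rewrite /f; set z := Phi (h x).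
  have zc : `|z - c| = e by exact: Phi2.
  have := PvG z (or_intror _); rewrite /= zc lexx => /(_ isT) h1.
  have h2 : `|G z| < r / 4.
    by apply: he; have := ler_distD c (h 0) z; rewrite (distrC c) zc; lra.
  have h3 : `|x| < r / 4.
    by rewrite -Ghx; apply: he; have := ler_distD c (h 0) (h x); rewrite (distrC c); lra.
  rewrite (_ : _ - v - x = (Pv z - G z) + (G z - v - x)); last by rewrite !addrA subrK.
  have := ler_normD (Pv z - G z) (G z - v - x); have := ler_normB (G z - v) x.
  have := ler_normB (G z) v; lra.
have Kx : K (h x) by exists x.
have Pv_v : Pv (Phi (h x)) = v by apply/eqP; rewrite -subr_eq0; apply/eqP.
have [hxc|hxc] := leP e `|h x - c|; last by apply: (hv _ (Phi2 _ Kx hxc)).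
rewrite Phi1 // in Pv_v.
have := hm _ (conj Kx hxc); have := PvG (h x) (or_introl Kx); rewrite Pv_v.
have := ler_normD (v - G (h x)) (- v); rewrite addrAC subrr add0r !normrN; lra.
Qed.

Lemma embedding_interior (R : realType) (N : nat) (r : R) (p : 'rV[R]_N) (h g : 'rV[R]_N -> 'rV[R]_N) :
  let B := [set x : 'rV[R]_N | `|x - p| <= r] in
  0 < r -> {within B, continuous h} -> (forall x, B x -> g (h x) = x) ->
  {within h @` B, continuous g} -> nbhs (h p) (h @` B).
Proof.
move=> B r0 /within_continuousE ch gh /within_continuousE cg.
pose B0 := [set x : 'rV[R]_N | `|x| <= r].
have E : (fun x => h (x + p)) @` B0 = h @` B.
  apply/seteqP; split=> _ [x xr <-].
    by exists (x + p) => //; rewrite /B /= addrK.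
  by exists (x - p) => //=; rewrite subrK.
rewrite -E -[X in h X]add0r.
apply: (@embedding_interior0 R N r (fun x => h (x + p)) (fun y => g y - p)) => //.
- apply/within_continuousE => x xr e e0.
  have [|d d0 hd] := ch (x + p) _ e e0; first by rewrite /B /= addrK.
  exists d => // y yr xy; apply: hd; first by rewrite /B /= addrK.
  by rewrite opprD addrACA subrr addr0.
- by move=> x xr; rewrite gh ?addrK // /B /= addrK.
- rewrite E; apply/within_continuousE => y Ky e e0; have [d d0 hd] := cg y Ky e e0.
  by exists d => // z Kz /(hd z Kz); rewrite opprB addrA subrK.
Qed.

Lemma near_identity_image (R : realType) (N : nat) (r e : R) (p q : 'rV[R]_N) (f : 'rV[R]_N -> 'rV[R]_N) :
  0 < r -> {within [set x | `|x - p| <= r], continuous f} ->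
  (forall x, `|x - p| <= r -> `|f x - x| <= e) -> `|q - p| <= r - e ->
  exists2 x, `|x - p| <= r & f x = q.
Proof.
move=> r0 /within_continuousE cf fe qp.
have [||x xr /eqP] := near_identity_zero (f := fun x => f (x + p) - q) r0.
- apply/within_continuousE => x xr eps eps0.
  have [|d d0 hd] := cf (x + p) _ eps eps0; first by rewrite /= addrK.
  exists d => // y yr xy; rewrite opprB addrA subrK; apply: hd; first by rewrite /= addrK.
  by rewrite opprD addrACA subrr addr0.
- move=> x xr; have := fe (x + p); rewrite addrK => /(_ xr) h.
  rewrite (_ : _ - x = (f (x + p) - (x + p)) - (q - p)); last by apply/rowP => i; rewrite !mxE; ring.
  by have := ler_normB (f (x + p) - (x + p)) (q - p); lra.
by rewrite subr_eq0 => /eqP h; exists (x + p); rewrite ?addrK.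
Qed.

(** * Complex numbers and winding numbers *)

Section ComplexNumbers.
Variable R : realType.
Notation C := (Cplx R).
Implicit Types z w : C.

Definition cRe z : R := complex.Re z.
Definition cIm z : R := complex.Im z.
Definition toC (x : R) : C := real_complex R x.
(** The norm of [C] is itself an element of [C]; [cabs], and later [vabs], move it to [R], where the
    order is total. *)
Definition cabs z : R := cRe `|z|.
Definition Ci : C := Complex 0 1.

HB.instance Definition _ := GRing.RMorphism.copy toC (real_complex R).

Lemma cnormE z : `|z| = toC (cabs z).
Proof. by []. Qed.

Lemma cRe_toC x : cRe (toC x) = x. Proof. by []. Qed.
Lemma cIm_toC x : cIm (toC x) = 0. Proof. by []. Qed.
Lemma cReD z w : cRe (z + w) = cRe z + cRe w. Proof. by case: z w => [a b] []. Qed.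
Lemma cImD z w : cIm (z + w) = cIm z + cIm w. Proof. by case: z w => [a b] []. Qed.
Lemma cReN z : cRe (- z) = - cRe z. Proof. by case: z. Qed.
Lemma cImN z : cIm (- z) = - cIm z. Proof. by case: z. Qed.
Lemma cReM z w : cRe (z * w) = cRe z * cRe w - cIm z * cIm w.
Proof. by case: z w => [a b] []. Qed.
Lemma cImM z w : cIm (z * w) = cRe z * cIm w + cIm z * cRe w.
Proof. by case: z w => [a b] []. Qed.

Lemma toC_le x y : (toC x <= toC y) = (x <= y). Proof. exact: lecR. Qed.
Lemma toC_lt x y : (toC x < toC y) = (x < y). Proof. exact: ltcR. Qed.
Lemma toC_inj : injective toC. Proof. by move=> x y []. Qed.

Lemma cplx_eq z w : cRe z = cRe w -> cIm z = cIm w -> z = w.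
Proof. by case: z w => [a b] [c d] /= -> ->. Qed.

Lemma cplxE z : z = toC (cRe z) + Ci * toC (cIm z).
Proof. by apply: cplx_eq; rewrite ?cReD ?cImD ?cReM ?cImM /=; ring. Qed.

Lemma cabs_ge0 z : 0 <= cabs z.
Proof. by rewrite -toC_le -cnormE rmorph0. Qed.
Lemma cabs0 : cabs 0 = 0. Proof. by rewrite /cabs normr0. Qed.
Lemma cabs1 : cabs 1 = 1. Proof. by rewrite /cabs normr1. Qed.
Lemma cabs_eq0 z : (cabs z == 0) = (z == 0).
Proof. by rewrite -[RHS]normr_eq0 cnormE -(inj_eq toC_inj) rmorph0. Qed.
Lemma cabs_gt0 z : (0 < cabs z) = (z != 0).
Proof. by rewrite lt_def cabs_ge0 andbT cabs_eq0. Qed.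
Lemma cabsM z w : cabs (z * w) = cabs z * cabs w.
Proof. by apply: toC_inj; rewrite rmorphM -!cnormE normrM. Qed.
Lemma cabsX z n : cabs (z ^+ n) = cabs z ^+ n.
Proof. by elim: n => [|n IH]; rewrite ?expr0 ?cabs1 // !exprS cabsM IH. Qed.
Lemma cabsV z : cabs z^-1 = (cabs z)^-1.
Proof. by apply: toC_inj; rewrite fmorphV -!cnormE normfV. Qed.
Lemma cabs_prod I (r : seq I) (P : pred I) F : cabs (\prod_(i <- r | P i) F i) = \prod_(i <- r | P i) cabs (F i).
Proof. by apply: (big_morph cabs cabsM cabs1). Qed.
Lemma cabsN z : cabs (- z) = cabs z. Proof. by rewrite /cabs normrN. Qed.
Lemma cabsC z w : cabs (z - w) = cabs (w - z). Proof. by rewrite /cabs distrC. Qed.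
Lemma cabsD z w : cabs (z + w) <= cabs z + cabs w.
Proof. by rewrite -toC_le rmorphD -!cnormE ler_normD. Qed.
Lemma cabsB z w : cabs (z - w) <= cabs z + cabs w.
Proof. by rewrite -[cabs w]cabsN; exact: cabsD. Qed.
Lemma cabs_distD t z w : cabs (z - w) <= cabs (z - t) + cabs (t - w).
Proof. by apply: le_trans (cabsD _ _); rewrite addrA subrK. Qed.
Lemma cabs_sum I (r : seq I) (P : pred I) F : cabs (\sum_(i <- r | P i) F i) <= \sum_(i <- r | P i) cabs (F i).
Proof.
elim/big_ind2: _ => [|x a y b xa yb|//]; first by rewrite cabs0.
by apply: le_trans (cabsD _ _) _; exact: lerD.
Qed.
Lemma cabs_toC x : cabs (toC x) = `|x|.
Proof. by rewrite /cabs normc_def /cRe /= expr0n addr0 sqrtr_sqr. Qed.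
Lemma cabs_nat n : cabs n%:R = n%:R.
Proof. by rewrite -(rmorph_nat toC) cabs_toC normr_nat. Qed.
Lemma cabs_sqr z : cabs z ^+ 2 = cRe z ^+ 2 + cIm z ^+ 2.
Proof. by rewrite /cabs normc_def /= sqr_sqrtr // addr_ge0 ?sqr_ge0. Qed.
Lemma cRe_le z : `|cRe z| <= cabs z.
Proof.
rewrite -(@ler_pXn2r _ 2) ?nnegrE ?cabs_ge0 // cabs_sqr real_normK ?num_real //.
by rewrite lerDl sqr_ge0.
Qed.
Lemma cIm_le z : `|cIm z| <= cabs z.
Proof.
rewrite -(@ler_pXn2r _ 2) ?nnegrE ?cabs_ge0 // cabs_sqr real_normK ?num_real //.
by rewrite lerDr sqr_ge0.
Qed.
Lemma cabs_le z : cabs z <= `|cRe z| + `|cIm z|.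
Proof.
rewrite {1}[z]cplxE; apply: le_trans (cabsD _ _) _; rewrite cabsM !cabs_toC lerD2l.
by rewrite (_ : cabs Ci = 1) ?mul1r // /cabs normc_def /cRe /= expr0n add0r expr1n sqrtr1.
Qed.

Lemma cnbhsP z (A : set C) :
  nbhs z A <-> exists2 e : R, 0 < e & forall w, cabs (z - w) < e -> A w.
Proof.
split=> [/nbhs_ballP[e /= e0 h]|[e e0 h]].
  have er : e = toC (cRe e) by rewrite -(RRe_real (gtr0_real e0)).
  have e1 : 0 < cRe e by rewrite -toC_lt -er rmorph0.
  exists (cRe e) => // w zw; apply: h; rewrite -ball_normE /=.
  by rewrite er cnormE toC_lt.
apply/nbhs_ballP; exists (toC e) => /=; first by rewrite -(rmorph0 toC) toC_lt.
by move=> w; rewrite -ball_normE /= cnormE toC_lt; exact: h.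
Qed.

Lemma cRe_continuous : continuous cRe.
Proof.
move=> z A /nbhs_normP[e e0 h]; apply/cnbhsP; exists e => // w zw; apply: h.
by apply: le_lt_trans zw; rewrite -cReN -cReD cRe_le.
Qed.
Lemma cIm_continuous : continuous cIm.
Proof.
move=> z A /nbhs_normP[e e0 h]; apply/cnbhsP; exists e => // w zw; apply: h.
by apply: le_lt_trans zw; rewrite -cImN -cImD cIm_le.
Qed.
Lemma cabs_dist z w : `|cabs z - cabs w| <= cabs (z - w).
Proof.
rewrite ler_norml; apply/andP; split.
  by rewrite lerNl opprB lerBlDr cabsC -{1}[w](subrK z) cabsD.
by rewrite lerBlDr -{1}[z](subrK w) cabsD.
Qed.
Lemma cabs_continuous : continuous cabs.
Proof.
move=> z A /nbhs_normP[e e0 h]; apply/cnbhsP; exists e => // w zw; apply: h.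
by apply: le_lt_trans zw; exact: cabs_dist.
Qed.
Lemma toC_continuous : continuous toC.
Proof.
move=> x A /cnbhsP[e e0 h]; apply/nbhs_normP; exists e => // y /= xy; apply: h.
by rewrite -rmorphB cabs_toC.
Qed.

Variable n : nat.
Implicit Types x y : 'rV[C]_n.

Definition vabs x : R := `|map_mx cabs x|.

Lemma vabs_le x e : 0 <= e -> (vabs x <= e) = [forall i, cabs (x 0 i) <= e].
Proof.
move=> e0; rewrite /vabs rV_norm_le //; apply: eq_forallb => i.
by rewrite mxE ger0_norm // cabs_ge0.
Qed.
Lemma vabs_lt x e : 0 < e -> (vabs x < e) = [forall i, cabs (x 0 i) < e].
Proof.
move=> e0; rewrite /vabs rV_norm_lt //; apply: eq_forallb => i.
by rewrite mxE ger0_norm // cabs_ge0.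
Qed.
Lemma vabs_coord x i : cabs (x 0 i) <= vabs x.
Proof. by have := rV_coord_le (map_mx cabs x) i; rewrite mxE ger0_norm // cabs_ge0. Qed.
Lemma vabs_ge0 x : 0 <= vabs x. Proof. exact: normr_ge0. Qed.
Lemma vabs0 : vabs 0 = 0.
Proof. by apply/le_anti; rewrite vabs_ge0 vabs_le // andbT; apply/forallP => i; rewrite mxE cabs0. Qed.
Lemma vabsN x : vabs (- x) = vabs x.
Proof. by congr `|_|; apply/rowP => i; rewrite !mxE cabsN. Qed.
Lemma vabsC x y : vabs (x - y) = vabs (y - x). Proof. by rewrite -vabsN opprB. Qed.
Lemma vabsD x y : vabs (x + y) <= vabs x + vabs y.
Proof.
rewrite vabs_le ?addr_ge0 ?vabs_ge0 //; apply/forallP => i; rewrite mxE.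
by apply: le_trans (cabsD _ _) _; rewrite lerD ?vabs_coord.
Qed.
Lemma vabs_distD t x y : vabs (x - y) <= vabs (x - t) + vabs (t - y).
Proof. by apply: le_trans (vabsD _ _); rewrite addrA subrK. Qed.
Lemma vabsZ a x : vabs (a *: x) = cabs a * vabs x.
Proof.
rewrite /vabs; have -> : map_mx cabs (a *: x) = cabs a *: map_mx cabs x.
  by apply/rowP => i; rewrite !mxE cabsM.
by rewrite normrZ ger0_norm // cabs_ge0.
Qed.
Lemma vnbhsP x (A : set 'rV[C]_n) :
  nbhs x A <-> exists2 e : R, 0 < e & forall y, vabs (x - y) < e -> A y.
Proof.
split=> [/nbhs_ballP[e /= e0 h]|[e e0 h]].
  have er : e = toC (cRe e) by rewrite -(RRe_real (gtr0_real e0)).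
  have e1 : 0 < cRe e by rewrite -toC_lt -er rmorph0.
  exists (cRe e) => // y; rewrite vabs_lt // => /forallP xy; apply: h; split=> // i j.
  by rewrite ord1 -ball_normE /= er cnormE toC_lt; have := xy j; rewrite !mxE.
apply/nbhs_ballP; exists (toC e) => /=; first by rewrite -(rmorph0 toC) toC_lt.
move=> y [_ xy]; apply: h; rewrite vabs_lt //; apply/forallP => i.
by rewrite !mxE -toC_lt -cnormE; have := xy 0 i; rewrite -ball_normE.
Qed.

End ComplexNumbers.
Arguments toC {R}. Arguments cRe {R}. Arguments cIm {R}. Arguments cabs {R}.
Arguments Ci {R}.

Lemma within_comp (X Y Z : topologicalType) (A : set X) (B : set Y) (f : X -> Y) (g : Y -> Z) :
  (forall x, A x -> B (f x)) -> {within A, continuous f} -> {within B, continuous g} ->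
  {within A, continuous (g \o f)}.
Proof.
move=> AB /subspace_continuousP cf /subspace_continuousP cg.
apply/subspace_continuousP => x Ax N /(cg _ (AB x Ax)) gN.
by have := cf x Ax _ gN; apply: filterS2 (withinT A _) => //= y Ay h; exact/h/AB.
Qed.

Lemma within_comp_continuous (X Y Z : topologicalType) (A : set X) (f : X -> Y) (g : Y -> Z) :
  {within A, continuous f} -> continuous g -> {within A, continuous (g \o f)}.
Proof. by move=> cf cg; apply: (within_comp (B := setT)) => //; exact: continuous_subspaceT. Qed.

Lemma within_continuous_prod (K : numFieldType) (X : topologicalType) (A : set X) (f g : X -> K) :
  {within A, continuous f} -> {within A, continuous g} -> {within A, continuous (fun x => f x * g x)}.
Proof.
move=> /subspace_continuousP cf /subspace_continuousP cg; apply/subspace_continuousP => x Ax.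
by apply: cvgM; [exact: cf|exact: cg].
Qed.

Lemma within_continuous_add (K : numFieldType) (X : topologicalType) (A : set X) (V : normedModType K) (f g : X -> V) :
  {within A, continuous f} -> {within A, continuous g} -> {within A, continuous (fun x => f x + g x)}.
Proof.
move=> /subspace_continuousP cf /subspace_continuousP cg; apply/subspace_continuousP => x Ax.
by apply: cvgD; [exact: cf|exact: cg].
Qed.

Lemma within_continuous_sub (K : numFieldType) (X : topologicalType) (A : set X) (V : normedModType K) (f g : X -> V) :
  {within A, continuous f} -> {within A, continuous g} -> {within A, continuous (fun x => f x - g x)}.
Proof.
move=> /subspace_continuousP cf /subspace_continuousP cg; apply/subspace_continuousP => x Ax.
by apply: cvgB; [exact: cf|exact: cg].
Qed.

Lemma cvg_sum_seq (K : numFieldType) (V : normedModType K) (T I : Type) (G : set_system T) (FG : Filter G)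
    (r : seq I) (F : I -> T -> V) (l : I -> V) :
  (forall i, F i @ G --> l i) -> (fun x => \sum_(i <- r) F i x) @ G --> \sum_(i <- r) l i.
Proof.
move=> h; elim: r => [|i r IH].
  by under eq_fun do rewrite big_nil; rewrite big_nil; exact: cvg_cst.
by under eq_fun do rewrite big_cons; rewrite big_cons; exact: (cvgD (h i) IH).
Qed.

Section Winding.
Variable R : realType.
Notation C := (Cplx R).
Implicit Types z w : C.

Definition cis (t : R) : C := Complex (cos t) (sin t).

Lemma cisD a b : cis (a + b) = cis a * cis b.
Proof. by apply: cplx_eq; rewrite ?cReM ?cImM /cRe /cIm /= ?cosD ?sinD // addrC. Qed.
Lemma cis0 : cis 0 = 1.
Proof. by apply: cplx_eq; rewrite /cRe /cIm /= ?cos0 ?sin0. Qed.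
Lemma cabs_cis t : cabs (cis t) = 1.
Proof. by apply/eqP; rewrite -(@eqrXn2 _ 2) ?cabs_ge0 // cabs_sqr /= cos2Dsin2 expr1n. Qed.
Lemma cis_neq0 t : cis t != 0.
Proof. by rewrite -cabs_gt0 cabs_cis. Qed.
Lemma cisV t : cis (- t) = (cis t)^-1.
Proof. by apply: (mulIf (cis_neq0 t)); rewrite mulVf ?cis_neq0 // -cisD addNr cis0. Qed.
Lemma cis_continuous : continuous cis.
Proof.
move=> t A /cnbhsP[e e0 h]; have e2 : 0 < e / 2 by rewrite divr_gt0.
have /cvgrPdist_lt/(_ _ e2) h1 := @continuous_cos R t.
have /cvgrPdist_lt/(_ _ e2) h2 := @continuous_sin R t.
apply: filterS2 h1 h2 => s h1 h2; apply: h; rewrite (splitr e).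
apply: le_lt_trans (cabs_le _) _; rewrite cReD cReN cImD cImN /cRe /cIm /=.
exact: ltrD.
Qed.

Lemma cos_eq1_small (s : R) : 0 < s < 2 * pi -> cos s != 1.
Proof.
move=> /andP[s0 s2]; have p0 := pi_gt0 R.
wlog sp : s s0 s2 / s <= pi => [H|].
  have [/H|sp] := leP s pi; first exact.
  rewrite -cosN -cosD2pi; apply: H; rewrite mulr2n; lra.
rewrite -cos0; apply/eqP => /cos_inj; rewrite !in_itv /= lexx (ltW p0) (ltW s0) sp.
by move=> /(_ isT isT) s00; rewrite s00 ltxx in s0.
Qed.

Lemma cis_int (k : int) : cis (k%:~R * (2 * pi)) = 1.
Proof.
have c1 : cis (2 * pi) = 1.
  by apply: cplx_eq; rewrite /cRe /cIm /= mulr_natl ?cos2pi ?sin2pi.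
have cn (n : nat) : cis (n%:R * (2 * pi)) = 1.
  by elim: n => [|n IH]; rewrite ?mul0r ?cis0 // -natr1 mulrDl mul1r cisD IH c1 mulr1.
by case: k => n; [exact: cn|rewrite NegzE mulrNz mulNr cisV cn invr1].
Qed.

Lemma cis_eq1 t : cis t = 1 -> exists k : int, t = k%:~R * (2 * pi).
Proof.
move=> ct; have p2 : 0 < 2 * pi :> R by rewrite mulr_gt0 // pi_gt0.
pose k := Num.floor (t / (2 * pi)); exists k.
pose s := t - k%:~R * (2 * pi).
have cs : cis s = 1 by rewrite cisD ct mul1r cisV cis_int invr1.
have s0 : 0 <= s by rewrite subr_ge0 -ler_pdivlMr // floor_le.
have s1 : s < 2 * pi.
  have := floorD1_gt (t / (2 * pi)); rewrite intrD mulr1z ltr_pdivrMr // -/k /s; lra.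
apply/eqP; rewrite -subr_eq0 -/s; apply: contraT => sn0.
have /cos_eq1_small/eqP[] : 0 < s < 2 * pi by rewrite lt_def sn0 s0.
by have := congr1 cRe cs.
Qed.

(** [t] is an argument of [z]; for [z = 0] every [t] is one. *)
Definition polar z (t : R) := z = toC (cabs z) * cis t.

Lemma polarM z w a b : polar z a -> polar w b -> polar (z * w) (a + b).
Proof. by move=> pz pw; rewrite /polar cabsM rmorphM cisD mulrACA -pz -pw. Qed.

Lemma polar_uniq z a b : z != 0 -> polar z a -> polar z b -> cis (a - b) = 1.
Proof.
move=> z0 pz; rewrite /polar {1}pz => /mulfI h; rewrite cisD cisV h ?divff ?cis_neq0 //.
by rewrite fmorph_eq0 cabs_eq0.
Qed.

Lemma polar_cis r t : 0 <= r -> polar (toC r * cis t) t.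
Proof. by move=> r0; rewrite /polar cabsM cabs_toC cabs_cis mulr1 ger0_norm. Qed.

(** On the right half-plane the argument is a continuous function of [z]; liftings of angles are
    assembled from this one. *)
Lemma polar_atan z : 0 < cRe z -> polar z (atan (cIm z / cRe z)).
Proof.
move=> z0; set q := cIm z / cRe z.
have s0 : 0 < Num.sqrt (1 + q ^+ 2) by rewrite sqrtr_gt0 ltr_wpDr ?sqr_ge0.
have ez : cabs z = cRe z * Num.sqrt (1 + q ^+ 2).
  apply/eqP; rewrite -(@eqrXn2 _ 2) ?cabs_ge0 ?mulr_ge0 ?(ltW z0) ?(ltW s0) //.
  rewrite cabs_sqr exprMn sqr_sqrtr ?addr_ge0 ?sqr_ge0 // /q; apply/eqP; field.
  by rewrite gt_eqF.
have cq := cos_atan q.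
have sq : sin (atan q) = q * cos (atan q).
  have := atanK q; rewrite /tan => {2}<-; rewrite divfK // cq invr_eq0 gt_eqF //.
apply: cplx_eq; rewrite ?cReM ?cImM cRe_toC cIm_toC /cRe /cIm /= ?mul0r ?subr0 ?addr0.
  by rewrite ez cq mulfK // gt_eqF.
by rewrite ez sq cq /q mulrCA mulfK ?gt_eqF // divfK // gt_eqF.
Qed.

Lemma polar_ex z : exists t, polar z t.
Proof.
have [->|z0] := eqVneq z 0; first by exists 0; rewrite /polar cabs0 rmorph0 mul0r.
have c0 : 0 < cabs z by rewrite cabs_gt0.
pose u := cRe z / cabs z; pose v := cIm z / cabs z.
have uv : u ^+ 2 + v ^+ 2 = 1.
  by rewrite !exprMn -mulrDl -cabs_sqr exprVn divff // expf_neq0 // gt_eqF.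
have u1 : -1 <= u <= 1.
  rewrite -ler_norml -(@expr_le1 _ 2) // real_normK ?num_real //.
  by have := sqr_ge0 v; lra.
have cu : cos (acos u) = u by rewrite acosK // in_itv.
have sv : sin (acos u) = `|v|.
  by rewrite sin_acos // -sqrtr_sqr; congr Num.sqrt; rewrite -uv; ring.
exists (if 0 <= v then acos u else - acos u).
have ev : sin (if 0 <= v then acos u else - acos u) = v.
  by case: leP => v0; rewrite ?sinN sv ?(ger0_norm v0) // (ltr0_norm v0) opprK.
have eu : cos (if 0 <= v then acos u else - acos u) = u.
  by case: leP => v0; rewrite ?cosN cu.
apply: cplx_eq; rewrite ?cReM ?cImM cRe_toC cIm_toC [X in _ * X]/= ?mul0r ?subr0 ?addr0.
  by rewrite /cRe /= eu /u mulrC divfK // gt_eqF.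
by rewrite /cIm /= ev /v mulrC divfK // gt_eqF.
Qed.

Lemma cRe_div_gt0 z w : cabs (z - w) < cabs w -> 0 < cRe (z / w).
Proof.
move=> h; have w0 : w != 0 by rewrite -cabs_gt0; apply: le_lt_trans h; exact: cabs_ge0.
rewrite (_ : z / w = 1 + (z - w) / w); last by field.
have : cabs ((z - w) / w) < 1 by rewrite cabsM cabsV ltr_pdivrMr ?cabs_gt0 // mul1r.
by rewrite cReD => h1; have := cRe_le ((z - w) / w); rewrite ler_norml /= {2}/cRe /=; lra.
Qed.

Section AngleLifting.
Variables (X : topologicalType) (A : set X) (H : R * X -> C).
Hypothesis cA : compact A.
Hypothesis cH : {within `[0, 1] `*` A, continuous H}.
Hypothesis H0 : forall s x, 0 <= s <= 1 -> A x -> H (s, x) != 0.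

(** Compactness cuts the homotopy into time steps, uniformly in [x], each of which multiplies [H] by
    a number of the right half-plane. As [X] carries no metric, near coverings take the place of
    uniform continuity. *)
Lemma homotopy_small_steps : exists2 e : R, 0 < e & forall x s s', A x ->
  0 <= s <= 1 -> 0 <= s' <= 1 -> `|s - s'| < e -> 0 < cRe (H (s', x) / H (s, x)).
Proof.
pose K : set (R * X) := `[0, 1]%classic `*` A.
have cK : compact K by apply: compact_setX => //; exact: segment_compact.
pose P (e : R) (p : R * X) := forall s', 0 <= s' <= 1 -> `|p.1 - s'| < e -> 0 < cRe (H (s', p.2) / H p).
have : \forall e \near (0 : R)^'+, K `<=` P e.
  move/compact_near_coveringP/near_covering_withinP : cK; apply => -[s x] [/= s01 Ax].
  (* Two values within a third of [|H (s, x)|] from [H (s, x)] differ by less than two thirds of it,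
     hence by less than the modulus of either. *)
  have Hn : 0 < cabs (H (s, x)) / 3.
    by rewrite divr_gt0 // cabs_gt0 H0 // -(itvP s01); move: s01; rewrite in_itv.
  have /subspace_continuousP/(_ (s, x) (conj s01 Ax)) := cH.
  have : nbhs (H (s, x)) [set w | cabs (H (s, x) - w) < cabs (H (s, x)) / 3].
    by apply/cnbhsP; exists (cabs (H (s, x)) / 3).
  move=> /[swap] /[apply] -[[N1 N2] [/= /nbhs_ballP[d /= d0 hd] xN2] hN].
  have d2 : 0 < d / 2 by rewrite divr_gt0.
  exists ((ball s (d / 2) `*` N2), [set e | e < d / 2]).
    split => /=; last exact: nbhs_right_lt.
    by exists (ball s (d / 2), N2) => //=; split=> //; exact: nbhsx_ballx.
  move=> [[s1 x1] e] [/= [ss1 x1N] ed] [s101 Ax1] s' s'01 s1s'.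
  have hK p : N1 p.1 -> N2 p.2 -> K p -> cabs (H (s, x) - H p) < cabs (H (s, x)) / 3.
    by move=> p1 p2; exact: hN.
  have h1 : cabs (H (s, x) - H (s1, x1)) < cabs (H (s, x)) / 3.
    by apply: (hK (s1, x1)) => //=; apply: hd; apply: le_ball ss1; lra.
  have h2 : cabs (H (s, x) - H (s', x1)) < cabs (H (s, x)) / 3.
    have Ks' : K (s', x1) by split=> //=; rewrite in_itv.
    apply: (hK (s', x1)) => //=; apply: hd; rewrite (splitr d); apply: ball_triangle ss1 _.
    by rewrite -ball_normE /=; apply: lt_trans ed.
  apply: cRe_div_gt0.
  have := cabs_distD (H (s, x)) (H (s', x1)) (H (s1, x1)).
  rewrite (cabsC (H (s', x1)) (H (s, x))).
  have := cabsD (H (s, x) - H (s1, x1)) (H (s1, x1)); rewrite subrK; lra.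
move=> hP; near (0 : R)^'+ => e; exists e => // x s s' Ax s01 s'01 ss'.
have : K `<=` P e by near: e.
by move=> /(_ (s, x)); apply => //; split=> //=; rewrite in_itv.
Unshelve. all: end_near. Qed.

Lemma angle_lifting : exists th : X -> R, [/\ {within A, continuous th},
  forall x, A x -> polar (H (1, x) / H (0, x)) (th x) &
  forall x y, (forall s, 0 <= s <= 1 -> H (s, x) = H (s, y)) -> th x = th y].
Proof.
have [e e0 he] := homotopy_small_steps.
have [M Me] : exists M : nat, 1 / e < M.+1%:R.
  exists (Num.bound (1 / e)); apply: lt_trans (_ : (Num.bound (1 / e))%:R < _); last by rewrite ltr_nat.
  by apply: archi_boundP; rewrite divr_ge0 // ltW.
have M0 : 0 < M.+1%:R :> R by rewrite ltr0n.
pose q (j : nat) (x : X) := H (j.+1%:R / M.+1%:R, x) / H (j%:R / M.+1%:R, x).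
have j01 j : (j <= M.+1)%N -> 0 <= (j%:R / M.+1%:R : R) <= 1.
  by move=> jM; rewrite divr_ge0 //= ler_pdivrMr // mul1r ler_nat.
have q0 j x : A x -> (j < M.+1)%N -> 0 < cRe (q j x).
  move=> Ax jM; apply: he => //; first exact: (j01 j (ltnW jM)); first exact: (j01 j.+1).
  rewrite -mulrBl -natr1 opprD addrA subrr add0r mulN1r normrN normrV ?unitfE ?gt_eqF //.
  rewrite ger0_norm ?(ltW M0) // -ltf_pV2 ?posrE ?invr_gt0 // invrK.
  by rewrite div1r in Me.
pose th x := \sum_(j < M.+1) atan (cIm (q j x) / cRe (q j x)).
exists th; split.
- rewrite /th; have cHj s : 0 <= s <= 1 -> {within A, continuous (fun x => H (s, x))}.
    move=> s01; apply: (within_comp (f := fun x => (s, x)) _ _ cH) => [x Ax|].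
      by split=> //=; rewrite in_itv.
    apply: continuous_subspaceT => x N [[N1 N2] /= [sN1 xN2] hN].
    by apply: filterS xN2 => y y2; apply: hN; split=> //=; exact: nbhs_singleton.
  have cq j : (j < M.+1)%N -> {within A, continuous (q j)}.
    move=> jM; apply/subspace_continuousP => x Ax.
    apply: cvgM; first by move/subspace_continuousP: (cHj _ (j01 j.+1 jM)); apply.
    apply: cvgV; first by apply: H0 => //; exact: (j01 j (ltnW jM)).
    by move/subspace_continuousP: (cHj _ (j01 j (ltnW jM))); apply.
  apply/subspace_continuousP => x Ax.
  apply: cvg_sum_seq => j.
  have qx : q j @ within A (nbhs x) --> q j x by move/subspace_continuousP: (cq j (ltn_ord j)); apply.
  apply: (@continuous_cvg _ _ _ _ _ _ atan); first exact: continuous_atan.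
  apply: cvgM; first by apply: (@continuous_cvg _ _ _ _ _ _ cIm) => //; exact: cIm_continuous.
  apply: cvgV; first by rewrite gt_eqF // q0.
  by apply: (@continuous_cvg _ _ _ _ _ _ cRe) => //; exact: cRe_continuous.
- move=> x Ax; rewrite /th.
  suff : forall m, (m <= M.+1)%N -> polar (H (m%:R / M.+1%:R, x) / H (0, x)) (\sum_(j < m) atan (cIm (q j x) / cRe (q j x))).
    by move=> /(_ _ (leqnn _)); rewrite divff // gt_eqF.
  elim=> [_|m IH mM].
    rewrite mul0r big_ord0 divff ?H0 ?lexx ?ler01 //.
    by rewrite /polar cabs1 rmorph1 cis0 mulr1.
  rewrite big_ord_recr /= (_ : H _ / _ = (H (m%:R / M.+1%:R, x) / H (0, x)) * q m x).
    by apply: polarM; [exact: IH (ltnW mM)|apply: polar_atan; exact: q0].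
  rewrite /q; field; rewrite !H0 ?lexx ?ler01 //; exact: (j01 m (ltnW mM)).
- move=> x y hxy; apply: eq_bigr => j _.
  by rewrite /q !hxy //; [exact: (j01 j (ltnW (ltn_ord j)))|exact: (j01 j.+1)].
Qed.
End AngleLifting.
End Winding.

Section WindingNumber.
Variable R : realType.
Notation C := (Cplx R).
Notation cis := (@cis R).
Notation I01 := (`[0, 1]%classic : set R).

(** By the intermediate value theorem [cis] would be 1 on the whole interval between [th a] and
    [th b], whereas the solutions of [cis v = 1] are isolated. *)
Lemma angle_const (a b : R) (th : R -> R) : a <= b ->
  {within `[a, b], continuous th} -> (forall x, a <= x <= b -> cis (th x) = 1) -> th a = th b.
Proof.
move=> ab cth h.
have step v : Num.min (th a) (th b) <= v <= Num.max (th a) (th b) -> cis v = 1.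
  by move=> hv; have [c cab <-] := IVT ab cth hv; apply: h; move: cab; rewrite in_itv.
have key u w : (forall v, u <= v <= w -> cis v = 1) -> ~ u < w.
  move=> huw uw; pose s := Num.min pi (w - u).
  have s0 : 0 < s by rewrite lt_min pi_gt0 subr_gt0.
  have su : s <= w - u by rewrite ge_min lexx orbT.
  have sp : s <= pi by rewrite ge_min lexx.
  have c1 : cis (u + s) = 1 by apply: huw; lra.
  have c0 : cis u = 1 by apply: huw; lra.
  have /eqP[] : cos s != 1 by apply: cos_eq1_small; have := pi_gt0 R; lra.
  by move: c1; rewrite cisD c0 mul1r => /(congr1 cRe).
have [tt|tt|//] := ltgtP (th a) (th b).
  by exfalso; apply: (key _ _ _ tt) => v hv; apply: step; rewrite (min_l (ltW tt)) (max_r (ltW tt)).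
by exfalso; apply: (key _ _ _ tt) => v hv; apply: step; rewrite (min_r (ltW tt)) (max_l (ltW tt)).
Qed.

(** The variation of a continuous argument, in turns. As a relation it also records that [f] has no
    zero and that the variation is integral; [wind_uniq] makes it functional. *)
Definition wind (f : R -> C) (k : int) : Prop :=
  exists th : R -> R, [/\ {within `[0, 1], continuous th},
    forall x, 0 <= x <= 1 -> f x != 0 /\ polar (f x) (th x) &
    th 1 - th 0 = k%:~R * (2 * pi)].

Lemma wind_eq f g k : (forall x, 0 <= x <= 1 -> f x = g x) -> wind f k -> wind g k.
Proof.
move=> fg [th [h1 h2 h3]]; exists th; split=> // x x01; rewrite -fg //; exact: h2.
Qed.

Lemma wind_uniq f j k : wind f j -> wind f k -> j = k.
Proof.
move=> [th [c1 p1 e1]] [th' [c2 p2 e2]].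
have : (th \- th') 0 = (th \- th') 1.
  apply: angle_const => //; first by apply: within_continuousB.
  by move=> x x01; have [f0 q1] := p1 x x01; have [_ q2] := p2 x x01; apply: polar_uniq q1 q2.
move=> /= e; have pp := pi_gt0 R.
have : (j%:~R - k%:~R) * (2 * pi) = 0 :> R by rewrite mulrBl -e1 -e2; lra.
move/eqP; rewrite mulf_eq0 subr_eq0 eqr_int mulf_eq0 (gt_eqF pp) pnatr_eq0 !orbF.
by move/eqP.
Qed.

Lemma windM f g j k : wind f j -> wind g k -> wind (fun x => f x * g x) (j + k).
Proof.
move=> [th [c1 p1 e1]] [th' [c2 p2 e2]]; exists (th \+ th'); split.
- exact: within_continuousD.
- move=> x x01; have [f0 q1] := p1 x x01; have [g0 q2] := p2 x x01.
  by split; [rewrite mulf_neq0|exact: polarM].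
- by rewrite /= intrD mulrDl -e1 -e2; ring.
Qed.

Lemma wind_ex (f : R -> C) : {within `[0, 1], continuous f} -> (forall x, 0 <= x <= 1 -> f x != 0) ->
  f 0 = f 1 -> exists k, wind f k.
Proof.
move=> cf f0 f01.
(* The loop is contracted to its base point through [f (s * x)], so that the lifting yields an
   argument of [f x / f 0]. *)
have [th [cth pth _]] : exists th : R -> R, [/\ {within `[0, 1], continuous th},
  forall x, I01 x -> polar (f (1 * x) / f (0 * x)) (th x) &
  forall x y, (forall s, 0 <= s <= 1 -> f (s * x) = f (s * y)) -> th x = th y].
  apply: (@angle_lifting R R I01 (fun p => f (p.1 * p.2))).
  - exact: segment_compact.
  - apply: (within_comp (f := fun p : R * R => p.1 * p.2) _ _ cf).
      move=> [s x] [/=]; rewrite !in_itv /= => /andP[s0 s1] /andP[x0 x1].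
      by rewrite mulr_ge0 //= mulr_ile1.
    by apply: continuous_subspaceT => p; exact: mul_continuous.
  - move=> s x /andP[s0 s1]; rewrite /= in_itv /= => /andP[x0 x1]; apply: f0.
    by rewrite mulr_ge0 //= mulr_ile1.
have [t0 pt0] := polar_ex (f 0).
have p1 x : I01 x -> polar (f x) (th x + t0).
  move=> x01; have := pth x x01; rewrite mul1r mul0r => p.
  by rewrite -[f x](divfK (f0 0 _)) ?lexx ?ler01 //; exact: polarM.
have [k hk] : exists k : int, th 1 - th 0 = k%:~R * (2 * pi).
  apply: cis_eq1; have h0 := p1 0; have h1 := p1 1.
  rewrite (_ : th 1 - th 0 = (th 1 + t0) - (th 0 + t0)); last by ring.
  apply: (@polar_uniq _ (f 1)); first by apply: f0; rewrite ler01 lexx.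
    by apply: h1; rewrite /= in_itv /= ler01 lexx.
  by rewrite -f01; apply: h0; rewrite /= in_itv /= ler01 lexx.
exists k, (th \+ (fun=> t0)); split.
- by apply: within_continuousD => //; apply: continuous_subspaceT; exact: cst_continuous.
- by move=> x x01; split; [exact: f0|apply: p1; rewrite /= in_itv].
- by rewrite /= -hk; ring.
Qed.

(** An argument of [H (1, x) / H (0, x)] is added to one of [H (0, x)]. It agrees at [x = 0] and
    [x = 1] since all intermediate loops are closed, so the variation is unchanged. *)
Lemma wind_homotopy (H : R * R -> C) k :
  {within I01 `*` I01, continuous H} ->
  (forall s x, 0 <= s <= 1 -> 0 <= x <= 1 -> H (s, x) != 0) ->
  (forall s, 0 <= s <= 1 -> H (s, 0) = H (s, 1)) ->
  wind (fun x => H (0, x)) k -> wind (fun x => H (1, x)) k.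
Proof.
move=> cH H0 H01 [th [c1 p1 e1]].
have [th' [c2 p2 h2]] : exists th : R -> R, [/\ {within `[0, 1], continuous th},
  forall x, I01 x -> polar (H (1, x) / H (0, x)) (th x) &
  forall x y, (forall s, 0 <= s <= 1 -> H (s, x) = H (s, y)) -> th x = th y].
  apply: angle_lifting => //; first exact: segment_compact.
exists (th \+ th'); split.
- exact: within_continuousD.
- move=> x x01; split; first by apply: H0; rewrite ?lexx ?ler01.
  have [h00 q1] := p1 x x01.
  rewrite -[H (1, x)](divfK h00) mulrC; apply: polarM => //.
  by apply: p2; rewrite /= in_itv.
- by rewrite -e1 /= (h2 0 1) //; ring.
Qed.

Lemma wind_cis (r : R) (k : int) : 0 < r -> wind (fun x => toC r * cis (2 * pi * k%:~R * x)) k.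
Proof.
move=> r0; exists (fun x => 2 * pi * k%:~R * x); split.
- by apply: continuous_subspaceT => x; exact: mulrl_continuous.
- move=> x _; split; last by apply: polar_cis; exact: ltW.
  by rewrite mulf_neq0 ?cis_neq0 // fmorph_eq0 gt_eqF.
- by rewrite mulr1 mulr0 subr0 mulrC.
Qed.

Lemma wind_cst (z : C) : z != 0 -> wind (fun=> z) 0.
Proof.
move=> z0; have [t pt] := polar_ex z; exists (fun=> t); split=> //.
  by apply: continuous_subspaceT; exact: cst_continuous.
by rewrite subrr mul0r.
Qed.

Lemma wind_rouche (f g : R -> C) k : {within `[0, 1], continuous f} -> {within `[0, 1], continuous g} ->
  (forall x, 0 <= x <= 1 -> cabs (f x - g x) < cabs (f x)) -> f 0 = f 1 -> g 0 = g 1 ->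
  wind f k -> wind g k.
Proof.
move=> cf cg fg f01 g01 wf.
pose H (p : R * R) := f p.2 + toC p.1 * (g p.2 - f p.2).
have proj2 : {within I01 `*` I01, continuous (@snd R R)}.
  by apply: continuous_subspaceT => p; exact: cvg_snd.
have proj1 : {within I01 `*` I01, continuous (@fst R R)}.
  by apply: continuous_subspaceT => p; exact: cvg_fst.
have cf2 : {within I01 `*` I01, continuous (f \o snd)}.
  by apply: within_comp proj2 cf => p [].
have cg2 : {within I01 `*` I01, continuous (g \o snd)}.
  by apply: within_comp proj2 cg => p [].
suff : wind (fun x => H (1, x)) k.
  by apply: wind_eq => x _; rewrite /H /= rmorph1 mul1r addrC subrK.
apply: wind_homotopy.
- have cD := within_continuousB cg2 cf2.
  have ct : {within I01 `*` I01, continuous (toC \o fst)}.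
    by apply: within_comp_continuous proj1 _; exact: toC_continuous.
  exact: (within_continuousD cf2 (within_continuous_prod ct cD)).
- move=> s x /andP[s0 s1] x01; rewrite -cabs_gt0 /H /=.
  have h := fg x x01.
  have h1 : cabs (toC s * (g x - f x)) <= cabs (f x - g x).
    by rewrite cabsM cabs_toC ger0_norm // cabsC ler_piMl ?cabs_ge0.
  have := cabsB (f x + toC s * (g x - f x)) (toC s * (g x - f x)); rewrite addrK; lra.
- by move=> s _; rewrite /H /= f01 g01.
- by apply: wind_eq wf => x _; rewrite /H /= rmorph0 mul0r addr0.
Qed.

Lemma wind_disc (F : C -> C) (z0 : C) (r : R) : 0 <= r ->
  {within [set z | cabs (z - z0) <= r], continuous F} -> (forall z, cabs (z - z0) <= r -> F z != 0) ->
  wind (fun x => F (z0 + toC r * cis (2 * pi * x))) 0.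
Proof.
move=> r0 cF F0; pose H (p : R * R) := F (z0 + toC (p.1 * r) * cis (2 * pi * p.2)).
have inD s t : 0 <= s <= 1 -> cabs (z0 + toC (s * r) * cis t - z0) <= r.
  move=> /andP[s0 s1]; rewrite addrAC subrr add0r cabsM cabs_cis mulr1 cabs_toC.
  by rewrite ger0_norm ?mulr_ge0 // ler_piMl.
suff : wind (fun x => H (1, x)) 0 by apply: wind_eq => x _; rewrite /H /= mul1r.
apply: wind_homotopy.
- apply: (within_comp (f := fun p : R * R => z0 + toC (p.1 * r) * cis (2 * pi * p.2)) _ _ cF).
    by move=> [s x] [/= s01 _]; apply: inD; move: s01; rewrite in_itv.
  apply: within_continuousD; first by apply: continuous_subspaceT; exact: cst_continuous.
  apply: continuous_subspaceT => p.
  have h1 : (fun q : R * R => toC (q.1 * r)) @ p --> toC (p.1 * r).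
    apply: (@continuous_cvg _ _ _ _ _ (fun q : R * R => q.1 * r) toC); first exact: toC_continuous.
    by apply: cvgM; [exact: cvg_fst|exact: cvg_cst].
  have h2 : (fun q : R * R => cis (2 * pi * q.2)) @ p --> cis (2 * pi * p.2).
    apply: (@continuous_cvg _ _ _ _ _ (fun q : R * R => 2 * pi * q.2) cis); first exact: cis_continuous.
    by apply: cvgM; [exact: cvg_cst|exact: cvg_snd].
  exact: cvgM h1 h2.
- by move=> s x s01 _; apply: F0; exact: inD.
- by move=> s _; rewrite /H /= mulr0 cis0 !mulr1; have := cis_int R 1; rewrite mulr1z mul1r => ->; rewrite mulr1.
- by apply: (@wind_eq (fun=> F z0)) => [x _|]; [rewrite /H /= mul0r rmorph0 mul0r addr0|apply: wind_cst; apply: F0; rewrite subrr cabs0].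
Qed.

(** Each shift by a period adds [a] turns to an argument of [V]. As [n] may be negative, the
    argument is lifted on a symmetric interval. *)
Lemma wind_power (V : R -> C) (a n : int) : continuous V -> (forall t, V t != 0) ->
  (forall t, V (t + 1) = V t) -> wind V a -> wind (fun x => V (n%:~R * x)) (a * n).
Proof.
move=> cV V0 V1 [ph [cph pph eph]].
(* Keeps [n * x] for [x] in [0,1], and unit shifts inside the range, within [[- K, K]]. *)
pose K : R := `|n|%:R + 1; have K1 : 1 <= K by rewrite lerDr ler0n.
have nK : `|n%:~R| <= K - 1 :> R by rewrite /K addrK natr_absz intr_norm.
have [th [cth pth _]] : exists th : R -> R, [/\ {within `[- K, K], continuous th},
  forall x, `[- K, K]%classic x -> polar (V (1 * x) / V (0 * x)) (th x) &
  forall x y, (forall s, 0 <= s <= 1 -> V (s * x) = V (s * y)) -> th x = th y].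
  apply: (@angle_lifting R R _ (fun p => V (p.1 * p.2))).
  - exact: segment_compact.
  - by apply: continuous_subspaceT => p; apply: continuous_comp; [exact: mul_continuous|exact: cV].
  - by move=> s x _ _; exact: V0.
have {}pth x : - K <= x <= K -> polar (V x) (th x + ph 0).
  move=> xK; have := pth x; rewrite mul1r mul0r /= in_itv /= => /(_ xK) p.
  rewrite -[V x](divfK (V0 0)); apply: polarM => //.
  by have [|_ ] := pph 0; rewrite ?lexx ?ler01.
have sub01 : th 1 - th 0 = a%:~R * (2 * pi).
  rewrite -eph.
  suff : ((fun x => th x + ph 0) \- ph) 0 = ((fun x => th x + ph 0) \- ph) 1 by rewrite /=; lra.
  apply: angle_const => //.
    apply: within_continuousB => //; apply: within_continuousD.
      apply: continuous_subspaceW cth => x /=.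
      by rewrite !in_itv /=; lra.
    by apply: continuous_subspaceT; exact: cst_continuous.
  move=> x x01 /=; have [v0 pp] := pph x x01; apply: polar_uniq v0 (pth x _) pp; lra.
have shift x : - K <= x <= K - 1 -> th (x + 1) - th x = a%:~R * (2 * pi).
  move=> xK; rewrite -sub01 -[in RHS](add0r 1).
  have cst u v : - K <= u -> v <= K - 1 -> u <= v -> th (u + 1) - th u = th (v + 1) - th v.
    move=> Ku Kv uv; apply: (@angle_const u v (fun x => th (x + 1) - th x)) => //.
      have c1 : {within `[u, v], continuous (th \o (fun x => x + 1))}.
        apply: within_comp _ _ cth => [y|].
          by rewrite /= !in_itv /=; lra.
        by apply: continuous_subspaceT => y; apply: cvgD; [exact: cvg_id|exact: cvg_cst].
      have c2 : {within `[u, v], continuous th}.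
        by apply: continuous_subspaceW cth => y /=; rewrite !in_itv /=; lra.
      exact: (within_continuousB c1 c2).
    move=> y yuv; rewrite (_ : _ - _ = (th (y + 1) + ph 0) - (th y + ph 0)); last by ring.
    apply: (@polar_uniq _ (V y)) => //; last by apply: pth; lra.
    by rewrite -V1; apply: pth; lra.
  by have [x0|x0] := leP x 0; [rewrite (cst x 0)|rewrite (cst 0 x)] => //; lra.
have nat_shift (m : nat) x : - K <= x -> x + m%:R <= K -> th (x + m%:R) - th x = (m%:Z * a)%:~R * (2 * pi).
  elim: m => [|m IH] Kx xK; first by rewrite addr0 subrr mul0r mul0r.
  rewrite -natr1 addrA; rewrite -natr1 in xK.
  have m0 : 0 <= m%:R :> R by rewrite ler0n.
  have := shift (x + m%:R); have := IH Kx => h1 h2.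
  rewrite (_ : _ - _ = (th (x + m%:R + 1) - th (x + m%:R)) + (th (x + m%:R) - th x)); last by ring.
  by rewrite h1 ?h2 ?intS ?mulrDl ?mul1r ?intrD ?mulrDl //; lra.
have tot : th n%:~R - th 0 = (a * n)%:~R * (2 * pi).
  have [m [nm|nm]] : exists m : nat, n = m%:Z \/ n = - m%:Z.
    by case: (n) => m; [exists m; left|exists m.+1; right; rewrite NegzE].
    have mK : m%:R <= K - 1 :> R by move: nK; rewrite nm -pmulrn ger0_norm.
    have := nat_shift m 0; rewrite add0r nm mulrC -pmulrn => -> //; lra.
  have mK : m%:R <= K - 1 :> R by move: nK; rewrite nm mulrNz normrN -pmulrn ger0_norm.
  have := nat_shift m (- m%:R); rewrite addNr nm mulrN !mulrNz -pmulrn => h.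
  rewrite mulNr -opprB [(a * _)%R]mulrC h //; lra.
exists (fun x => th (n%:~R * x) + ph 0); split.
- have c1 : {within `[0, 1], continuous (th \o (fun x => n%:~R * x))}.
    apply: within_comp _ _ cth => [x|].
      rewrite /= !in_itv /= => /andP[x0 x1]; rewrite -ler_norml normrM (ger0_norm x0).
      by apply: le_trans (_ : `|n%:~R| <= _); [rewrite ler_piMr|lra].
    by apply: continuous_subspaceT => x; exact: mulrl_continuous.
  by apply: (within_continuousD c1); apply: continuous_subspaceT; exact: cst_continuous.
- move=> x /andP[x0 x1]; split=> //; apply: pth; rewrite -ler_norml normrM (ger0_norm x0).
  by apply: le_trans (_ : `|n%:~R| <= _); [rewrite ler_piMr|lra].
- by rewrite mulr1 mulr0 -tot; ring.
Qed.

Lemma circle_continuous (z0 : C) (r : R) : continuous (fun x : R => z0 + toC r * cis (2 * pi * x)).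
Proof.
move=> x; apply: cvgD; first exact: cvg_cst.
apply: cvgM; first exact: cvg_cst.
apply: (@continuous_cvg _ _ _ _ _ (fun q : R => 2 * pi * q) cis); first exact: cis_continuous.
exact: mulrl_continuous.
Qed.

Lemma cis_1 : cis (2 * pi * 1) = 1.
Proof. by have := cis_int R 1; rewrite mulr1z mul1r mulr1. Qed.

(** The boolean is coerced to 0 or 1. For [w] inside, Rouche's comparison with the centred circle
    applies; for [w] outside, the loop contracts in the disc. *)
Lemma wind_linear (z0 w : C) (r : R) : 0 < r -> cabs (w - z0) != r ->
  wind (fun x => z0 + toC r * cis (2 * pi * x) - w) (cabs (w - z0) < r)%R.
Proof.
move=> r0 wr; case: ltgtP wr => // wr _.
  have h : wind (fun x => toC r * cis (2 * pi * x)) 1.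
    by apply: wind_eq (wind_cis 1 r0) => x _; rewrite mulr1z mulr1.
  apply: wind_rouche h => /=.
  - have -> : (fun x : R => toC r * cis (2 * pi * x)) = fun x => 0 + toC r * cis (2 * pi * x).
      by apply/funext => x; rewrite add0r.
    by apply: continuous_subspaceT; exact: circle_continuous.
  - by apply: continuous_subspaceT => x; apply: cvgB; [exact: circle_continuous|exact: cvg_cst].
  - move=> x _; rewrite (_ : _ - _ = w - z0); last by ring.
    by rewrite cabsM cabs_cis mulr1 cabs_toC gtr0_norm.
  - by rewrite cis_1 mulr0 cis0.
  - by rewrite cis_1 mulr0 cis0.
apply: (wind_disc (F := fun z => z - w)); first exact: ltW.
  apply: continuous_subspaceT => z.
  by apply: (@continuousB _ C C id (fun=> w)) => //; exact: cst_continuous.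
move=> z zr; rewrite subr_eq0; apply/eqP => zw; move: zr; rewrite zw leNgt wr //.
Qed.

Lemma wind_roots (rs : seq C) (c z0 : C) (r : R) : 0 < r -> c != 0 ->
  (forall w, w \in rs -> cabs (w - z0) != r) ->
  wind (fun x => (c *: \prod_(w <- rs) ('X - w%:P)).[z0 + toC r * cis (2 * pi * x)])
    (count (fun w => cabs (w - z0) < r) rs).
Proof.
move=> r0 c0; elim: rs => [_|w rs IH h] /=.
  by apply: wind_eq (wind_cst c0) => x _; rewrite big_nil hornerZ hornerC mulr1.
have h1 : wind _ _ := @wind_linear z0 w r r0 (h w (mem_head _ _)).
have h2 := IH (fun w' w'rs => h w' (mem_behead (s := w :: rs) w'rs)).
rewrite PoszD; apply: wind_eq (windM h1 h2) => x _.
by rewrite big_cons !hornerZ hornerM hornerXsubC; ring.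
Qed.
End WindingNumber.

(** Uniqueness of base [B] expansions; it separates the monomials in [dominant_monomial]. *)
Lemma digits_inj (B n : nat) (a b : 'I_n -> nat) :
  (forall i, a i < B)%N -> (forall i, b i < B)%N ->
  (\sum_(i < n) a i * B ^ i = \sum_(i < n) b i * B ^ i)%N -> a =1 b.
Proof.
elim: n a b => [|n IH] a b aB bB; first by move=> _ [].
rewrite !big_ord_recl !expn0 !muln1.
have E (c : 'I_n.+1 -> nat) : (\sum_(i < n) c (lift ord0 i) * B ^ (bump 0 i) = (\sum_(i < n) c (lift ord0 i) * B ^ i) * B)%N.
  by rewrite big_distrl /=; apply: eq_bigr => i _; rewrite /bump /= add1n expnSr mulnA.
rewrite /= !E => h.
have B0 : (0 < B)%N by apply: leq_ltn_trans (aB ord0).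
have h0 : a ord0 = b ord0.
  by have := congr1 (modn^~ B) h; rewrite /= ![(_ + _ * B)%N]addnC !modnMDl !modn_small.
move: h; rewrite h0 => /addnI/eqP; rewrite eqn_pmul2r // => /eqP/IH h i.
case: (unliftP ord0 i) => [j ->|-> //]; apply: h => k; [exact: aB|exact: bB].
Qed.

(** * Squarefree parts of homogeneous polynomials *)

Section Polynomials.
Variables (R : realType) (n : nat).
Notation C := (Cplx R).
Notation A := (mpoly n C).
Notation X_ i := (mpolyX C (mnm1 i)).
Implicit Types (p q : A) (x : 'rV[C]_n).

Definition ev x p : C := meval (fun i => x 0 i) p.
HB.instance Definition _ x := GRing.RMorphism.copy (ev x) (@meval n C (fun i => x 0 i)).

Definition evp x (P : {poly A}) : {poly C} := map_poly (ev x) P.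
HB.instance Definition _ x := GRing.RMorphism.copy (evp x) (map_poly (ev x)).

Lemma evpE x P i : (evp x P)`_i = ev x P`_i.
Proof. by rewrite coef_map. Qed.
Lemma evC x c : ev x (mpolyC n c) = c. Proof. exact: mevalC. Qed.
Lemma evX x i : ev x (X_ i) = x 0 i. Proof. exact: mevalXU. Qed.
Lemma evpC x p : evp x p%:P = (ev x p)%:P. Proof. exact: map_polyC. Qed.
Lemma evpX x : evp x 'X = 'X. Proof. exact: map_polyX. Qed.

Lemma evE p x : ev x p = \sum_(m <- msupp p) mcoeff m p * \prod_i x 0 i ^+ m i.
Proof. exact: mevalE. Qed.

(** Kronecker substitution: with [rho i = e ^ (B ^ i)] distinct monomials become distinct powers of
    [e], and for small [e] the lowest one outweighs all others together. The factor 2 leaves room to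
    invert the dominant term. *)
Lemma dominant_monomial p (r : R) : p != 0 -> 0 < r ->
  exists rho : 'I_n -> R, (forall i, 0 < rho i <= r) /\ exists2 a0, a0 \in msupp p &
    (\sum_(a <- msupp p | a != a0) cabs (mcoeff a p) * \prod_i rho i ^+ a i) * 2 <=
       cabs (mcoeff a0 p) * \prod_i rho i ^+ a0 i.
Proof.
move=> p0 r0; pose B := msize p; pose W (a : multinom n) := (\sum_(i < n) a i * B ^ i)%N.
have Winj : {in msupp p &, injective W}.
  have h a : a \in msupp p -> forall i, (a i < B)%N.
    move=> ap i; apply: leq_ltn_trans (msize_mdeg_lt ap).
    by rewrite mdegE (bigD1 i) //= leq_addr.
  by move=> a b ap bp /(digits_inj (h a ap) (h b bp)) ab; apply/mnmP.
have [a0 a0p a0min] : exists2 a0, a0 \in msupp p & forall a, a \in msupp p -> (W a0 <= W a)%N.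
  have s0 : msupp p != [::] by rewrite msupp_eq0.
  have exW : exists k, k \in [seq W a | a <- msupp p].
    by case: (msupp p) s0 => // a s _; exists (W a); rewrite mem_head.
  case: (ex_minnP exW) => k /mapP[a ap ->] kmin; exists a => // b bp.
  by apply: kmin; apply: map_f.
pose S := \sum_(a <- msupp p) cabs (mcoeff a p).
have S0 : 0 <= S by apply: sumr_ge0 => a _; exact: cabs_ge0.
have c0 : 0 < cabs (mcoeff a0 p) by rewrite cabs_gt0 -mcoeff_msupp.
(* The last bound gives [e * S * 2 <= cabs (mcoeff a0 p)]; every other monomial has at least one
   factor [e] more than [a0]. *)
pose e := Num.min (Num.min 1 r) (cabs (mcoeff a0 p) / ((S + 1) * 2)).
have S1 : 0 < (S + 1) * 2 by rewrite mulr_gt0 // ltr_wpDl.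
have e0 : 0 < e by rewrite !lt_min ltr01 r0 divr_gt0.
have [e1 er es] : [/\ e <= 1, e <= r & e * S * 2 <= cabs (mcoeff a0 p)].
  rewrite /e; set m := Num.min (Num.min _ _) _.
  have m1 : m <= Num.min 1 r by rewrite ge_min lexx.
  have m2 : m <= cabs (mcoeff a0 p) / ((S + 1) * 2) by rewrite ge_min lexx orbT.
  split; [apply: le_trans m1 _; by rewrite ge_min lexx|apply: le_trans m1 _; by rewrite ge_min lexx orbT|].
  move: m2; rewrite ler_pdivlMr // => /(le_trans _); apply; rewrite -mulrA ler_wpM2l ?(ltW e0) //.
  by rewrite ler_wpM2r // lerDl.
pose rho (i : 'I_n) := e ^+ (B ^ i).
have rhoE (a : multinom n) : \prod_i rho i ^+ a i = e ^+ W a.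
  rewrite /rho /W.
  rewrite (eq_bigr (fun i : 'I_n => e ^+ (a i * B ^ i)%N)); first by rewrite -expr_sum.
  by move=> i _; rewrite -exprM mulnC.
have B0 : (0 < B)%N by rewrite lt0n /B mmeasure_poly_eq0.
exists rho; split.
  move=> i; rewrite exprn_gt0 //=; apply: le_trans er.
  by rewrite -[X in _ <= X]expr1; apply: ler_wiXn2l; rewrite ?(ltW e0) // expn_gt0 B0.
exists a0 => //; rewrite rhoE.
apply: le_trans (_ : e ^+ W a0 * (e * S * 2) <= _); last first.
  by rewrite mulrC ler_wpM2r // exprn_ge0 // ltW.
rewrite !mulrA ler_wpM2r // -exprSr /S mulr_sumr big_mkcond /= big_seq [X in _ <= X]big_seq.
apply: ler_sum => a ap; case: eqP => [_|/eqP aa0] /=.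
  by rewrite mulr_ge0 ?cabs_ge0 // exprn_ge0 // ltW.
rewrite rhoE mulrC ler_wpM2r ?cabs_ge0 //; apply: ler_wiXn2l; rewrite ?(ltW e0) //.
rewrite ltn_neqAle a0min // andbT; apply: contra aa0 => /eqP/Winj-> //.
Qed.

Lemma mpoly_nonzero_ev p : p != 0 -> exists x, ev x p != 0.
Proof.
move=> p0; have [rho [rhor [a0 a0p h]]] := dominant_monomial p0 ltr01.
exists (\row_i toC (rho i)); rewrite -cabs_gt0 evE.
have E (a : multinom n) : cabs (\prod_i (\row_i toC (rho i)) 0 i ^+ a i) = \prod_i rho i ^+ a i.
  rewrite cabs_prod; apply: eq_bigr => i _; rewrite mxE cabsX cabs_toC ger0_norm //.
  by have /andP[/ltW] := rhor i.
rewrite (bigD1_seq a0) //= ?msupp_uniq //.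
set u := _ * _; set v := \sum_(_ <- _ | _) _.
have uE : cabs u = cabs (mcoeff a0 p) * \prod_i rho i ^+ a0 i by rewrite cabsM E.
have u0 : 0 < cabs u.
  rewrite uE mulr_gt0 ?cabs_gt0 -?mcoeff_msupp //; apply: prodr_gt0 => i _.
  by rewrite exprn_gt0 //; have /andP[] := rhor i.
have : cabs v * 2 <= cabs u.
  rewrite uE; apply: le_trans h; rewrite ler_wpM2r //.
  by apply: le_trans (cabs_sum _ _ _) _; apply: ler_sum => a _; rewrite cabsM E.
have := cabsD (u + v) (- v); rewrite addrK cabsN; lra.
Qed.

Lemma ev_inj p q : (forall x, ev x p = ev x q) -> p = q.
Proof.
move=> h; apply/eqP; rewrite -subr_eq0; apply/negPn/negP => /mpoly_nonzero_ev[x].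
by rewrite rmorphB /= h subrr eqxx.
Qed.

(* f(x + z b), as a polynomial in z whose coefficients are polynomials in x *)
Definition shift_poly (b : 'rV[C]_n) : A -> {poly A} :=
  mmap (fun c => (mpolyC n c)%:P) (fun i => (X_ i)%:P + (mpolyC n (b 0 i))%:P * 'X).

Lemma shift_polyE b p x (z : C) : (evp x (shift_poly b p)).[z] = ev (x + z *: b) p.
Proof.
rewrite /shift_poly /mmap rmorph_sum horner_sum evE; apply: eq_bigr => m _.
rewrite rmorphM /= evpC evC hornerM hornerC; congr (_ * _).
rewrite /mmap1 rmorph_prod horner_prod; apply: eq_bigr => i _.
rewrite rmorphXn /= horner_exp; congr (_ ^+ _).
rewrite rmorphD rmorphM /= !evpC evpX hornerD hornerM !hornerC hornerX evX evC !mxE.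
by rewrite mulrC.
Qed.

(** Only the part of degree [d] reaches [z ^ d], and there each variable contributes its coordinate
    of [b]. The coefficient is thus a constant, so the polynomial is monic up to a scalar when that
    constant is nonzero. *)
Lemma shift_poly_coef b p d : (forall m, m \in msupp p -> (mdeg m <= d)%N) ->
  (size (shift_poly b p) <= d.+1)%N /\
  (shift_poly b p)`_d = mpolyC n (ev b (pihomog mdeg d p)).
Proof.
move=> hd.
(* Degree at most [k] with coefficient [c] at [k]: a multiplicative property, so monomials follow
   from variables. *)
pose P (c : C) k (F : {poly A}) := (size F <= k.+1)%N /\ F`_k = mpolyC n c.
have PM c1 k1 F1 c2 k2 F2 : P c1 k1 F1 -> P c2 k2 F2 -> P (c1 * c2) (k1 + k2)%N (F1 * F2).
  move=> [s1 h1] [s2 h2]; split.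
    apply: leq_trans (size_polyMleq _ _) _.
    by rewrite -ltnS; apply: leq_trans (leqSpred _) _; rewrite ltnS -addnS; have := leq_add s1 s2; lia.
  rewrite coefM (bigD1 (inord k1)) //= inordK ?ltnS ?leq_addr // addKn h1 h2 mpolyCM big1 ?addr0 //.
  move=> i ik1; have {}ik1 : i != k1 :> nat.
    by apply: contra ik1 => /eqP e; apply/eqP/val_inj; rewrite /= inordK // ?ltnS ?leq_addr.
  have [ik|ik] := ltnP i k1.
    rewrite [F2`__]nth_default ?mulr0 //; apply: leq_trans s2 _.
    by have := ltn_ord i; lia.
  rewrite [F1`__]nth_default ?mul0r //; apply: leq_trans s1 _; lia.
have P1 : P 1 0%N 1 by split; rewrite ?size_poly1 // coef1 eqxx mpolyC1.
have Pm (m : multinom n) : P (\prod_i b 0 i ^+ m i) (mdeg m) (mmap1 (fun i => (X_ i)%:P + (mpolyC n (b 0 i))%:P * 'X) m).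
  rewrite mdegE /mmap1; apply: (big_ind3 P P1) => [c1 k1 F1 c2 k2 F2|i _]; first by move=> p1 p2; exact: PM.
  elim: (m i) => [|k IH]; first by rewrite !expr0.
  rewrite !exprS -[k.+1]add1n; apply: PM => //; split.
    apply: leq_trans (size_polyD _ _) _; rewrite geq_max; apply/andP; split.
      by apply: leq_trans (size_polyC_leq1 _) _.
    apply: leq_trans (size_polyMleq _ _) _; rewrite size_polyX.
    by rewrite addn2 ltnS size_polyC_leq1.
  by rewrite coefD coefC /= add0r coefMX /= coefC eqxx.
split.
  rewrite /shift_poly /mmap; apply: leq_trans (size_sum _ _ _) _.
  rewrite big_seq; elim/big_ind: _ => // [u v uk vk|m mp]; first by rewrite geq_max uk.
  rewrite mul_polyC; apply: leq_trans (size_scale_leq _ _) _.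
  by have [s _] := Pm m; apply: leq_trans s _; rewrite ltnS hd.
rewrite /shift_poly /mmap coef_sum pihomogE /ev (rmorph_sum (meval _)) (rmorph_sum (@mpolyC n C)) /= [RHS]big_mkcond /= [LHS]big_seq [RHS]big_seq.
apply: eq_bigr => m mp; rewrite coefCM.
have [s c] := Pm m; case: eqP => [<-|md].
  by rewrite c /ev mevalZ mevalX rmorphM.
rewrite [X in _ * X]nth_default ?mulr0 //; apply: leq_trans s _.
by rewrite ltn_neqAle hd // andbT; apply/eqP.
Qed.

End Polynomials.
Arguments ev {R n}.
Arguments evp {R n}.

Section Univariate.
Variable R : realType.
Notation C := (Cplx R).
Implicit Types (p q : {poly C}) (z : C).

Lemma poly_bounded p (r : R) : exists2 M, 0 <= M & forall z, cabs z <= r -> cabs p.[z] <= M.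
Proof.
exists (\sum_(i < size p) cabs p`_i * `|r| ^+ i).
  by apply: sumr_ge0 => i _; rewrite mulr_ge0 ?cabs_ge0 ?exprn_ge0.
move=> z zr; rewrite horner_coef; apply: le_trans (cabs_sum _ _ _) _.
apply: ler_sum => i _; rewrite cabsM cabsX ler_wpM2l ?cabs_ge0 //.
by rewrite lerXn2r ?nnegrE ?cabs_ge0 // (le_trans zr) // ler_norm.
Qed.

Lemma poly_lipschitz_at p w : exists2 M, 0 <= M &
  forall z, cabs (z - w) <= 1 -> cabs (p.[z] - p.[w]) <= M * cabs (z - w).
Proof.
have /factor_theorem[q hq] : root (p - p.[w]%:P) w by rewrite /root !hornerE subrr.
have [M M0 hM] := poly_bounded q (cabs w + 1).
exists M => // z zw; have := congr1 (fun u => u.[z]) hq; rewrite !hornerE => ->.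
rewrite cabsM ler_wpM2r ?cabs_ge0 // hM //.
by rewrite -[z](subrK w) addrC; apply: le_trans (cabsD _ _) _; rewrite lerD2l.
Qed.

(** Induction on the degree of [q]: by the bound a root of [q] is a root of [p], and the common
    linear factor can be cancelled. *)
Lemma poly_dvd_of_bound p q : q != 0 ->
  (forall r : R, exists K, forall z, cabs z <= r -> cabs p.[z] <= K * cabs q.[z]) -> q %| p.
Proof.
move: {2}(size q) (leqnn (size q)) => k; elim: k p q => [|k IH] p q qk q0 H.
  by move: qk; rewrite leqn0 size_poly_eq0 (negbTE q0).
have [s1|s1] := eqVneq (size q) 1%N.
  by apply/dvdpP; move/eqP/size_poly1P : s1 => [c c0 ->]; exists (c^-1 *: p); rewrite -scalerAl mulrC mul_polyC scalerA mulVf ?scale1r.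
have [r rq] : exists r, root q r by exact/closed_rootP.
have pr : root p r.
  have [K hK] := H (cabs r); rewrite /root -cabs_eq0 eq_le cabs_ge0 andbT.
  by have := hK r (lexx _); rewrite (eqP rq) cabs0 mulr0.
have [q1 e1] := factor_theorem _ _ rq; have [p1 e2] := factor_theorem _ _ pr.
rewrite e1 e2 dvdp_mul2r ?polyXsubC_eq0 //.
have q10 : q1 != 0 by apply: contra_neq q0; rewrite e1 => ->; rewrite mul0r.
apply: IH => //.
  by move: qk; rewrite e1 size_Mmonic ?monicXsubC // size_XsubC addn2.
move=> rho; have [K hK] := H (Num.max rho (cabs r + 1)).
have hz z : cabs z <= Num.max rho (cabs r + 1) -> z != r -> cabs p1.[z] <= K * cabs q1.[z].
  move=> zr znr; have := hK z zr; rewrite e1 e2 !hornerE !cabsM mulrA ler_pM2r //.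
  by rewrite cabs_gt0 subr_eq0.
exists K => z zr; have [->|znr] := eqVneq z r; last first.
  by apply: hz => //; rewrite le_max zr.
(* At [r] itself the cancelled bound follows from nearby points [w = r + h], with Lipschitz
   estimates in place of a limit. *)
have [M M0 hM] := poly_lipschitz_at p1 r; have [N N0 hN] := poly_lipschitz_at q1 r.
have K0 : 0 <= `|K| by [].
apply/ler_addgt0Pr => e e0.
pose s := M + `|K| * N + 1; have s0 : 0 < s by rewrite ltr_wpDl // addr_ge0 // mulr_ge0.
pose h := Num.min 1 (e / s); have h0 : 0 < h by rewrite lt_min ltr01 divr_gt0.
have h1 : h <= 1 by rewrite ge_min lexx.
have hs : h * s <= e by rewrite -ler_pdivlMr // ge_min lexx orbT.
pose w := r + toC h.
have wr : cabs (w - r) = h by rewrite addrAC subrr add0r cabs_toC gtr0_norm.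
have := hz w _ _; rewrite -subr_eq0 -cabs_gt0 wr h0 le_max => /(_ _ isT) hw.
have {}hw : cabs p1.[w] <= K * cabs q1.[w].
  by apply: hw; apply/orP; right; apply: le_trans (cabsD _ _) _; rewrite cabs_toC gtr0_norm // lerD2l.
have := hM w; rewrite wr => /(_ h1) hMw; have := hN w; rewrite wr => /(_ h1) hNw.
have a1 : cabs p1.[r] <= cabs p1.[w] + M * h.
  by have := cabsB p1.[w] (p1.[w] - p1.[r]); rewrite opprB addrC subrK; lra.
have a2 : `|cabs q1.[w] - cabs q1.[r]| <= N * h by apply: le_trans (cabs_dist _ _) hNw.
have a3 : K * cabs q1.[w] - K * cabs q1.[r] <= `|K| * (N * h).
  by rewrite -mulrBr; apply: le_trans (ler_norm _) _; rewrite normrM ler_wpM2l.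
by move: hs; rewrite /s; lra.
Qed.
End Univariate.

Section PolynomialMaps.
Variables (R : realType) (n : nat).
Notation C := (Cplx R).
Notation A := (mpoly n C).
Notation X_ i := (mpolyX C (mnm1 i)).
Implicit Types (p q c : A) (x y b : 'rV[C]_n) (P F : {poly A}).

Lemma cvg_prod_seq (T I : Type) (G : set_system T) (FG : Filter G)
    (r : seq I) (F : I -> T -> C) (l : I -> C) :
  (forall i, F i @ G --> l i) -> (fun t => \prod_(i <- r) F i t) @ G --> \prod_(i <- r) l i.
Proof.
move=> h; elim: r => [|i r IH].
  by under eq_fun do rewrite big_nil; rewrite big_nil; exact: cvg_cst.
by under eq_fun do rewrite big_cons; rewrite big_cons; exact: (cvgM (h i) IH).
Qed.

Lemma cvg_exp (T : Type) (G : set_system T) (FG : Filter G) (f : T -> C) (l : C) k :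
  f @ G --> l -> (fun t => f t ^+ k) @ G --> l ^+ k.
Proof.
move=> h; elim: k => [|k IH].
  by under eq_fun do rewrite expr0; rewrite expr0; exact: cvg_cst.
by under eq_fun do rewrite exprS; rewrite exprS; exact: (cvgM h IH).
Qed.

Lemma ev_continuous p : continuous (fun x => ev x p).
Proof.
move=> x; under eq_fun do rewrite evE.
apply: (@cvg_sum_seq C C _ _ _ (nbhs_filter x)) => m.
have cc : (fun=> mcoeff m p) @ x --> mcoeff m p by exact: (@cst_continuous _ C).
apply: (cvgM cc); apply: (cvg_prod_seq (nbhs_filter x)) => i; apply: (cvg_exp (nbhs_filter x)).
exact: (@coord_continuous C 1 n 0 i x).
Qed.

Lemma ev_near p x (e : R) : 0 < e ->
  exists2 d, 0 < d & forall y, vabs (x - y) < d -> cabs (ev x p - ev y p) < e.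
Proof.
move=> e0; apply/vnbhsP.
have : nbhs (ev x p) [set w | cabs (ev x p - w) < e] by apply/cnbhsP; exists e.
exact: ev_continuous.
Qed.

Lemma ev_bounded p (r : R) : exists2 M, 0 <= M & forall x, vabs x <= r -> cabs (ev x p) <= M.
Proof.
exists (\sum_(m <- msupp p) cabs (mcoeff m p) * \prod_(i < n) `|r| ^+ m i).
  by apply: sumr_ge0 => m _; rewrite mulr_ge0 ?cabs_ge0 // prodr_ge0 // => i _; rewrite exprn_ge0.
move=> x xr; rewrite evE; apply: le_trans (cabs_sum _ _ _) _; apply: ler_sum => m _.
rewrite cabsM cabs_prod ler_wpM2l ?cabs_ge0 //; apply: ler_prod => i _.
rewrite cabsX exprn_ge0 ?cabs_ge0 //= lerXn2r ?nnegrE ?cabs_ge0 //.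
by apply: le_trans (vabs_coord x i) _; apply: le_trans xr _; exact: ler_norm.
Qed.

Lemma poly_eq0_ev (q : {poly C}) : (forall z, q.[z] = 0) -> q = 0.
Proof.
move=> h; apply/eqP; apply: contraT => /closed_nonrootP[z]; rewrite /root h eqxx //.
Qed.

Lemma small_nonroot (q : {poly C}) (e : R) : q != 0 -> 0 < e -> exists2 z, cabs z < e & q.[z] != 0.
Proof.
move=> q0 e0; apply: contrapT => H.
pose rs := [seq toC (e / (k.+2)%:R) : C | k <- iota 0 (size q)].
have urs : uniq rs.
  rewrite map_inj_in_uniq ?iota_uniq // => j k _ _ /toC_inj /(mulfI (lt0r_neq0 e0))/invr_inj/eqP.
  by rewrite eqr_nat => /eqP[].
have rrs : all (root q) rs.
  apply/allP => _ /mapP[k _ ->]; rewrite /root; apply/negPn/negP => qk; apply: H.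
  exists (toC (e / k.+2%:R)) => //; rewrite cabs_toC ger0_norm ?divr_ge0 ?(ltW e0) //.
  by rewrite gtr_pMr // invf_lt1 // ltr1n.
by have := max_poly_roots q0 rrs urs; rewrite size_map size_iota ltnn.
Qed.

(** On the line through [x] and a point where [p] is nonzero, [p] has only finitely many zeros. *)
Lemma mpoly_nonzero_near p x (e : R) : p != 0 -> 0 < e ->
  exists2 y, vabs (x - y) < e & ev y p != 0.
Proof.
move=> p0 e0; have [x1 hx1] := mpoly_nonzero_ev p0.
pose q := evp x (shift_poly (x1 - x) p).
have q0 : q != 0.
  apply: contra_neq hx1 => q0; have := shift_polyE (x1 - x) p x 1.
  by rewrite -/q q0 horner0 scale1r addrC subrK.
have v0 : 0 < vabs (x1 - x) + 1 by rewrite ltr_wpDl // vabs_ge0.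
have [z zs qz] := small_nonroot q0 (divr_gt0 e0 v0).
exists (x + z *: (x1 - x)); last by rewrite -shift_polyE.
rewrite opprD addrA subrr add0r vabsN vabsZ.
move: zs; rewrite ltr_pdivlMr // => h; apply: le_lt_trans h.
by rewrite ler_wpM2l ?cabs_ge0 // lerDl.
Qed.

Lemma ev_eq0_generic c p : c != 0 -> (forall x, ev x c != 0 -> ev x p = 0) -> p = 0.
Proof.
move=> c0 h; have : c * p = 0.
  apply: ev_inj => x; rewrite rmorphM rmorph0 /=.
  by have [->|/h ->] := eqVneq (ev x c) 0; rewrite ?mul0r ?mulr0.
by move/eqP; rewrite mulf_eq0 (negbTE c0) => /eqP.
Qed.

Lemma evp_eq0_generic c P : c != 0 -> (forall x, ev x c != 0 -> evp x P = 0) -> P = 0.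
Proof.
move=> c0 h; apply/polyP => i; rewrite coef0; apply: (ev_eq0_generic c0) => x /h.
by move=> /(congr1 (fun q : {poly C} => q`_i)); rewrite evpE coef0.
Qed.

(** Division by a monic polynomial commutes with evaluation of the coefficients. The evaluated
    remainder is a multiple of [evp x F] of smaller degree, so it is 0 at generic [x], hence
    identically. *)
Lemma monic_dvd_pointwise F P c : F \is monic -> c != 0 ->
  (forall x, ev x c != 0 -> evp x F %| evp x P) -> exists Q, P = Q * F.
Proof.
move=> Fm c0 h; exists (P %/ F); rewrite {1}(Pdiv.IdomainMonic.divp_eq Fm P).
suff -> : P %% F = 0 by rewrite addr0.
apply: (evp_eq0_generic c0) => x /h Px.
have Fx : evp x F \is monic by apply: monic_map.
have hr : evp x F %| evp x (P %% F).
  have -> : evp x (P %% F) = evp x P - evp x (P %/ F) * evp x F.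
    by rewrite {2}(Pdiv.IdomainMonic.divp_eq Fm P) rmorphD rmorphM /= addrAC subrr add0r.
  by rewrite dvdp_sub // dvdp_mull.
apply/eqP; apply: contraT => r0; have := dvdp_leq r0 hr; rewrite leqNgt => /negP[].
apply: leq_ltn_trans (size_poly _ _) _.
have -> : size (evp x F) = size F by rewrite size_map_poly_id0 // (monicP Fm) rmorph1 oner_neq0.
by rewrite ltn_modp monic_neq0.
Qed.

Lemma shift_monic b p d : (forall m, m \in msupp p -> (mdeg m <= d)%N) ->
  ev b (pihomog mdeg d p) != 0 ->
  let F := (mpolyC n (ev b (pihomog mdeg d p))^-1) *: shift_poly b p in
  F \is monic /\ size F = d.+1.
Proof.
move=> hd t0 F; have [s cf] := shift_poly_coef b hd.
have Fd : F`_d = 1 by rewrite coefZ cf -mpolyCM mulVf // mpolyC1.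
have sF : size F = d.+1.
  apply/anti_leq/andP; split; first by apply: leq_trans (size_scale_leq _ _) s.
  by rewrite ltnNge; apply/negP => /leq_sizeP/(_ d (leqnn d)); rewrite Fd => /eqP; rewrite oner_eq0.
by split => //; rewrite monicE lead_coefE sF Fd.
Qed.

Lemma mcoeff_pihomog p d (m : multinom n) :
  mcoeff m (pihomog mdeg d p) = if mdeg m == d then mcoeff m p else 0.
Proof.
rewrite pihomogE raddf_sum /= (eq_bigr (fun a : multinom n => if a == m then mcoeff m p else 0)); last first.
  by move=> a _; rewrite mcoeffZ mcoeffX; case: eqP => [->|_]; rewrite ?mulr1 ?mulr0.
rewrite -big_mkcondr /= big_const_seq iter_addr_0.
have -> : count (fun a : multinom n => (mdeg a == d) && (a == m)) (msupp p) =
    ((mdeg m == d) && (m \in msupp p) : nat).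
  have -> : count (fun a : multinom n => (mdeg a == d) && (a == m)) (msupp p) =
     ((mdeg m == d) * count_mem m (msupp p))%N.
    case md : (mdeg m == d); rewrite ?mul1n ?mul0n.
      by apply: eq_count => a /=; case: (eqVneq a m) => [->|]; rewrite ?md ?andbF.
    by rewrite -(count_pred0 (msupp p)); apply: eq_count => a /=; case: (eqVneq a m) => [->|]; rewrite ?md ?andbF.
  by rewrite count_uniq_mem ?msupp_uniq //; case: (_ == d); rewrite ?mul1n ?mul0n.
by case: (mdeg m == d); rewrite // mcoeff_msupp; case: eqP => [->|]; rewrite ?mulr1n ?mulr0n.
Qed.

Lemma top_homog_neq0 p : p != 0 -> exists b, ev b (pihomog mdeg (msize p).-1 p) != 0.
Proof.
move=> p0; apply: mpoly_nonzero_ev.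
have s0 : msize p != 0%N by rewrite mmeasure_poly_eq0.
have [m mp md] : exists2 m, m \in msupp p & mdeg m = (msize p).-1.
  apply: contrapT => H; have : (msize p <= (msize p).-1)%N.
    rewrite [X in (X <= _)%N]msizeE big_seq; elim/big_ind: _ => // [u v uk vk|m mp]; first by rewrite geq_max uk.
    have := msize_mdeg_lt mp; rewrite -[X in (_ < X)%N]prednK ?lt0n // ltnS leq_eqVlt => /orP[/eqP e|//].
    by exfalso; apply: H; exists m.
  by rewrite -ltnS prednK ?lt0n // ltnn.
apply: contraTneq mp => h; rewrite mcoeff_msupp negbK; apply/eqP.
by have := congr1 (mcoeff m) h; rewrite mcoeff0 mcoeff_pihomog md eqxx.
Qed.

(** On every line of direction [b] the one-variable statement applies. There [q] is monic up to a
    constant, so the quotients are the evaluations of one polynomial, and its constant coefficient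
    is the quotient up to that constant. *)
Lemma mpoly_dvd_of_bound p q : q != 0 ->
  (forall r : R, exists K, forall x, vabs x <= r -> cabs (ev x p) <= K * cabs (ev x q)) ->
  exists u, p = u * q.
Proof.
move=> q0 H; have [b hb] := top_homog_neq0 q0.
have [|Fm sF] := shift_monic (d := (msize q).-1) _ hb.
  by move=> m /msize_mdeg_lt; case: (msize q).
set t := ev b _ in hb Fm sF; set F := _ *: _ in Fm sF.
have Fx x : evp x F = t^-1 *: evp x (shift_poly b q).
  by rewrite /F -mul_polyC rmorphM /= evpC evC mul_polyC.
have [Q hQ] : exists Q, shift_poly b p = Q * F.
  apply: (@monic_dvd_pointwise F _ 1 Fm (oner_neq0 _)) => x _.
  rewrite Fx dvdpZl ?invr_eq0; last by [].
  apply: poly_dvd_of_bound.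
    have : evp x F != 0 by rewrite monic_neq0 // monic_map.
    by apply: contra_neq; rewrite Fx => ->; rewrite scaler0.
  move=> r; have [K hK] := H (vabs x + `|r| * vabs b); exists K => z zr.
  rewrite [X in cabs X <= _]shift_polyE [X in _ <= _ * cabs X]shift_polyE.
  apply: hK; apply: le_trans (vabsD _ _) _; rewrite lerD2l vabsZ.
  by rewrite ler_wpM2r ?vabs_ge0 // (le_trans zr) // ler_norm.
exists (Q`_0 * mpolyC n t^-1); apply: ev_inj => x; rewrite !rmorphM /= evC.
have e0 p' : ev x p' = (evp x (shift_poly b p')).[0] by rewrite shift_polyE scale0r addr0.
rewrite (e0 p) (e0 q) hQ rmorphM /= hornerM Fx hornerZ mulrA; congr (_ * _ * _).
by rewrite horner_coef0 evpE.
Qed.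
End PolynomialMaps.

Section RootsOfPolynomials.
Variable R : realType.
Notation C := (Cplx R).
Implicit Types (p u v w : {poly C}) (r z : C) (rs : seq C).

Lemma separable_roots p : separable_poly p -> exists2 rs, uniq rs &
  p = lead_coef p *: \prod_(r <- rs) ('X - r%:P).
Proof.
move=> sp; have [rs hp] := closed_field_poly_normal p; exists rs => //.
have p0 : lead_coef p != 0 by rewrite lead_coef_eq0 separable_poly_neq0.
by move: sp; rewrite hp (eqp_separable (eqp_scale _ p0)) separable_prod_XsubC.
Qed.

Lemma root_prodXsub rs z : root (\prod_(r <- rs) ('X - r%:P)) z = (z \in rs).
Proof. exact: root_prod_XsubC. Qed.

(* u divides both p and p', hence misses one multiplicity of each root of p *)
Lemma root_quotient_gcd p u v w (c1 c2 r : C) : p != 0 -> c1 != 0 -> c2 != 0 ->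
  c1 *: p = v * u -> c2 *: p^`() = w * u -> root p r -> root v r.
Proof.
move=> p0 c10 c20 e1 e2 pr; apply: contraT => vr.
have [m [q qr pE]] := multiplicity_XsubC p r.
rewrite p0 /= in qr.
case: m pE => [|m] pE; first by move: pr; rewrite pE mulr1 (negbTE qr).
have h1 : ('X - r%:P) ^+ m.+1 %| u.
  rewrite -(@Gauss_dvdpr _ _ v); last by apply: coprimep_expl; rewrite coprimep_sym coprimep_XsubC.
  by rewrite -e1 dvdpZr // pE dvdp_mulIr.
have : ('X - r%:P) ^+ m.+1 %| p^`() by rewrite -(dvdpZr _ _ c20) e2 dvdp_mull.
rewrite pE derivM dvdp_addr ?dvdp_mulIr // deriv_exp /= derivXsubC mul1r.
rewrite exprSr -scaler_nat -scalerAr dvdpZr ?pnatr_eq0 // mulrC.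
rewrite dvdp_mul2r ?expf_neq0 ?polyXsubC_eq0 // dvdp_XsubCl (negbTE qr) //.
Qed.

Lemma prod_coef_bound rs (rho : R) : (forall r, r \in rs -> cabs r <= rho) -> forall i,
  cabs (\prod_(r <- rs) ('X - r%:P))`_i <= (1 + rho) ^+ size rs.
Proof.
elim: rs => [_ i|r rs IH h i].
  by rewrite big_nil coef1 cabs_nat; case: (i == 0%N).
have {}IH := IH (fun r' hr => h r' (mem_behead (s := r :: rs) hr)).
have rr : cabs r <= rho by apply: h; rewrite mem_head.
rewrite big_cons mulrBl coefB mul_polyC coefZ mulrC coefMX exprS.
apply: le_trans (cabsB _ _) _; rewrite mulrDl mul1r; apply: lerD.
  by case: (i == 0%N) => //; rewrite cabs0 exprn_ge0 // addr_ge0 // (le_trans _ rr) ?cabs_ge0.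
by rewrite cabsM ler_pM ?cabs_ge0.
Qed.

(** Cauchy's bound; it bounds the roots uniformly while the base point of the line stays bounded. *)
Lemma monic_root_bound p (M : R) r : p \is monic -> (forall i, cabs p`_i <= M) ->
  root p r -> cabs r <= 1 + M * (size p)%:R.
Proof.
move=> pm pM; have M0 : 0 <= M by apply: le_trans (pM 0%N); exact: cabs_ge0.
have [r1|r1 pr] := leP (cabs r) 1; first by rewrite (le_trans r1) // lerDl mulr_ge0.
have [d sp] : exists d, size p = d.+2.
  have : size p != 0%N by rewrite size_poly_eq0 monic_neq0.
  case sp : (size p) => [|[|d]] // _; last by exists d.
  have /eqP/size_poly1P[c c0 e] := sp.
  by move: pr; rewrite e rootC (negbTE c0).
have r0 : 0 < cabs r by apply: lt_trans r1.
suff : cabs r ^+ d.+1 <= M * d.+1%:R * cabs r ^+ d.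
  rewrite exprSr mulrC ler_pM2r ?exprn_gt0 // => h; rewrite (le_trans h) // sp.
  by have : M * d.+1%:R <= M * d.+2%:R; [rewrite ler_wpM2l // ler_nat|lra].
have : r ^+ d.+1 = - \sum_(i < d.+1) p`_i * r ^+ i.
  move: pr; rewrite /root horner_coef sp big_ord_recr /=.
  have -> : p`_d.+1 = 1 by move/monicP: pm; rewrite lead_coefE sp.
  by rewrite mul1r addrC addr_eq0 => /eqP.
rewrite -cabsX => ->; rewrite cabsN; apply: le_trans (cabs_sum _ _ _) _.
have -> : M * d.+1%:R * cabs r ^+ d = \sum_(i < d.+1) M * cabs r ^+ d.
  by rewrite sumr_const card_ord -[RHS]mulr_natr mulrAC.
apply: ler_sum => i _; rewrite cabsM cabsX ler_pM ?cabs_ge0 ?exprn_ge0 ?cabs_ge0 //.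
by rewrite ler_eXn2l // -ltnS.
Qed.
End RootsOfPolynomials.

Section Radical.
Variables (R : realType) (n : nat).
Notation C := (Cplx R).
Notation A := (mpoly n C).
Notation X_ i := (mpolyX C (mnm1 i)).
Implicit Types (p q c : A) (x y b : 'rV[C]_n) (P F : {poly A}).

Definition affine_subst (a : C) y p : A :=
  mmap (@mpolyC n C) (fun i => mpolyC n a * X_ i + mpolyC n (y 0 i)) p.

Lemma affine_substE a y p x : ev x (affine_subst a y p) = ev (a *: x + y) p.
Proof.
rewrite /affine_subst /mmap rmorph_sum evE; apply: eq_bigr => m _.
rewrite rmorphM /= evC; congr (_ * _); rewrite /mmap1 rmorph_prod; apply: eq_bigr => i _.
by rewrite rmorphXn rmorphD rmorphM /= !evC evX !mxE.
Qed.

Lemma affine_subst_neq0 a y p : a != 0 -> p != 0 -> affine_subst a y p != 0.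
Proof.
move=> a0 p0; have [x hx] := mpoly_nonzero_ev p0.
apply: contraNneq hx => h; have := affine_substE a y p (a^-1 *: (x - y)).
by rewrite h rmorph0 scalerA divff // scale1r subrK => <-.
Qed.

Lemma pihomog_sum p k : (msize p <= k)%N -> p = \sum_(d < k) pihomog mdeg d p.
Proof.
move=> pk; apply/mpolyP => m; rewrite raddf_sum /=.
under eq_bigr do rewrite mcoeff_pihomog.
have [mk|mk] := ltnP (mdeg m) k.
  by rewrite (bigD1 (Ordinal mk)) //= eqxx big1 ?addr0 // => i ik; rewrite ifF //; apply: contraNF ik => /eqP e; apply/eqP/val_inj.
rewrite big1; last by move=> i _; rewrite ifF //; apply: contraTF (ltn_ord i) => /eqP <-; rewrite -leqNgt.
by apply/eqP; rewrite mcoeff_eq0 msize_mdeg_ge // (leq_trans pk).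
Qed.

Lemma ev_homog d p x (a : C) : p \is ishomog1 d mdeg -> ev (a *: x) p = a ^+ d * ev x p.
Proof.
move/dhomogP => h; rewrite !evE mulr_sumr !big_seq; apply: eq_bigr => m mp.
rewrite mulrCA; congr (_ * _); rewrite -(h m mp) /= mdegE.
rewrite expr_sum -big_split /=; apply: eq_bigr => i _.
by rewrite !mxE exprMn.
Qed.

(** For fixed [x] the identity is polynomial in [a], so the powers of [a] can be compared. *)
Lemma homog_of_ev p d : (forall x a, a != 0 -> ev (a *: x) p = a ^+ d * ev x p) ->
  p \is ishomog1 d mdeg.
Proof.
move=> h; pose k := maxn (msize p) d.+1.
have dk : (d < k)%N by rewrite leq_max ltnSn orbT.
have pk : (msize p <= k)%N by rewrite leq_maxl.
have comp j : (j < k)%N -> j != d -> pihomog mdeg j p = 0.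
  move=> jk jd; apply: ev_inj => x; rewrite rmorph0 /=.
  pose q : {poly C} := \poly_(i < k) ev x (pihomog mdeg i p) - ev x p *: 'X^d.
  (* The factor ['X] absorbs the value [a = 0], about which the hypothesis says nothing. *)
  have q0 : 'X * q = 0.
    apply: poly_eq0_ev => a; rewrite hornerM hornerX.
    have [->|a0] := eqVneq a 0; first by rewrite mul0r.
    rewrite /q hornerD hornerN hornerZ hornerXn horner_poly [_ * a ^+ d]mulrC -h //.
    rewrite [in X in _ - X](pihomog_sum pk) rmorph_sum /=.
    under [X in _ - X]eq_bigr do rewrite (ev_homog x a (pihomogP _ _ _)) mulrC.
    by rewrite subrr mulr0.
  have /eqP := q0; rewrite mulf_eq0 polyX_eq0 /= => /eqP/(congr1 (fun u : {poly C} => u`_j)).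
  by rewrite coef0 coefB coef_poly jk coefZ coefXn (negbTE jd) mulr0 subr0.
rewrite (pihomog_sum pk) (bigD1 (Ordinal dk)) //= big1 ?addr0; last first.
  by move=> i id; apply: comp => //; apply: contra id => /eqP e; apply/eqP/val_inj.
exact: pihomogP.
Qed.
End Radical.

Lemma prod_XsubC_dvd_exp (K : fieldType) (p : {poly K}) (rs : seq K) :
  (forall r, r \in rs -> root p r) -> \prod_(r <- rs) ('X - r%:P) %| p ^+ size rs.
Proof.
elim: rs => [|r rs IH] h; first by rewrite big_nil dvd1p.
rewrite big_cons exprS dvdp_mul //; first by rewrite dvdp_XsubCl h ?mem_head.
by apply: IH => r' r'rs; apply: h; rewrite inE r'rs orbT.
Qed.

Section SquarefreePart.
Variables (R : realType) (n : nat).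
Notation C := (Cplx R).
Notation A := (mpoly n C).
Implicit Types (p q c : A) (x y : 'rV[C]_n) (P : {poly A}).
Variables (f : A) (d : nat) (b : 'rV[C]_n).
Hypotheses (fh : f \is ishomog1 d mdeg) (fb : ev b f != 0).

(** A violation at [x] would persist at all nearby points, some of which satisfy [ev y c != 0]; the
    radius [r + 1] leaves room for them. *)
Lemma bound_of_generic p q c (K r : R) : c != 0 -> 0 <= K ->
  (forall x, vabs x <= r + 1 -> ev x c != 0 -> cabs (ev x p) <= K * cabs (ev x q)) ->
  forall x, vabs x <= r -> cabs (ev x p) <= K * cabs (ev x q).
Proof.
move=> c0 K0 H x xr; rewrite leNgt; apply/negP => lt.
pose e := cabs (ev x p) - K * cabs (ev x q); have e0 : 0 < e by rewrite subr_gt0.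
have e1 : 0 < e / 2 by rewrite divr_gt0.
have K1 : 0 < K + 1 by rewrite ltr_wpDl.
have e2 : 0 < e / 2 / (K + 1) by rewrite divr_gt0.
have [d1 d10 h1] := ev_near p x e1; have [d2 d20 h2] := ev_near q x e2.
have [|y xy cy] := mpoly_nonzero_near x c0 (e := Num.min 1 (Num.min d1 d2)).
  by rewrite !lt_min ltr01 d10.
move: xy; rewrite !lt_min => /and3P[xy1 /h1 xy2 /h2 xy3].
have yr : vabs y <= r + 1.
  have := vabsD (y - x) x; rewrite subrK vabsC => h; apply: le_trans h _.
  by rewrite addrC lerD // ltW.
have b2 : cabs (ev x p) - cabs (ev y p) < e / 2.
  by apply: le_lt_trans xy2; apply: le_trans (ler_norm _) (cabs_dist _ _).
have b3 := H y yr cy.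
have : K * (cabs (ev y q) - cabs (ev x q)) <= e / 2.
  have [t|t] := leP (cabs (ev y q) - cabs (ev x q)) 0.
    by apply: le_trans (ltW e1); rewrite mulr_ge0_le0.
  have t3 : (cabs (ev y q) - cabs (ev x q)) * (K + 1) <= e / 2.
    rewrite -ler_pdivlMr //; apply: le_trans (ler_norm _) _; apply: le_trans (cabs_dist _ _) _.
    by rewrite cabsC; exact: ltW.
  by apply: le_trans t3; rewrite mulrC ler_wpM2l ?(ltW t) // lerDl.
move: b2 b3; rewrite mulrBr /e.
generalize (cabs (ev x p)) (cabs (ev x q)) (cabs (ev y p)) (cabs (ev y q)) => px qx py qy; lra.
Qed.

Let T := ev b f.
Let F : {poly A} := mpolyC n T^-1 *: shift_poly b f.

Lemma monic_shift : F \is monic /\ size F = d.+1.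
Proof.
have E : pihomog mdeg d f = f by rewrite pihomog_dE.
have := @shift_monic _ _ b f d; rewrite E; apply=> // m mp.
by move/dhomogP: fh => /(_ m mp) /= ->.
Qed.

Lemma shift_rootP x z : root (evp x F) z <-> ev (x + z *: b) f = 0.
Proof.
have -> : evp x F = T^-1 *: evp x (shift_poly b f).
  by rewrite /F -mul_polyC rmorphM /= evpC evC mul_polyC.
rewrite rootZ ?invr_eq0 // /root shift_polyE.
by split=> /eqP.
Qed.

(** [v] is [F] divided by its gcd with its derivative, but over a polynomial ring these divisions
    hold up to nonzero factors only. Their product with the Bezout constant and the leading
    coefficient of [v] is [c]: where it does not vanish, all identities specialise to the line
    through [x]. *)
Lemma generic_roots : exists v : {poly A}, exists2 c, c != 0 &
  v != 0 /\ forall x, ev x c != 0 -> ev x (lead_coef v) != 0 /\ exists rs, [/\ uniq rs,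
    evp x v = ev x (lead_coef v) *: \prod_(r <- rs) ('X - r%:P) &
    forall z, z \in rs <-> ev (x + z *: b) f = 0].
Proof.
have [Fm sF] := monic_shift.
have F0 : F != 0 by rewrite monic_neq0.
pose u := gcdp F F^`(); pose v := F %/ u.
have sv : separable_poly v by apply: make_separable.
have v0 : v != 0 by apply: separable_poly_neq0.
have u0 : u != 0 by rewrite gcdp_eq0 negb_and F0.
have := dvdp_gcdl F F^`(); rewrite Pdiv.Idomain.dvdp_eq -/u -/v; set c1 := _ ^+ _ => /eqP e1.
have := dvdp_gcdr F F^`(); rewrite Pdiv.Idomain.dvdp_eq -/u; set c2 := _ ^+ _; set w := _ %/ _ => /eqP e2.
have c10 : c1 != 0 by rewrite expf_neq0 // lead_coef_eq0.
have c20 : c2 != 0 by rewrite expf_neq0 // lead_coef_eq0.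
have := sv; rewrite separable_poly.unlock => /Bezout_coprimepP[[s t] /= ].
rewrite -size_poly_eq1 => /size_poly1P[c3 c30 e3].
exists v, (c1 * c2 * c3 * lead_coef v).
  by rewrite !mulf_neq0 // lead_coef_eq0.
split=> // x; rewrite !rmorphM /= !mulf_eq0 !negb_or => /andP[/andP[/andP[x1 x2] x3] x4].
split=> //.
have E1 : ev x c1 *: evp x F = evp x v * evp x u.
  by rewrite -rmorphM -e1 -!mul_polyC rmorphM /= evpC.
have dE P : (evp x P)^`() = evp x P^`() by exact: deriv_map.
have E2 : ev x c2 *: (evp x F)^`() = evp x w * evp x u.
  by rewrite dE -rmorphM -e2 -!mul_polyC rmorphM /= evpC.
have lv : lead_coef (evp x v) = ev x (lead_coef v) by apply: lead_coef_map_eq.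
have svx : separable_poly (evp x v).
  rewrite separable_poly.unlock; apply/Bezout_coprimepP; exists (evp x s, evp x t) => /=.
  rewrite dE -!rmorphM -rmorphD /= e3 evpC -size_poly_eq1 size_polyC x3 //.
have Fx0 : evp x F != 0 by rewrite monic_neq0 // monic_map.
have [rs urs vE] := separable_roots svx.
exists rs; split=> //; first by rewrite -lv.
move=> z; rewrite -shift_rootP -root_prodXsub -(@rootZ _ _ (lead_coef (evp x v))); last first.
  by rewrite lv.
rewrite -vE; split=> [vz|]; last exact: (root_quotient_gcd Fx0 x1 x2 E1 E2).
by rewrite -(rootZ _ _ x1) E1 rootM vz.
Qed.

(** The coefficients of [v] divided by [D] are symmetric functions of the roots, hence bounded on
    bounded sets, so [D] divides every coefficient of [v] by [mpoly_dvd_of_bound]. This plays the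
    part of Gauss's lemma and yields the monic [G]. *)
Lemma squarefree_poly : exists e (G : {poly A}), exists2 c, c != 0 &
  [/\ G \is monic, size G = e.+1 & forall x, ev x c != 0 -> exists rs, [/\ uniq rs, size rs = e,
    evp x G = \prod_(r <- rs) ('X - r%:P) &
    forall z, z \in rs <-> ev (x + z *: b) f = 0]].
Proof.
have [Fm sF] := monic_shift.
have [v [c c0 [v0 hv]]] := generic_roots.
set D := lead_coef v in hv; have D0 : D != 0 by rewrite lead_coef_eq0.
pose e := (size v).-1.
have sv : size v = e.+1 by rewrite prednK // lt0n size_poly_eq0.
have srs x rs : ev x c != 0 -> evp x v = ev x D *: \prod_(r <- rs) ('X - r%:P) -> size rs = e.
  move=> /hv[Dx _] vE; apply/eqP; rewrite -eqSS -sv -(size_prod_XsubC rs id) -(size_scale _ Dx) -vE.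
  by apply/eqP; rewrite size_map_poly_id0.
have bnd j : exists q, v`_j = q * D.
  apply: mpoly_dvd_of_bound => // r.
  have /choice[M hM] : forall i, exists M, 0 <= M /\ forall x, vabs x <= r + 1 -> cabs (ev x F`_i) <= M.
    by move=> i; have [M M0 hM] := ev_bounded F`_i (r + 1); exists M.
  pose S := \sum_(i < size F) M i.
  have S0 : 0 <= S by apply: sumr_ge0 => i _; exact: (hM i).1.
  have hS x i : vabs x <= r + 1 -> cabs (evp x F)`_i <= S.
    move=> xr; rewrite evpE; have [iF|iF] := ltnP i (size F).
      apply: le_trans ((hM i).2 x xr) _; rewrite /S (bigD1 (Ordinal iF)) //= lerDl.
      by apply: sumr_ge0 => k _; exact: (hM k).1.
    by rewrite nth_default // rmorph0 cabs0.
  pose rho := 1 + S * (size F)%:R.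
  have rho0 : 0 <= rho by rewrite addr_ge0 // mulr_ge0.
  exists ((1 + rho) ^+ e); apply: (@bound_of_generic _ _ c) => //.
    by rewrite exprn_ge0 // addr_ge0.
  move=> x xr cx; have [Dx [rs [urs vE rsP]]] := hv x cx.
  rewrite -evpE vE coefZ cabsM mulrC ler_wpM2r ?cabs_ge0 // -(srs x rs cx vE).
  apply: prod_coef_bound => z /rsP/shift_rootP zF.
  have := monic_root_bound (monic_map _ Fm) (fun i => hS x i xr) zF.
  by rewrite size_map_poly_id0 // (monicP Fm) rmorph1 oner_neq0.
have /choice[Gc hG] := bnd.
pose G : {poly A} := \poly_(j < e.+1) Gc j.
have vG : v = D *: G.
  apply/polyP => j; rewrite coefZ coef_poly; case: ltnP => je; first by rewrite hG mulrC.
  by rewrite mulr0 nth_default // sv.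
have Ge : G`_e = 1.
  apply: (mulfI D0); rewrite mulr1 -coefZ -vG /D lead_coefE sv //.
have sG : size G = e.+1.
  apply/anti_leq/andP; split; first exact: size_poly.
  by rewrite ltnNge; apply/negP => /leq_sizeP/(_ e (leqnn e)); rewrite Ge => /eqP; rewrite oner_eq0.
exists e, G, c => //; split=> //; first by rewrite monicE lead_coefE sG Ge.
move=> x cx; have [Dx [rs [urs vE rsP]]] := hv x cx.
exists rs; split=> //; first exact: srs vE.
apply: (scalerI Dx); rewrite -vE vG -!mul_polyC rmorphM /= evpC //.
Qed.

(** [g] is the constant coefficient of [G], so generically the product of the negated distinct roots
    on a line. Its shift and dilation laws are checked at generic points by comparing root lists.
    The fourth clause is the Nullstellensatz for [f]. *)
Theorem squarefree_part : exists e (g : A), exists2 c : A, c != 0 &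
  [/\ g \is ishomog1 e mdeg, ev b g = 1, forall x, ev x g = 0 <-> ev x f = 0,
   forall h : A, (forall x, ev x f = 0 -> ev x h = 0) -> exists q, h = q * g &
   forall x, ev x c != 0 -> exists rs, [/\ uniq rs, size rs = e &
     forall z, ev (x + z *: b) g = \prod_(r <- rs) (z - r)]].
Proof.
have [Fm sF] := monic_shift.
have [e [G [c c0 [Gm sG hG]]]] := squarefree_poly.
pose g := G`_0.
have g0 x : ev x g = (evp x G).[0] by rewrite horner_coef0 evpE.
have gx x : ev x c != 0 -> exists rs, [/\ uniq rs, size rs = e,
    evp x G = \prod_(r <- rs) ('X - r%:P),
    forall z, z \in rs <-> ev (x + z *: b) f = 0 & ev x g = \prod_(r <- rs) (- r)].
  move=> /hG[rs [u s E h]]; exists rs; split=> //.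
  by rewrite g0 E horner_prod; apply: eq_bigr => r _; rewrite hornerXsubC sub0r.
(* Moving the base point by [z *: b] translates the roots by [- z]; both sides are products over the
   translated list. *)
have gshift x z : ev (x + z *: b) g = (evp x G).[z].
  have -> : (evp x G).[z] = ev x G.[mpolyC n z].
    by rewrite -{1}[z](evC x) /evp horner_map.
  rewrite -[x in LHS]scale1r -affine_substE; congr (ev x _); apply/eqP; rewrite -subr_eq0; apply/eqP.
  have c'0 : c * affine_subst 1 (z *: b) c != 0.
    by rewrite mulf_neq0 // affine_subst_neq0 // oner_neq0.
  apply: (ev_eq0_generic c'0) => {}x; rewrite rmorphM /= (affine_substE _ _ c) scale1r mulf_eq0 negb_or.
  move=> /andP[/gx[rs [u s E h _]] /gx[rs' [u' s' E' h' gx']]].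
  rewrite rmorphB /= (affine_substE _ _ g) scale1r gx'; apply/eqP; rewrite subr_eq0; apply/eqP.
  have -> : ev x G.[mpolyC n z] = (evp x G).[z] by rewrite -{2}[z](evC x) /evp horner_map.
  have pe : perm_eq rs' [seq r - z | r <- rs].
    apply: uniq_perm => //; first by rewrite map_inj_uniq // => r1 r2 /addIr.
    move=> r; apply/idP/idP => [/h'|/mapP[r0 /h r0h ->]].
      rewrite -addrA -scalerDl => /h r0; apply/mapP; exists (z + r) => //.
      by rewrite addrC addrA addNr add0r.
    by apply/h'; rewrite -addrA -scalerDl (addrC z) subrK.
  rewrite (perm_big _ pe) big_map E horner_prod; apply: eq_bigr => r _.
  by rewrite opprB hornerXsubC.
(* As [f] is homogeneous, dilating the base point by [a] multiplies the roots by [a]. *)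
have gh x a : a != 0 -> ev (a *: x) g = a ^+ e * ev x g.
  move=> a0; have -> : a ^+ e * ev x g = ev x (mpolyC n (a ^+ e) * g) by rewrite rmorphM /= evC.
  rewrite -[a *: x]addr0 -affine_substE; congr (ev x _); apply/eqP; rewrite -subr_eq0; apply/eqP.
  have c'0 : c * affine_subst a 0 c != 0 by rewrite mulf_neq0 // affine_subst_neq0.
  apply: (ev_eq0_generic c'0) => {}x; rewrite rmorphM /= (affine_substE _ _ c) addr0 mulf_eq0 negb_or.
  move=> /andP[/gx[rs [u s E h gx0]] /gx[rs' [u' s' E' h' gx']]].
  rewrite rmorphB rmorphM /= evC (affine_substE _ _ g) addr0 gx' gx0; apply/eqP; rewrite subr_eq0; apply/eqP.
  have pe : perm_eq rs' [seq a * r | r <- rs].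
    apply: uniq_perm => //; first by rewrite map_inj_uniq // => r1 r2 /(mulfI a0).
    move=> r; apply/idP/idP => [/h' r1|/mapP[r0 /h r0h ->]].
      apply/mapP; exists (a^-1 * r); last by rewrite mulVKf.
      apply/h; have := ev_homog (a *: x + r *: b) a^-1 fh; rewrite r1 mulr0.
      by rewrite scalerDr 2!scalerA (mulVf a0) scale1r.
    by apply/h'; rewrite -scalerA -scalerDr (ev_homog _ _ fh) r0h mulr0.
  rewrite (perm_big _ pe) big_map -s; elim: (rs) => [|r l IH]; first by rewrite !big_nil mul1r.
  by rewrite !big_cons IH exprS -mulrN mulrACA.
have gb1 : ev b g = 1.
  (* Above the base point 0 homogeneity leaves only the top power of the variable; since [G] is
     monic, [ev b g = 1]. *)
  have Eg : evp 0 G = ev b g *: 'X^e.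
    apply/eqP; rewrite -subr_eq0; apply/eqP.
    suff : 'X * (evp 0 G - ev b g *: 'X^e) = 0.
      by move/eqP; rewrite mulf_eq0 polyX_eq0 /= => /eqP.
    apply: poly_eq0_ev => z; rewrite hornerM hornerX.
    have [->|z0] := eqVneq z 0; first by rewrite mul0r.
    by rewrite hornerD hornerN hornerZ hornerXn -gshift add0r gh // [_ * z ^+ e]mulrC subrr mulr0.
  have := congr1 (fun P : {poly C} => P`_e) Eg; rewrite evpE coefZ coefXn eqxx mulr1 => <-.
  have -> : G`_e = 1 by move/monicP: Gm; rewrite lead_coefE sG.
  by rewrite rmorph1.
have Tf x : ev x f = T * (evp x F).[0].
  have -> : evp x F = T^-1 *: evp x (shift_poly b f).
    by rewrite /F -mul_polyC rmorphM /= evpC evC mul_polyC.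
  by rewrite hornerZ mulVKf // shift_polyE scale0r addr0.
exists e, g, c => //; split=> //.
- exact: homog_of_ev gh.
- move=> x; have [Q hQ] : exists Q, F = Q * G.
    apply: (monic_dvd_pointwise Gm c0) => y /hG[rs [u s -> h]].
    by apply: uniq_roots_dvdp; [apply/allP => z /h/shift_rootP|rewrite uniq_rootsE].
  (* Every root of [F] is a root of [G], and [F] has [d] roots with multiplicity. *)
  have [Q' hQ'] : exists Q', G ^+ d = Q' * F.
    apply: (monic_dvd_pointwise Fm c0) => y /hG[rs [u s E h]].
    have Fy : evp y F \is monic by apply: monic_map.
    have [rf Erf] := closed_field_poly_normal (evp y F).
    rewrite (monicP Fy) scale1r in Erf.
    have srf : size rf = d.
      apply/eqP; rewrite -eqSS -(size_prod_XsubC rf id) -Erf -sF.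
      by rewrite size_map_poly_id0 // (monicP Fm) rmorph1 oner_neq0.
    rewrite rmorphXn /= Erf -srf; apply: prod_XsubC_dvd_exp => r rrf.
    by rewrite E root_prodXsub; apply/h/shift_rootP; rewrite Erf root_prodXsub.
  split=> h.
    by rewrite Tf hQ rmorphM /= hornerM -g0 h !mulr0.
  have F0x : (evp x F).[0] = 0 by move: h; rewrite Tf => /eqP; rewrite mulf_eq0 (negbTE fb) => /eqP.
  have := congr1 (fun P : {poly A} => (evp x P).[0]) hQ'.
  rewrite rmorphM rmorphXn /= hornerM F0x mulr0 horner_exp -g0 => /eqP.
  by rewrite expf_eq0 => /andP[_ /eqP].
(* The roots of [G] on a generic line are simple, so vanishing at them already gives
   divisibility. *)
- move=> h hf; have [Q hQ] : exists Q, shift_poly b h = Q * G.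
    apply: (monic_dvd_pointwise Gm c0) => y /hG[rs [u s -> hr]].
    apply: uniq_roots_dvdp; last by rewrite uniq_rootsE.
    by apply/allP => z /hr/hf hz; rewrite /root shift_polyE hz.
  exists Q`_0; apply: ev_inj => x; rewrite rmorphM /= g0.
  have -> : ev x h = (evp x (shift_poly b h)).[0] by rewrite shift_polyE scale0r addr0.
  by rewrite hQ rmorphM /= hornerM; congr (_ * _); rewrite horner_coef0 evpE.
- move=> x cx; have [rs [u s E h]] := hG x cx; exists rs; split=> // z.
  by rewrite gshift E horner_prod; apply: eq_bigr => r _; rewrite hornerXsubC.
Qed.
End SquarefreePart.

(** * Power series and multiplicity *)

Section WeightedNorm.
Variables (R : realType) (n : nat).
Notation C := (Cplx R).
Notation A := (mpoly n C).
Implicit Types (p q : A) (a : multinom n) (rho : 'I_n -> R).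

Definition wmon rho a : R := \prod_i rho i ^+ a i.

(** Weighted l1 norm: a power series converges absolutely at the radii [rho] when the norms of its
    truncations are bounded. *)
Definition wnorm rho p : R := \sum_(a <- msupp p) cabs (mcoeff a p) * wmon rho a.

Lemma wmonD rho a a' : wmon rho (mnm_add a a') = wmon rho a * wmon rho a'.
Proof. by rewrite /wmon -big_split; apply: eq_bigr => i _ /=; rewrite mnmDE exprD. Qed.

Section Positive.
Variable rho : 'I_n -> R.
Hypothesis rho0 : forall i, 0 < rho i.

Lemma wmon_gt0 a : 0 < wmon rho a.
Proof. by apply: prodr_gt0 => i _; rewrite exprn_gt0. Qed.

Lemma wnorm_ge0 p : 0 <= wnorm rho p.
Proof. by apply: sumr_ge0 => a _; rewrite mulr_ge0 ?cabs_ge0 // ltW // wmon_gt0. Qed.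

Lemma wnorm_seq p (s : seq (multinom n)) : uniq s ->
  \sum_(a <- s) cabs (mcoeff a p) * wmon rho a <= wnorm rho p.
Proof.
move=> us; rewrite (bigID (fun a => a \in msupp p)) /= [X in _ + X]big1 ?addr0; last first.
  by move=> a; rewrite mcoeff_msupp negbK => /eqP ->; rewrite cabs0 mul0r.
rewrite -big_filter /wnorm [X in _ <= X](bigID (fun a => a \in s)) /= -[X in _ <= X + _]big_filter.
rewrite (perm_big [seq i <- msupp p | i \in s]) /=.
  by rewrite lerDl sumr_ge0 // => a _; rewrite mulr_ge0 ?cabs_ge0 // ltW // wmon_gt0.
apply: uniq_perm; rewrite ?filter_uniq ?msupp_uniq // => a.
by rewrite !mem_filter andbC.
Qed.

Lemma wnorm_seqE p (s : seq (multinom n)) : uniq s -> {subset msupp p <= s} ->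
  \sum_(a <- s) cabs (mcoeff a p) * wmon rho a = wnorm rho p.
Proof.
move=> us ps; apply/le_anti; rewrite wnorm_seq //= /wnorm [X in _ <= X](bigID (fun a => a \in msupp p)) /=.
rewrite -[X in _ <= X + _]big_filter (perm_big [seq i <- s | i \in msupp p]) /=.
  by rewrite lerDl sumr_ge0 // => a _; rewrite mulr_ge0 ?cabs_ge0 // ltW // wmon_gt0.
apply: uniq_perm; rewrite ?filter_uniq ?msupp_uniq // => a.
by rewrite mem_filter; case: (boolP (a \in msupp p)) => //= /ps ->.
Qed.

Lemma wnormD p q : wnorm rho (p + q) <= wnorm rho p + wnorm rho q.
Proof.
pose s := undup (msupp p ++ msupp q).
have us : uniq s by rewrite undup_uniq.
rewrite -(@wnorm_seqE (p + q) s) //; last by move=> a /msuppD_le; rewrite mem_undup.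
rewrite -(@wnorm_seqE p s) //; last by move=> a ap; rewrite mem_undup mem_cat ap.
rewrite -(@wnorm_seqE q s) //; last by move=> a aq; rewrite mem_undup mem_cat aq orbT.
rewrite -big_split /=; apply: ler_sum => a _; rewrite -mulrDl ler_wpM2r ?(ltW (wmon_gt0 a)) //.
by rewrite mcoeffD cabsD.
Qed.

Lemma wnormN p : wnorm rho (- p) = wnorm rho p.
Proof.
rewrite -(@wnorm_seqE (- p) (msupp p)) ?msupp_uniq //; last first.
  by move=> a; rewrite (perm_mem (msuppN p)).
by apply: eq_bigr => a _; rewrite mcoeffN cabsN.
Qed.

Lemma wnorm0 : wnorm rho 0 = 0.
Proof. by rewrite /wnorm; apply: big1 => a _; rewrite mcoeff0 cabs0 mul0r. Qed.

Lemma wnorm_monomial (c : C) a : wnorm rho (c *: mpolyX C a) = cabs c * wmon rho a.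
Proof.
rewrite -(@wnorm_seqE _ [:: a]) //.
  by rewrite big_seq1 mcoeffZ mcoeffX eqxx mulr1.
by move=> a' /msuppZ_le; rewrite msuppX.
Qed.

Lemma wnorm_sum (I : Type) (s : seq I) (P : pred I) (F : I -> A) :
  wnorm rho (\sum_(i <- s | P i) F i) <= \sum_(i <- s | P i) wnorm rho (F i).
Proof.
elim/big_ind2: _ => [|p x q y hp hq|//]; first by rewrite wnorm0.
by apply: le_trans (wnormD _ _) _; exact: lerD.
Qed.

Lemma wnormM p q : wnorm rho (p * q) <= wnorm rho p * wnorm rho q.
Proof.
rewrite {1}(mpolyE p) {1}(mpolyE q) big_distrlr /=.
apply: le_trans (wnorm_sum _ _ _) _; rewrite /wnorm big_distrlr /=; apply: ler_sum => a _.
apply: le_trans (wnorm_sum _ _ _) _; apply: ler_sum => a' _.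
rewrite -scalerAl -scalerAr scalerA -mpolyXD wnorm_monomial cabsM wmonD.
by rewrite mulrACA.
Qed.

Lemma wnorm_mulX p a (c : C) : cabs c * wmon rho a * wnorm rho p <= wnorm rho (p * (c *: mpolyX C a)).
Proof.
rewrite -scalerAr -mul_mpolyC.
apply: le_trans (@wnorm_seq _ [seq mnm_add a a' | a' <- msupp p] _); last first.
  by rewrite map_inj_uniq ?msupp_uniq // => u v /addmI.
rewrite big_map /wnorm mulr_sumr; apply: ler_sum => a' _.
by rewrite mcoeffCM mcoeffMX cabsM wmonD mulrACA.
Qed.

(* This bound makes the formal quotient of a convergent series by g converge. *)
Lemma wnorm_quotient_bound p g a0 : a0 \in msupp g ->
  (\sum_(a <- msupp g | a != a0) cabs (mcoeff a g) * wmon rho a) * 2 <=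
    cabs (mcoeff a0 g) * wmon rho a0 ->
  cabs (mcoeff a0 g) * wmon rho a0 * wnorm rho p <= 2 * wnorm rho (p * g).
Proof.
(* [g] splits into its dominant term [t], which multiplies norms by at least [T], and a rest of norm
   at most [T / 2]. *)
move=> a0g; set t := mcoeff a0 g *: mpolyX C a0; set T := cabs _ * _ => hg.
have gt : wnorm rho (g - t) * 2 <= T.
  apply: le_trans hg; rewrite ler_wpM2r //.
  have -> : g - t = \sum_(a <- msupp g | a != a0) mcoeff a g *: mpolyX C a.
    by rewrite {1}(mpolyE g) (bigD1_seq a0) ?msupp_uniq //= addrAC subrr add0r.
  by apply: le_trans (wnorm_sum _ _ _) _; apply: ler_sum => a _; rewrite wnorm_monomial.
have h1 := wnorm_mulX p a0 (mcoeff a0 g); rewrite -/t -/T in h1.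
have h2 : wnorm rho (p * t) <= wnorm rho (p * g) + wnorm rho p * wnorm rho (g - t).
  have -> : p * t = p * g + - (p * (g - t)) by rewrite mulrBr opprB addrC subrK.
  by apply: le_trans (wnormD _ _) _; rewrite wnormN lerD2l wnormM.
have h3 : wnorm rho p * wnorm rho (g - t) * 2 <= T * wnorm rho p.
  by rewrite -mulrA mulrC ler_wpM2r ?wnorm_ge0.
move: h1 h2 h3; generalize (wnorm rho (p * t)) (wnorm rho (p * g)) (wnorm rho p * wnorm rho (g - t)) (T * wnorm rho p).
by move=> x y z w; lra.
Qed.
End Positive.

(** [bmultinom n m] ranges over degrees below [m], so the part of degree [d] first appears in
    [trunc c d.+1]. *)
Definition trunc (c : multinom n -> C) (m : nat) : A :=
  \sum_(a : bmultinom n m) c a *: mpolyX C a.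

Lemma mcoeff_trunc c m a : mcoeff a (trunc c m) = if (mdeg a < m)%N then c a else 0.
Proof.
rewrite /trunc raddf_sum /=; under eq_bigr do rewrite mcoeffZ mcoeffX.
case: ltnP => am.
  rewrite (bigD1 (BMultinom am)) //= eqxx mulr1 big1 ?addr0 // => a' aa'.
  rewrite (_ : (_ == a) = false) ?mulr0 //; apply: contraNF aa' => /eqP e.
  by apply/eqP/val_inj.
rewrite big1 // => a' _; rewrite (_ : (_ == a) = false) ?mulr0 //.
by apply: contraTF (bmdeg a') => /eqP ->; rewrite -leqNgt.
Qed.

Lemma ev_trunc c m (x : 'rV[C]_n) : ev x (trunc c m) = \sum_(a : bmultinom n m) c a * \prod_(i < n) x 0 i ^+ a i.
Proof.
rewrite /trunc rmorph_sum; apply: eq_bigr => a _ /=.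
by rewrite -mul_mpolyC rmorphM /= evC; congr (_ * _); exact: mevalX.
Qed.

Lemma wnorm_trunc rho c m : (forall i, 0 < rho i) ->
  wnorm rho (trunc c m) = \sum_(a : bmultinom n m) cabs (c a) * wmon rho a.
Proof.
move=> r0; rewrite -(@wnorm_seqE _ r0 _ (map (@bmnm n m) (enum [set: bmultinom n m]%SET))).
- rewrite big_map big_enum /=; apply: eq_big => [a|a _]; first by rewrite inE.
  by rewrite mcoeff_trunc bmdeg.
- by rewrite map_inj_uniq ?enum_uniq //; exact: val_inj.
- move=> a; rewrite mcoeff_msupp mcoeff_trunc; case: ltnP => [am _|_]; last by rewrite eqxx.
  by apply/mapP; exists (BMultinom am) => //; rewrite mem_enum inE.
Qed.

Lemma wmon_cst (r : R) a : wmon (fun=> r) a = r ^+ mdeg a.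
Proof. by rewrite /wmon mdegE expr_sum. Qed.

End WeightedNorm.

Section PowerSeries.
Variables (R : realType) (n : nat).
Notation C := (Cplx R).
Notation A := (mpoly n C).
Implicit Types (p q : A) (a : multinom n) (x : 'rV[C]_n) (c : multinom n -> C) (h : 'rV[C]_n -> C).

Definition converges_on c h (r M : R) := [/\ 0 < r, 0 <= M,
  forall m, \sum_(a : bmultinom n m) cabs (c a) * r ^+ mdeg a <= M &
  forall x, vabs x < r -> (fun m => ev x (trunc c m)) @ \oo --> h x].

Lemma has_power_seriesP c h :
  has_power_series c 0 h <-> exists r M, converges_on c h r M.
Proof.
split=> [[r [r0 [[M hM] hx]]]|[r [M [r0 M0 hM hx]]]].
  have er : r = toC (cRe r) by rewrite -(RRe_real (gtr0_real r0)).
  have r1 : 0 < cRe r by rewrite -toC_lt -er rmorph0.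
  have hM' m : \sum_(a : bmultinom n m) cabs (c a) * cRe r ^+ mdeg a <= cRe M.
    have := hM m; have -> : \sum_(a : bmultinom n m) `|c a| * r ^+ mdeg a =
      toC (\sum_(a : bmultinom n m) cabs (c a) * cRe r ^+ mdeg a).
      rewrite rmorph_sum; apply: eq_bigr => a _.
      by rewrite rmorphM rmorphXn /= cnormE -er.
    by rewrite lecE => /andP[_].
  exists (cRe r), (cRe M); split=> //.
    apply: le_trans (hM' 0%N); apply: sumr_ge0 => a _.
    by rewrite mulr_ge0 ?cabs_ge0 // exprn_ge0 // ltW.
  move=> x xr; have xb : ball 0 r x.
    split=> // i j; rewrite ord1 -ball_normE /= er cnormE toC_lt mxE sub0r cabsN.
    exact: le_lt_trans (vabs_coord x j) xr.
  have := hx x xb; under eq_fun do under eq_bigr do under eq_bigr do rewrite mxE subr0.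
  by under [X in _ -> X @ _ --> _]eq_fun do rewrite ev_trunc.
exists (toC r); split; first by rewrite -(rmorph0 toC) toC_lt.
split.
  exists (toC M) => m; have -> : \sum_(a : bmultinom n m) `|c a| * toC r ^+ mdeg a =
      toC (\sum_(a : bmultinom n m) cabs (c a) * r ^+ mdeg a).
    by rewrite rmorph_sum; apply: eq_bigr => a _; rewrite rmorphM rmorphXn /= cnormE.
  by rewrite toC_le.
move=> x [_ xb]; have xr : vabs x < r.
  rewrite vabs_lt //; apply/forallP => i; have := xb 0 i.
  by rewrite -ball_normE /= mxE sub0r normrN cnormE toC_lt.
have := hx x xr; under [X in _ -> X @ _ --> _]eq_fun do under eq_bigr do under eq_bigr do rewrite mxE subr0.
by under eq_fun do rewrite ev_trunc.
Qed.

Lemma cvg_cabs_le (u : nat -> C) (l w : C) (B : R) k : u @ \oo --> l ->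
  (forall m, (k <= m)%N -> cabs (u m - w) <= B) -> cabs (l - w) <= B.
Proof.
move=> ul h; rewrite leNgt; apply/negP => lt.
have : nbhs l [set z | cabs (l - z) < cabs (l - w) - B].
  by apply/cnbhsP; exists (cabs (l - w) - B) => //; rewrite subr_gt0.
move/ul => [N _ hN]; have h1 : cabs (l - u (maxn N k)) < cabs (l - w) - B := hN (maxn N k) (leq_maxl _ _).
have h2 := h (maxn N k) (leq_maxr _ _).
suff : cabs (l - w) < cabs (l - w) by rewrite ltxx.
apply: le_lt_trans (cabs_distD (u (maxn N k)) l w) _.
by apply: lt_le_trans (ltr_leD h1 h2) _; rewrite subrK.
Qed.

(** All terms left have degree at least [k], so passing from radius [r] to [vabs x] gains
    [(vabs x / r) ^+ k]. This estimate serves both for Cauchy sequences and for remainders. *)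
Lemma trunc_tail c (r M : R) x k m : 0 < r ->
  (forall m, \sum_(a : bmultinom n m) cabs (c a) * r ^+ mdeg a <= M) ->
  vabs x <= r -> (k <= m)%N -> cabs (ev x (trunc c m) - ev x (trunc c k)) <= M * (vabs x / r) ^+ k.
Proof.
move=> r0 hM xr km; rewrite -rmorphB /=; set p := trunc c m - trunc c k.
have pE a : mcoeff a p = if (k <= mdeg a < m)%N then c a else 0.
  rewrite mcoeffB !mcoeff_trunc; case: (ltnP (mdeg a) k) => ak /=.
    by rewrite (leq_trans ak km) subrr.
  by rewrite subr0.
have x0 := vabs_ge0 x; have t0 : 0 <= vabs x / r by rewrite divr_ge0 // ltW.
have t1 : vabs x / r <= 1 by rewrite ler_pdivrMr // mul1r.
rewrite evE; apply: le_trans (cabs_sum _ _ _) _.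
apply: le_trans (_ : \sum_(a <- msupp p) (vabs x / r) ^+ k * (cabs (c a) * r ^+ mdeg a) <= _).
  rewrite !big_seq; apply: ler_sum => a; rewrite mcoeff_msupp pE.
  case: ifP => [/andP[ka am] _|_]; last by rewrite eqxx.
  rewrite cabsM mulrCA ler_wpM2l ?cabs_ge0 // cabs_prod.
  apply: le_trans (_ : vabs x ^+ mdeg a <= _).
    rewrite mdegE expr_sum; apply: ler_prod => i _.
    by rewrite cabsX exprn_ge0 ?cabs_ge0 //= lerXn2r ?nnegrE ?cabs_ge0 // vabs_coord.
  rewrite -{1}[vabs x](@divfK _ r) ?gt_eqF // exprMn ler_wpM2r ?exprn_ge0 ?(ltW r0) //.
  exact: ler_wiXn2l.
rewrite -mulr_sumr mulrC ler_wpM2r ?exprn_ge0 //; apply: le_trans (hM m).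
have re (i : 'I_n) : 0 < (fun=> r) i by [].
rewrite (_ : \sum_(a : bmultinom n m) _ = wnorm (fun=> r) (trunc c m)); last first.
  by rewrite wnorm_trunc //; apply: eq_bigr => a _; rewrite wmon_cst.
apply: le_trans (wnorm_seq re (trunc c m) (msupp_uniq p)); rewrite !big_seq.
apply: ler_sum => a; rewrite mcoeff_msupp pE wmon_cst mcoeff_trunc.
by case: ifP => [/andP[ka ->] _|_]; last by rewrite eqxx.
Qed.

Lemma power_series_tail c h (r M : R) x k : converges_on c h r M -> vabs x < r ->
  cabs (h x - ev x (trunc c k)) <= M * (vabs x / r) ^+ k.
Proof.
move=> [r0 M0 hM hx] xr; apply: (cvg_cabs_le (k := k) (hx x xr)) => m km.
exact: trunc_tail r0 hM (ltW xr) km.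
Qed.

Definition hpart c d : A := pihomog mdeg d (trunc c d.+1).

Lemma hpart_homog c d : hpart c d \is ishomog1 d mdeg.
Proof. exact: pihomogP. Qed.

Lemma mcoeff_hpart c d a : mcoeff a (hpart c d) = if mdeg a == d then c a else 0.
Proof. by rewrite mcoeff_pihomog mcoeff_trunc; case: eqP => // ->; rewrite ltnSn. Qed.

Lemma truncS c d : trunc c d.+1 = trunc c d + hpart c d.
Proof.
apply/mpolyP => a; rewrite mcoeffD mcoeff_hpart !mcoeff_trunc ltnS leq_eqVlt.
by case: eqP => [->|_] /=; rewrite ?ltnn ?add0r ?addr0.
Qed.

Lemma trunc_zero c : trunc c 0 = 0.
Proof. by apply/mpolyP => a; rewrite mcoeff_trunc mcoeff0. Qed.

Lemma truncE c d : trunc c d = \sum_(j < d) hpart c j.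
Proof. by elim: d => [|d IH]; rewrite ?big_ord0 ?trunc_zero // big_ord_recr truncS IH. Qed.

Lemma bigO_small (u B : R) : 0 <= u -> (exists2 e, 0 < e & forall t, 0 < t -> t < e -> u <= B * t) -> u = 0.
Proof.
move=> u0 [e e0 h]; apply/eqP; rewrite eq_le u0 andbT leNgt; apply/negP => lt.
pose t := Num.min (e / 2) (u / (2 * (`|B| + 1))).
have B1 : 0 < 2 * (`|B| + 1) by rewrite mulr_gt0 // ltr_wpDl.
have t0 : 0 < t by rewrite lt_min !divr_gt0.
have te : t < e by rewrite gt_min ltr_pdivrMr // ltr_pMr // ltr1n.
have := h t t0 te; apply/negP; rewrite -ltNge.
have tB : t * (2 * (`|B| + 1)) <= u by rewrite -ler_pdivlMr // ge_min lexx orbT.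
have : B * t <= `|B| * t by rewrite ler_wpM2r ?ler_norm // ltW.
by lra.
Qed.

(** Induction on [d]: once the lower parts vanish at [x], the equation [h (t x) = 0] says that
    [t ^ d] times the part of degree [d] is [O(t ^ (d + 1))] for small [t > 0]. *)
Lemma hpart_vanish c h (V : set 'rV[C]_n) : has_power_series c 0 h ->
  (forall x (t : C), V x -> V (t *: x)) ->
  (\forall x \near (0 : 'rV[C]_n), V x -> h x = 0) ->
  forall d x, V x -> ev x (hpart c d) = 0.
Proof.
move=> /has_power_seriesP[r [M hc]] hV /vnbhsP[e e0 he] d x Vx.
have [r0 M0 _ _] := hc.
elim/ltn_ind: d => d IH; apply/eqP; rewrite -cabs_eq0; apply/eqP.
pose N := vabs x + 1; have N0 : 0 < N by rewrite ltr_wpDl ?vabs_ge0.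
apply: (@bigO_small _ (M * (vabs x / r) ^+ d.+1)); first exact: cabs_ge0.
exists (Num.min (e / N) (r / N)); first by rewrite lt_min !divr_gt0.
move=> t t0; rewrite lt_min !ltr_pdivlMr // => /andP[te tr].
have tx : vabs (toC t *: x) = t * vabs x by rewrite vabsZ cabs_toC gtr0_norm.
have tN : t * vabs x <= t * N by rewrite ler_wpM2l ?(ltW t0) // lerDl.
have h0 : h (toC t *: x) = 0.
  by apply: he; [rewrite sub0r vabsN tx; apply: le_lt_trans tN te|exact: hV].
have := @power_series_tail c h r M (toC t *: x) d.+1 hc.
rewrite tx => /(_ (le_lt_trans tN tr)); rewrite h0 sub0r cabsN truncE rmorph_sum /=.
rewrite big_ord_recr /= big1 ?add0r; last first.
  by move=> j _; rewrite (ev_homog _ _ (hpart_homog _ _)) IH ?mulr0.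
rewrite (ev_homog _ _ (hpart_homog _ _)) cabsM cabsX cabs_toC (gtr0_norm t0).
rewrite -mulrA exprMn => H.
have td : 0 < t ^+ d by rewrite exprn_gt0.
rewrite -(ler_pM2l td); apply: (le_trans H).
have -> : (t * vabs x) ^+ d.+1 = t ^+ d * t * vabs x ^+ d.+1 by rewrite exprMn exprSr.
by rewrite exprMn le_eqVlt; apply/orP; left; apply/eqP; ring.
Qed.

End PowerSeries.

Section QuotientSeries.
Variables (R : realType).
Notation C := (Cplx R).

Lemma geometric_small (B s e : R) : 0 <= s -> s < 1 -> 0 < e -> exists N, B * s ^+ N < e.
Proof.
move=> s0 s1 e0; have B1 : 0 < `|B| + 1 by rewrite ltr_wpDl.
have : `|s| < 1 by rewrite ger0_norm.
move/cvg_expr/cvgrPdist_lt => /(_ (e / (`|B| + 1)) (divr_gt0 e0 B1))[N _ hN]; exists N.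
have := hN N (leqnn N); rewrite sub0r normrN ger0_norm ?exprn_ge0 // ltr_pdivlMr // => h.
have sN : 0 <= s ^+ N by rewrite exprn_ge0.
apply: le_lt_trans h; rewrite mulrC ler_wpM2l //.
by apply: le_trans (ler_norm B) _; rewrite lerDl.
Qed.

Lemma real_geometric_cvg (u : nat -> R) (B s : R) : 0 <= s -> s < 1 ->
  (forall k m, (k <= m)%N -> `|u m - u k| <= B * s ^+ k) -> exists l : R, u @ \oo --> l.
Proof.
move=> s0 s1 h; suff /cvg_ex : cvg (u @ \oo) by [].
apply: cauchy_cvg; apply: cauchy_exP => e e0; have [N hN] := geometric_small B s0 s1 e0.
exists (u N), N => // m /= Nm; rewrite -ball_normE /= distrC.
exact: le_lt_trans (h _ _ Nm) hN.
Qed.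

Lemma geometric_cvg (u : nat -> C) (B s : R) : 0 <= s -> s < 1 ->
  (forall k m, (k <= m)%N -> cabs (u m - u k) <= B * s ^+ k) -> exists l : C, u @ \oo --> l.
Proof.
move=> s0 s1 h.
have [|a ha] := @real_geometric_cvg (fun m => cRe (u m)) B s s0 s1.
  by move=> k m km; rewrite -cReN -cReD; apply: le_trans (cRe_le _) (h _ _ km).
have [|b hb] := @real_geometric_cvg (fun m => cIm (u m)) B s s0 s1.
  by move=> k m km; rewrite -cImN -cImD; apply: le_trans (cIm_le _) (h _ _ km).
exists (toC a + Ci * toC b) => A /cnbhsP[e e0 hA].
have e2 : 0 < e / 2 by rewrite divr_gt0.
move/cvgrPdist_lt : ha => /(_ _ e2)[N1 _ h1]; move/cvgrPdist_lt : hb => /(_ _ e2)[N2 _ h2].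
exists (maxn N1 N2) => // m /=; rewrite geq_max => /andP[m1 m2]; apply: hA.
apply: le_lt_trans (cabs_le _) _; rewrite [ltRHS]splitr.
rewrite !(cReD, cImD, cReN, cImN, cReM, cImM) !cRe_toC !cIm_toC /= !mul0r !mulr0 mul1r !(add0r, addr0, subr0, subrr).
by apply: ltrD; [exact: h1|exact: h2].
Qed.

Variable (n : nat).
Notation A := (mpoly n C).
Implicit Types (p q : A) (a : multinom n) (x : 'rV[C]_n) (c : multinom n -> C) (h : 'rV[C]_n -> C).

(** Only the part of [q] of degree [d - e] contributes in degree [d]. The conditional guards the
    truncated subtraction: for [d < e] the product has no part of degree [d], and [p = 0]. *)
Lemma homog_quotient p q g d e : p \is ishomog1 d mdeg -> g \is ishomog1 e mdeg -> p = q * g ->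
  p = (if (e <= d)%N then pihomog mdeg (d - e) q else 0) * g.
Proof.
move=> ph gh pE.
have {1}-> : p = pihomog mdeg d p by rewrite pihomog_dE.
rewrite {1}pE {1}(pihomog_sum (leqnn (msize q))) mulr_suml raddf_sum /=.
have E (j : 'I_(msize q)) : pihomog mdeg d (pihomog mdeg j q * g) =
    if (j + e)%N == d then pihomog mdeg j q * g else 0.
  have hj : pihomog mdeg j q * g \is ishomog1 (j + e) mdeg by rewrite dhomogM ?pihomogP.
  by case: eqP => [<-|/eqP h]; rewrite ?(pihomog_dE hj) ?(pihomog_ne0 h hj).
rewrite (eq_bigr _ (fun j _ => E j)) -big_mkcond /=.
case: ifP => ed; last first.
  rewrite mul0r big_pred0 // => j; apply: contraFF ed => /eqP <-; exact: leq_addl.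
have [jm|mj] := ltnP (d - e) (msize q).
  rewrite (big_pred1 (Ordinal jm)) // => j; rewrite -[RHS](eqn_add2r e) /= subnK //.
rewrite big_pred0 => [|j].
  suff -> : pihomog mdeg (d - e) q = 0 by rewrite mul0r.
  apply/mpolyP => m; rewrite mcoeff_pihomog mcoeff0; case: eqP => // md; apply/eqP.
  apply: contraTT mj; rewrite -mcoeff_msupp -ltnNge -md; exact: msize_mdeg_lt.
apply/negP => /eqP je; have := ltn_ord j; rewrite ltnNge -{1}(addnK e j) je mj //.
Qed.

Section Quotient.
Variables (g : A) (e : nat).
Hypotheses (gh : g \is ishomog1 e mdeg) (g0 : g != 0).

Lemma min_radius (rho : 'I_n -> R) : (forall i, 0 < rho i) -> exists2 r, 0 < r & forall i, r <= rho i.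
Proof.
move=> h; exists (\big[Num.min/1]_i rho i); last by move=> i; rewrite (bigD1 i) //= ge_min lexx.
by elim/big_ind: _ => // x y x0 y0; rewrite lt_min x0.
Qed.

Lemma wnorm_mono (r s : 'I_n -> R) p : (forall i, 0 <= r i <= s i) -> wnorm r p <= wnorm s p.
Proof.
move=> h; apply: ler_sum => a _; rewrite ler_wpM2l ?cabs_ge0 //; apply: ler_prod => i _.
by have /andP[r0 rs] := h i; rewrite exprn_ge0 //= lerXn2r ?nnegrE ?(le_trans r0).
Qed.

(** The quotients of the homogeneous parts form a formal series; [wnorm_quotient_bound] makes it
    converge on a polydisc where one monomial of [g] is dominant. *)
Lemma quotient_series c h : has_power_series c 0 h ->
  (forall d, exists q, hpart c d = q * g) ->
  exists q : 'rV[C]_n -> C, analytic_at 0 q /\ \forall x \near (0 : 'rV[C]_n), h x = q x * ev x g.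
Proof.
move=> /has_power_seriesP[r [M [r0 M0 hM hx]]] /choice[q0 hq0].
pose Q j := pihomog mdeg j (q0 (j + e)%N).
have Qh j : Q j \is ishomog1 j mdeg by exact: pihomogP.
have hQ j : hpart c (e + j)%N = Q j * g.
  by rewrite (homog_quotient (hpart_homog c _) gh (hq0 _)) leq_addr addKn /Q addnC.
have hsmall d : (d < e)%N -> hpart c d = 0.
  by move=> de; rewrite (homog_quotient (hpart_homog c _) gh (hq0 _)) leqNgt de mul0r.
pose cq a := mcoeff a (Q (mdeg a)).
have hcq j : hpart cq j = Q j.
  apply/mpolyP => a; rewrite mcoeff_hpart /cq; case: eqP => [->//|/eqP aj].
  by apply/esym/eqP; apply: contraNT aj; rewrite -mcoeff_msupp ; move/dhomogP: (Qh j) => Qj /Qj /= ->.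
have tE m : trunc cq m * g = trunc c (e + m).
  rewrite !truncE big_split_ord /= [X in _ = X + _]big1 => [|j _]; last exact: hsmall.
  rewrite add0r.
  by rewrite mulr_suml; apply: eq_bigr => j _; rewrite hcq hQ.
(* The radii that make a monomial dominant differ in general; the smaller common radius [s] fits the
   definition of a power series. *)
have [rho [rhor [a0 a0g dom]]] := dominant_monomial g0 r0.
have rho0 i : 0 < rho i by have /andP[] := rhor i.
have [s s0 srho] := min_radius rho0.
pose T := cabs (mcoeff a0 g) * wmon rho a0.
have T0 : 0 < T by rewrite mulr_gt0 ?wmon_gt0 // cabs_gt0 -mcoeff_msupp.
pose M' := 2 * M / T.
have hM' m : \sum_(a : bmultinom n m) cabs (cq a) * s ^+ mdeg a <= M'.
  have -> : \sum_(a : bmultinom n m) cabs (cq a) * s ^+ mdeg a = wnorm (fun=> s) (trunc cq m).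
    by rewrite wnorm_trunc //; apply: eq_bigr => a _; rewrite wmon_cst.
  apply: le_trans (_ : wnorm rho (trunc cq m) <= _).
    by apply: wnorm_mono => i; rewrite (ltW s0) srho.
  rewrite /M' ler_pdivlMr // [_ * T]mulrC.
  have WB := wnorm_quotient_bound rho0 (trunc cq m) a0g dom.
  apply: le_trans WB _; rewrite tE ler_wpM2l //.
  apply: le_trans (hM (e + m)%N).
  apply: (@le_trans _ _ (wnorm (fun=> r) (trunc c (e + m)))).
    by apply: wnorm_mono => i; have /andP[/ltW -> ->] := rhor i.
  by rewrite wnorm_trunc // le_eqVlt; apply/orP; left; apply/eqP; apply: eq_bigr => a _; rewrite wmon_cst.
have M'0 : 0 <= M' by apply: divr_ge0; [rewrite mulr_ge0|exact: ltW].
have conv x : vabs x < s -> exists l : C, (fun m => ev x (trunc cq m)) @ \oo --> l.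
  move=> xs; apply: (@geometric_cvg _ M' (vabs x / s)).
  - by rewrite divr_ge0 ?vabs_ge0 // ltW.
  - by rewrite ltr_pdivrMr // mul1r.
  - by move=> k m km; exact: (trunc_tail s0 hM' (ltW xs) km).
have : forall x, exists l : C, vabs x < s -> (fun m => ev x (trunc cq m)) @ \oo --> l.
  by move=> x; have [/conv[l hl]|_] := ltP (vabs x) s; [exists l|exists 0].
move/choice => [q hq]; exists q; split.
  by exists cq; apply/has_power_seriesP; exists s, M'; split.
apply/vnbhsP; exists (Num.min s r); first by rewrite lt_min s0.
move=> x; rewrite sub0r vabsN lt_min => /andP[xs xr].
have h1 : (fun m => ev x (trunc cq m) * ev x g) @ \oo --> q x * ev x g.
  have cc : (fun=> ev x g) @ \oo --> ev x g by exact: cvg_cst.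
  exact: (cvgM (hq x xs) cc).
have h2 : (fun m => ev x (trunc c (e + m))) @ \oo --> h x.
  move=> B /(hx x xr)[N _ hN]; exists N => // m /= Nm; apply: hN => /=.
  by rewrite (leq_trans Nm) // leq_addl.
have h3 : (fun m => ev x (trunc cq m) * ev x g) = (fun m => ev x (trunc c (e + m))).
  by apply/funext => m; rewrite -tE rmorphM.
by rewrite h3 in h1; exact: (@cvg_unique C (@norm_hausdorff _ C) _ _ _ _ h2 h1).
Qed.

End Quotient.
End QuotientSeries.

Section Multiplicity.
Variables (R : realType) (n : nat).
Notation C := (Cplx R).
Notation A := (mpoly n C).
Implicit Types (p q : A) (a : multinom n) (x b : 'rV[C]_n) (c : multinom n -> C) (u v h g : 'rV[C]_n -> C).

Lemma ev_power_series p : has_power_series (fun a => mcoeff a p) 0 (fun x => ev x p).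
Proof.
have E m : (msize p <= m)%N -> trunc (fun a => mcoeff a p) m = p.
  move=> pm; apply/mpolyP => a; rewrite mcoeff_trunc; case: ltnP => // ma.
  apply/esym/eqP; apply: contraTT ma; rewrite -mcoeff_msupp -ltnNge => /msize_mdeg_lt.
  by move/leq_trans; apply.
have one0 (i : 'I_n) : 0 < (fun=> 1 : R) i by [].
apply/has_power_seriesP; exists 1, (wnorm (fun=> 1) p); split=> //.
- exact: wnorm_ge0.
- move=> m; have -> : \sum_(a : bmultinom n m) cabs (mcoeff a p) * 1 ^+ mdeg a =
      wnorm (fun=> 1) (trunc (fun a => mcoeff a p) m).
    by rewrite wnorm_trunc //; apply: eq_bigr => a _; rewrite wmon_cst.
  apply: le_trans (wnorm_seq one0 p (msupp_uniq (trunc (fun a => mcoeff a p) m))).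
  rewrite /wnorm; apply: ler_sum => a _; rewrite mcoeff_trunc.
  by case: ifP => // _; rewrite cabs0 mul0r mulr_ge0 ?cabs_ge0 // ltW // wmon_gt0.
- move=> x _ B hB; exists (msize p) => // m /= pm; rewrite E //.
  exact: nbhs_singleton hB.
Qed.

Lemma ev_vanishing_order p e : p \is ishomog1 e mdeg -> p != 0 -> vanishing_order (fun x => ev x p) e.
Proof.
move=> /dhomogP ph p0; exists (fun a => mcoeff a p); split; first exact: ev_power_series.
have [s ps] : exists a, a \in msupp p.
  apply: contrapT => H; move/negP: p0; apply; apply/eqP/mpolyP => a; rewrite mcoeff0.
  by apply/eqP; apply: contraT; rewrite -mcoeff_msupp => ap; case: H; exists a.
split; last by exists s; rewrite -mcoeff_msupp; split=> //; exact: (ph s ps).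
move=> a ae; apply/eqP; apply: contraTT ae; rewrite -mcoeff_msupp => ap.
by rewrite (ph a ap : mdeg a = e) ltnn.
Qed.

Lemma vanishing_order_upper u k : vanishing_order u k ->
  exists2 M : R, 0 <= M & exists2 e : R, 0 < e & forall x, vabs x < e -> cabs (u x) <= M * vabs x ^+ k.
Proof.
move=> [c [/has_power_seriesP[r [M hc]] [ck _]]]; have [r0 M0 _ _] := hc.
exists (M / r ^+ k); first by rewrite divr_ge0 // exprn_ge0 // ltW.
exists r => // x xr; have := power_series_tail k hc xr.
have -> : trunc c k = 0.
  by apply/mpolyP => a; rewrite mcoeff_trunc mcoeff0; case: ifP => // /ck.
by rewrite rmorph0 subr0 expr_div_n mulrCA mulrC -mulrA.
Qed.

Lemma analytic_bounded u : analytic_at 0 u ->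
  exists2 M : R, 0 <= M & exists2 e : R, 0 < e & forall x, vabs x < e -> cabs (u x) <= M.
Proof.
move=> [c /has_power_seriesP[r [M hc]]]; have [r0 M0 _ _] := hc.
exists M => //; exists r => // x xr; have := power_series_tail 0 hc xr.
by rewrite trunc_zero rmorph0 subr0 expr0 mulr1.
Qed.

Lemma vanishing_order_lower u k : vanishing_order u k ->
  exists b, exists2 v : R, 0 < v & exists2 M : R, 0 <= M & exists2 e : R, 0 < e &
    forall t : R, 0 < t -> t < e -> v * t ^+ k <= cabs (u (toC t *: b)) + M * t ^+ k.+1.
Proof.
move=> [c [/has_power_seriesP[r [M hc]] [ck [a [ak ca]]]]]; have [r0 M0 _ _] := hc.
have Hk : trunc c k.+1 = hpart c k.
  rewrite truncS (_ : trunc c k = 0) ?add0r //.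
  by apply/mpolyP => a'; rewrite mcoeff_trunc mcoeff0; case: ifP => // /ck.
have H0 : hpart c k != 0.
  by apply: contraNneq ca => /(congr1 (mcoeff a)); rewrite mcoeff_hpart ak eqxx mcoeff0 => ->.
have [b hb] := mpoly_nonzero_ev H0; exists b, (cabs (ev b (hpart c k))); first by rewrite cabs_gt0.
exists (M * (vabs b / r) ^+ k.+1); first by rewrite mulr_ge0 // exprn_ge0 // divr_ge0 ?vabs_ge0 // ltW.
have N0 : 0 < vabs b + 1 by rewrite ltr_wpDl ?vabs_ge0.
exists (r / (vabs b + 1)); first by rewrite divr_gt0.
move=> t t0; rewrite ltr_pdivlMr // => tr.
have tb : vabs (toC t *: b) = t * vabs b by rewrite vabsZ cabs_toC gtr0_norm.
have tbr : vabs (toC t *: b) < r.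
  by rewrite tb; apply: le_lt_trans tr; rewrite ler_wpM2l ?(ltW t0) // lerDl.
have := power_series_tail k.+1 hc tbr; rewrite Hk (ev_homog _ _ (hpart_homog c k)) tb.
set w := u _; set z := ev b _; rewrite cabsC => T.
have -> : cabs z * t ^+ k = cabs (toC t ^+ k * z).
  by rewrite cabsM cabsX cabs_toC gtr0_norm // mulrC.
have E : M * (vabs b / r) ^+ k.+1 * t ^+ k.+1 = M * (t * vabs b / r) ^+ k.+1.
  by rewrite -mulrA -exprMn [vabs b / r * t]mulrC mulrA.
rewrite E -{1}[toC t ^+ k * z](subrK w) [X in _ <= X]addrC.
by apply: le_trans (cabsD _ _) _; rewrite lerD2r.
Qed.

(** Along a real ray on which [u] has exact order [k], the equation [u = q v] with [q] bounded
    forces [u] to have order at least [l]. *)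
Lemma vanishing_order_dvd (u v q : 'rV[C]_n -> C) k l : vanishing_order u k -> vanishing_order v l ->
  analytic_at 0 q -> (\forall x \near (0 : 'rV[C]_n), u x = q x * v x) -> (l <= k)%N.
Proof.
move=> /vanishing_order_lower[b [w w0 [M M0 [e e0 lo]]]] /vanishing_order_upper[M1 M10 [e1 e10 up]].
move=> /analytic_bounded[M2 M20 [e2 e20 qb]] /vnbhsP[e3 e30 uE].
rewrite leqNgt; apply/negP => kl; have : w = 0; last by move=> w00; rewrite w00 ltxx in w0.
have N0 : 0 < vabs b + 1 by rewrite ltr_wpDl ?vabs_ge0.
pose M3 := M2 * (M1 * vabs b ^+ l); have M30 : 0 <= M3 by rewrite !mulr_ge0 // exprn_ge0 ?vabs_ge0.
apply: (@bigO_small _ _ (M3 + M)); first exact: ltW.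
exists (Num.min (Num.min 1 e) (Num.min (Num.min e1 e2) e3 / (vabs b + 1))).
  by rewrite !lt_min ltr01 e0 divr_gt0 // !lt_min e10 e20 e30.
move=> t t0; rewrite !lt_min ltr_pdivlMr // !lt_min => /andP[/andP[t1 te] /andP[/andP[te1 te2] te3]].
have tb : vabs (toC t *: b) = t * vabs b by rewrite vabsZ cabs_toC gtr0_norm.
have tbN : vabs (toC t *: b) <= t * (vabs b + 1) by rewrite tb ler_wpM2l ?(ltW t0) // lerDl.
have H := lo t t0 te; rewrite uE ?sub0r ?vabsN ?(le_lt_trans tbN) // cabsM in H.
have H1 : cabs (q (toC t *: b)) * cabs (v (toC t *: b)) <= M2 * (M1 * vabs (toC t *: b) ^+ l).
  by apply: ler_pM; rewrite ?cabs_ge0 ?qb ?up ?(le_lt_trans tbN).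
have {H} H := le_trans H (lerD H1 (lexx _)).
have tk : 0 < t ^+ k by rewrite exprn_gt0.
rewrite -(ler_pM2r tk); apply: le_trans H _.
rewrite tb exprMn mulrDl mulrDl; apply: lerD; last by rewrite exprS mulrA.
rewrite /M3 -!mulrA ler_wpM2l // ler_wpM2l // mulrC ler_wpM2l ?exprn_ge0 ?vabs_ge0 //.
by rewrite -exprS ler_wiXn2l // ?ltW.
Qed.

Lemma multiplicity_unique (V : set 'rV[C]_n) g e : reduced_equation V g -> vanishing_order g e ->
  multiplicity V = e.
Proof.
move=> gV ge; apply: xget_unique; first by exists g.
move=> k [g' [g'V g'k]]; apply/eqP; rewrite eqn_leq.
have D g1 g2 k1 k2 : reduced_equation V g1 -> reduced_equation V g2 ->
    vanishing_order g1 k1 -> vanishing_order g2 k2 -> (k1 <= k2)%N.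
  move=> [_ [_ g1V]] [ag2 [Vg2 _]] ok1 ok2.
  have [|q [aq qE]] := g1V g2 ag2; first by apply: filterS Vg2 => x [].
  exact: (vanishing_order_dvd ok2 ok1 aq qE).
by rewrite (D _ _ _ _ g'V gV g'k ge) (D _ _ _ _ gV g'V ge g'k).
Qed.

Theorem homogeneous_multiplicity (g : A) e (V : set 'rV[C]_n) : g \is ishomog1 e mdeg -> g != 0 ->
  (forall x, ev x g = 0 <-> V x) ->
  (forall p, (forall x, V x -> ev x p = 0) -> exists q, p = q * g) ->
  multiplicity V = e.
Proof.
move=> gh g0 gV NS; apply: (@multiplicity_unique V (fun x => ev x g)); last exact: ev_vanishing_order.
split; first by exists (fun a => mcoeff a g); exact: ev_power_series.
split; first by near=> x; split=> /gV.
move=> h [c hc] hV; apply: (quotient_series gh g0 hc) => d; apply: NS.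
apply: (hpart_vanish hc _ hV) => x t /gV xV; apply/gV.
by rewrite (ev_homog _ _ gh) xV mulr0.
Unshelve. all: by end_near.
Qed.

End Multiplicity.

(** * Complex space as real space: compact balls and invariance of domain *)

Lemma rV_nbhsP (R : realType) (N : nat) (x : 'rV[R]_N) (A : set 'rV[R]_N) :
  nbhs x A <-> exists2 e, 0 < e & forall y, `|x - y| < e -> A y.
Proof.
split=> [/nbhs_ballP[e /= e0 h]|[e e0 h]].
  by exists e => // y xy; apply: h; rewrite -ball_normE.
by apply/nbhs_ballP; exists e => // y; rewrite -ball_normE; exact: h.
Qed.

Section ComplexSpace.
Variables (R : realType) (n : nat).
Notation C := (Cplx R).
Notation Cn := ('rV[C]_n).
Notation Rn := ('rV[R]_(n + n)).
Implicit Types (x p q : Cn) (y : Rn).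

Definition unrealify y : Cn := \row_i (toC (lsubmx y 0 i) + @Ci R * toC (rsubmx y 0 i)).

Lemma realifyK : cancel (@realify R n) unrealify.
Proof.
move=> x; apply/rowP => i; rewrite mxE row_mxKl row_mxKr !mxE.
by rewrite [RHS]cplxE.
Qed.

Lemma unrealifyK : cancel unrealify (@realify R n).
Proof.
move=> y; rewrite /realify -[RHS]hsubmxK; congr row_mx; apply/rowP => i; rewrite !mxE.
  by rewrite -[complex.Re _]/(cRe _) cReD cReM /=; ring.
by rewrite -[complex.Im _]/(cIm _) cImD cImM /=; ring.
Qed.

Lemma realifyB x p : realify (x - p) = realify x - realify p.
Proof.
rewrite /realify opp_row_mx add_row_mx; congr row_mx; apply/rowP => i; rewrite !mxE.
  by rewrite -[complex.Re _]/(cRe _) cReD cReN.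
by rewrite -[complex.Im _]/(cIm _) cImD cImN.
Qed.

Lemma realify_norm x : `|realify x| <= vabs x.
Proof.
rewrite rV_norm_le ?vabs_ge0 //; apply/forallP => i; rewrite mxE.
case: (fintype.split i) => j; rewrite mxE; apply: le_trans (vabs_coord x j).
  exact: cRe_le.
exact: cIm_le.
Qed.

Lemma vabs_realify x : vabs x <= 2 * `|realify x|.
Proof.
rewrite vabs_le ?mulr_ge0 //; apply/forallP => i; apply: le_trans (cabs_le _) _.
rewrite mulr2n mulrDl mul1r; apply: lerD.
  by have := rV_coord_le (realify x) (lshift n i); rewrite row_mxEl mxE.
by have := rV_coord_le (realify x) (rshift n i); rewrite row_mxEr mxE.
Qed.

Lemma realify_continuous : continuous (@realify R n).
Proof.
move=> x A /nbhs_normP[e /= e0 hA]; apply/vnbhsP; exists e => // x' xx'; apply: hA.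
by rewrite /= -realifyB; apply: le_lt_trans (realify_norm _) xx'.
Qed.

Lemma unrealify_continuous : continuous unrealify.
Proof.
move=> y A /vnbhsP[e /= e0 hA]; apply/rV_nbhsP; exists (e / 2); first by rewrite divr_gt0.
move=> y' /= yy'; apply: hA; apply: le_lt_trans (vabs_realify _) _.
by rewrite realifyB !unrealifyK mulrC -ltr_pdivlMr.
Qed.

Lemma vabs_dist x p : `|vabs x - vabs p| <= vabs (x - p).
Proof.
have h (a b : Cn) : vabs a - vabs b <= vabs (a - b) by rewrite lerBlDr -{1}[a](subrK b) vabsD.
by rewrite ler_norml h andbT lerNl opprB vabsC h.
Qed.

Lemma vabs_continuous : continuous (@vabs R n).
Proof.
move=> x A /nbhs_normP[e /= e0 hA]; apply/vnbhsP; exists e => // x' xx'; apply: hA.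
exact: le_lt_trans (vabs_dist x x') xx'.
Qed.

Lemma vball_compact p (r : R) : compact [set x | vabs (x - p) <= r].
Proof.
have K : compact (unrealify @` [set y | `|y - realify p| <= r]).
  apply: continuous_compact; last exact: closed_cube_compact.
  by apply: continuous_subspaceT; exact: unrealify_continuous.
apply: subclosed_compact K _.
  have -> : [set x | vabs (x - p) <= r] = (fun x => vabs (x - p)) @^-1` [set u | u <= r] by [].
  apply: closed_comp; last exact: closed_le.
  move=> x _; apply: (@continuous_comp _ _ _ (fun x => x - p) (@vabs R n)).
    by apply: (@continuousB _ _ _ id (fun=> p)) => //; exact: cst_continuous.
  exact: vabs_continuous.
move=> x xr; exists (realify x); last exact: realifyK.
by rewrite /= -realifyB; apply: le_trans (realify_norm _) xr.
Qed.

(** The norms satisfy [|realify x| <= vabs x <= 2 * |realify x|], so the real ball of radius [r / 2]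
    fits into the complex one. The same factor causes the [2 * r] of
    [complex_near_identity_image]. *)
Lemma complex_embedding_interior (r : R) p (h g : Cn -> Cn) :
  let B := [set x | vabs (x - p) <= r] in
  0 < r -> {within B, continuous h} -> (forall x, B x -> g (h x) = x) ->
  {within h @` B, continuous g} -> nbhs (h p) (h @` B).
Proof.
move=> B r0 ch gh cg.
pose D := [set y | `|y - realify p| <= r / 2].
have DB y : D y -> B (unrealify y).
  move=> yD; apply: le_trans (vabs_realify _) _; rewrite realifyB unrealifyK mulrC -ler_pdivlMr //.
pose H := @realify R n \o h \o unrealify; pose G := @realify R n \o g \o unrealify.
have cH : {within D, continuous H}.
  apply: (@within_comp _ _ _ D B unrealify (@realify R n \o h) DB).
    by apply: continuous_subspaceT; exact: unrealify_continuous.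
  exact: within_comp_continuous ch realify_continuous.
have cG : {within H @` D, continuous G}.
  apply: (@within_comp _ _ _ (H @` D) (h @` B) unrealify (@realify R n \o g)).
  - by move=> _ [y Dy <-]; exists (unrealify y); [exact: DB|rewrite /H /= realifyK].
  - by apply: continuous_subspaceT; exact: unrealify_continuous.
  - exact: within_comp_continuous cg realify_continuous.
have GH y : D y -> G (H y) = y.
  by move=> Dy; rewrite /G /H /= realifyK gh ?unrealifyK //; exact: DB.
have r2 : 0 < r / 2 by rewrite divr_gt0.
have := @embedding_interior R (n + n) (r / 2) (realify p) H G r2 cH GH cG.
rewrite /H /= realifyK => /(@realify_continuous (h p)) HH.
apply: (@filterS _ _ (nbhs_filter (h p)) _ _ _ HH) => x /= [y Dy /(congr1 unrealify)].
by rewrite !realifyK => <-; exists (unrealify y) => //; exact: DB.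
Qed.

Lemma complex_near_identity_image (r e : R) p q (f : Cn -> Cn) :
  0 < r -> {within [set x | vabs (x - p) <= 2 * r], continuous f} ->
  (forall x, vabs (x - p) <= 2 * r -> vabs (f x - x) <= e) -> vabs (q - p) <= r - e ->
  exists2 x, vabs (x - p) <= 2 * r & f x = q.
Proof.
move=> r0 cf fe qp; pose D := [set y | `|y - realify p| <= r].
have DB y : D y -> vabs (unrealify y - p) <= 2 * r.
  by move=> yD; apply: le_trans (vabs_realify _) _; rewrite realifyB unrealifyK ler_pM2l.
have [||||y yD fy] := @near_identity_image R (n + n) r e (realify p) (realify q)
    (@realify R n \o f \o unrealify).
- by [].
- apply: (@within_comp _ _ _ D [set x | vabs (x - p) <= 2 * r] unrealify (@realify R n \o f) DB).
    by apply: continuous_subspaceT; exact: unrealify_continuous.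
  exact: within_comp_continuous cf realify_continuous.
- move=> y yD; rewrite /= -[y in _ - y]unrealifyK -realifyB; apply: le_trans (realify_norm _) _.
  by apply: fe; exact: DB.
- by rewrite -realifyB; apply: le_trans (realify_norm _) qp.
exists (unrealify y); first exact: DB.
by rewrite -[q]realifyK -fy /= realifyK.
Qed.

End ComplexSpace.

Section Tubes.
Variable R : realType.
Notation C := (Cplx R).

Lemma cdisc_compact (r : R) : compact [set z : C | cabs z <= r].
Proof.
have -> : [set z : C | cabs z <= r] = (fun x : 'rV[C]_1 => x 0 0) @` [set x | vabs (x - 0) <= r].
  apply/seteqP; split=> [z zr|_ [x xr <-]]; last first.
    by apply: le_trans xr; rewrite subr0; exact: vabs_coord.
  exists (const_mx z); last by rewrite mxE.
  have r0 := le_trans (cabs_ge0 z) zr.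
  by rewrite /= subr0 vabs_le //; apply/forallP => i; rewrite mxE.
apply: continuous_compact; last exact: vball_compact.
by apply: continuous_subspaceT; exact: coord_continuous.
Qed.

Lemma tube (T : topologicalType) (K : set T) (Q : T -> R -> Prop) (s : R) : compact K ->
  (forall x, K x -> exists2 N, nbhs x N & exists2 d, 0 < d & forall y t, N y -> K y ->
     0 <= t <= 1 -> `|s - t| < d -> Q y t) ->
  exists2 d, 0 < d & forall t, 0 <= t <= 1 -> `|s - t| < d -> forall x, K x -> Q x t.
Proof.
move=> /compact_near_coveringP cK h.
have : \forall t \near s, K `<=` (fun x => K x -> 0 <= t <= 1 -> Q x t).
  apply: (cK R (nbhs s) (fun t x => K x -> 0 <= t <= 1 -> Q x t)) => x Kx.
  have [N xN [d d0 hN]] := h x Kx.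
  exists (N, [set t | `|s - t| < d]).
    by split=> //; apply/nbhs_normP; exists d.
  by move=> [y t] /= [Ny st] Ky t01; apply: hN.
move=> /nbhs_normP[d /= d0 hd]; exists d => // t t01 st x Kx.
exact: (hd t st x Kx Kx t01).
Qed.

(** Quantifying over all [d' <= d] makes the property stable under shrinking, so a minimum over the
    list works. *)
Lemma common_radius (I : eqType) (rs : seq I) (P : I -> R -> Prop) :
  (forall i, i \in rs -> exists2 d, 0 < d & forall d', 0 < d' -> d' <= d -> P i d') ->
  exists2 d, 0 < d & forall i, i \in rs -> forall d', 0 < d' -> d' <= d -> P i d'.
Proof.
elim: rs => [_|i rs IH h]; first by exists 1.
have [|d d0 hd] := IH; first by move=> j jrs; apply: h; rewrite inE jrs orbT.
have [d1 d10 hd1] := h i (mem_head _ _); exists (Num.min d d1); first by rewrite lt_min d0.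
move=> j; rewrite inE => /orP[/eqP ->|jrs] d' d'0; rewrite le_min => /andP[d'd d'd1].
  exact: hd1.
exact: hd.
Qed.

End Tubes.

(** * Index of loops around a simple point *)

Section PuncturedDisc.
Variable R : realType.
Notation C := (Cplx R).
Notation cis := (@cis R).
Notation I01 := (`[0, 1]%classic : set R).

(** [a] is the index of [v] on the circle of radius [eta]. In polar coordinates a loop of winding
    number [k] deforms, inside the punctured disc, to that circle run [k] times. *)
Lemma punctured_disc_wind (v : C -> C) (eta : R) : 0 < eta ->
  {within [set z | 0 < cabs z <= eta], continuous v} ->
  (forall z, 0 < cabs z <= eta -> v z != 0) ->
  exists a : int, forall (z : R -> C) (k : int), {within I01, continuous z} ->
    (forall x, 0 <= x <= 1 -> 0 < cabs (z x) <= eta) -> z 0 = z 1 -> wind z k ->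
    wind (fun x => v (z x)) (a * k).
Proof.
move=> eta0 cv v0; set D := [set z | _] in cv.
pose V (x : R) := v (0 + toC eta * cis (2 * pi * x)).
have circD x : D (0 + toC eta * cis (2 * pi * x)).
  by rewrite /D /= add0r cabsM cabs_cis mulr1 cabs_toC gtr0_norm // eta0 lexx.
have cV : continuous V.
  have : {within [set: R], continuous V}.
    apply: (@within_comp _ _ _ setT D (fun x : R => 0 + toC eta * cis (2 * pi * x)) v) => //.
    by apply: continuous_subspaceT; exact: circle_continuous.
  by move=> h; apply/continuous_subspace_setT; exact: h.
have V0 x : V x != 0 by apply: v0; exact: circD.
have V1 x : V (x + 1) = V x.
  by rewrite /V (mulrDr (2 * pi)) cisD cis_1 mulr1.
have [a wa] : exists a, wind V a.
  apply: wind_ex; [exact: continuous_subspaceT|by move=> x _; exact: V0|].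
  by have := V1 0; rewrite add0r.
exists a => z k cz zD z01 wz.
have [j wj] : exists j, wind (fun x => v (z x)) j.
  apply: wind_ex; last by rewrite z01.
    by apply: (@within_comp _ _ _ I01 D z v) => // x /= x01; apply: zD; move: x01; rewrite in_itv.
  by move=> x x01; apply: v0; exact: zD.
suff -> : a * k = j by [].
apply: wind_uniq (wind_power k cV V0 V1 wa) _.
have [th [cth pth eth]] := wz.
(* Modulus and argument are interpolated linearly between the loop [z] and the circle run [k]
   times. *)
pose m (q : R * R) : R := (1 - q.1) * cabs (z q.2) + q.1 * eta.
pose ang (q : R * R) : R := (1 - q.1) * th q.2 + q.1 * (2 * pi * (k%:~R * q.2)).
pose H (q : R * R) := v (toC (m q) * cis (ang q)).
have c1 : {within I01 `*` I01, continuous (fun q : R * R => q.1)}.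
  by apply: continuous_subspaceT => q; exact: cvg_fst.
have c2 : {within I01 `*` I01, continuous (fun q : R * R => q.2)}.
  by apply: continuous_subspaceT => q; exact: cvg_snd.
have s2 (q : R * R) : (I01 `*` I01) q -> I01 q.2 by case.
have cz2 : {within I01 `*` I01, continuous (fun q : R * R => cabs (z q.2))}.
  apply: (@within_comp_continuous _ _ _ _ (fun q : R * R => z q.2)); last exact: cabs_continuous.
  exact: (within_comp s2 c2 cz).
have cth2 : {within I01 `*` I01, continuous (fun q : R * R => th q.2)} by exact: (within_comp s2 c2 cth).
have cc (u : R) : {within I01 `*` I01, continuous (fun q : R * R => u)}.
  by apply: continuous_subspaceT => q; exact: cst_continuous.
have cm : {within I01 `*` I01, continuous m}.
  apply: within_continuous_add; first by apply: within_continuous_prod => //; apply: within_continuous_sub.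
  exact: within_continuous_prod.
have cang : {within I01 `*` I01, continuous ang}.
  apply: within_continuous_add; first by apply: within_continuous_prod => //; apply: within_continuous_sub.
  by apply: within_continuous_prod => //; apply: within_continuous_prod => //; apply: within_continuous_prod.
have mD s x : 0 <= s <= 1 -> 0 <= x <= 1 -> 0 < m (s, x) <= eta.
  move=> /andP[s0 s1] /zD; rewrite /m /=; set w := cabs _ => /andP[w0 w1].
  have s10 : 0 <= 1 - s by rewrite subr_ge0.
  apply/andP; split; last by nra.
  by have [->|sn] := eqVneq s 0; [lra|have : 0 < s by rewrite lt_def sn]; nra.
have HD s x : 0 <= s <= 1 -> 0 <= x <= 1 -> D (toC (m (s, x)) * cis (ang (s, x))).
  move=> hs hx; have /andP[m0 m1] := mD s x hs hx.
  by rewrite /D /= cabsM cabs_cis mulr1 cabs_toC gtr0_norm // m0 m1.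
have := @wind_homotopy R H j; rewrite /H /m /ang /= => WH.
have E0 x : 0 <= x <= 1 -> v (z x) = H (0, x).
  move=> x01; rewrite /H /m /ang /= !subr0 !mul0r !addr0 !mul1r.
  by have [_ <-] := pth x x01.
have : wind (fun x => H (1, x)) j.
  apply: (@wind_homotopy R H j).
  - apply: (@within_comp _ _ _ _ D (fun q => toC (m q) * cis (ang q)) v) => //.
      move=> [s x] [/=]; rewrite !in_itv /= => hs hx; exact: HD.
    apply: within_continuous_prod.
      by apply: (within_comp_continuous cm); exact: toC_continuous.
    by apply: (within_comp_continuous cang); exact: cis_continuous.
  - by move=> s x hs hx; apply: v0; exact: HD.
  - move=> s hs; rewrite /H /m /ang /= z01; congr (v (_ * _)).
    have -> : th 1 = th 0 + k%:~R * (2 * pi) by rewrite -eth addrC subrK.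
    rewrite mulr0 mulr0 mulr0 addr0 mulr1.
    have -> : (1 - s) * (th 0 + k%:~R * (2 * pi)) + s * (2 * pi * k%:~R) =
      (1 - s) * th 0 + k%:~R * (2 * pi) by ring.
    by rewrite cisD cis_int mulr1.
  - exact: (wind_eq E0 wj).
apply: wind_eq => x x01; rewrite /H /V /m /ang /= subrr !mul0r !add0r !mul1r.
by [].
Qed.

End PuncturedDisc.

Section WithinContinuity.
Variables (R : realType) (n : nat).
Notation C := (Cplx R).
Notation Cn := ('rV[C]_n).

Lemma within_ceps (A : set Cn) (f : Cn -> C) : {within A, continuous f} <->
  forall x, A x -> forall e : R, 0 < e -> exists2 d : R, 0 < d &
    forall y, A y -> vabs (x - y) < d -> cabs (f x - f y) < e.
Proof.
rewrite subspace_continuousP; split=> h x Ax.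
  move=> e e0; have : nbhs (f x) [set w | cabs (f x - w) < e] by apply/cnbhsP; exists e.
  move=> /(h x Ax)/vnbhsP[d d0 hd]; exists d => // y Ay xy; exact: hd.
move=> B /cnbhsP[e e0 hB]; have [d d0 hd] := h x Ax e e0.
by apply/vnbhsP; exists d => // y xy Ay; apply: hB; exact: hd.
Qed.

Lemma within_veps m (A : set Cn) (f : Cn -> 'rV[C]_m) : {within A, continuous f} <->
  forall x, A x -> forall e : R, 0 < e -> exists2 d : R, 0 < d &
    forall y, A y -> vabs (x - y) < d -> vabs (f x - f y) < e.
Proof.
rewrite subspace_continuousP; split=> h x Ax.
  move=> e e0; have : nbhs (f x) [set w | vabs (f x - w) < e] by apply/vnbhsP; exists e.
  move=> /(h x Ax)/vnbhsP[d d0 hd]; exists d => // y Ay xy; exact: hd.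
move=> B /vnbhsP[e e0 hB]; have [d d0 hd] := h x Ax e e0.
by apply/vnbhsP; exists d => // y xy Ay; apply: hB; exact: hd.
Qed.

End WithinContinuity.

Section LocalCoordinate.
Variables (R : realType) (n : nat).
Notation C := (Cplx R).
Notation A := (mpoly n C).
Notation Cn := ('rV[C]_n).
Implicit Types (x y p : Cn).
Variables (g : A) (e : nat) (b : Cn).
Hypotheses (gh : g \is ishomog1 e mdeg) (gb : ev b g = 1).

Lemma line_monic x : evp x (shift_poly b g) \is monic /\ size (evp x (shift_poly b g)) = e.+1.
Proof.
have [||Fm Fs] := @shift_monic _ _ b g e _.
- by move/dhomogP: gh => h m /h /= ->.
- by rewrite pihomog_dE // gb oner_neq0.
move: Fm Fs; rewrite pihomog_dE // gb invr1 mpolyC1 scale1r => Fm Fs.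
have xm : evp x (shift_poly b g) \is monic by apply: monic_map.
by split=> //; rewrite /evp size_map_poly_id0 // (monicP Fm) rmorph1 oner_neq0.
Qed.

Lemma line_roots x : exists2 rs, size rs = e & forall z, ev (x + z *: b) g = \prod_(r <- rs) (z - r).
Proof.
have [Fm Fs] := line_monic x; have [rs hrs] := closed_field_poly_normal (evp x (shift_poly b g)).
rewrite (monicP Fm) scale1r in hrs; exists rs.
  by move: Fs; rewrite hrs size_prod_XsubC => -[].
by move=> z; rewrite -shift_polyE hrs horner_prod; apply: eq_bigr => r _; rewrite hornerXsubC.
Qed.

(** [cabs (ev x g)] is the product of the moduli of the [e] roots on the line, which therefore
    cannot all be at least [rho]. *)
Lemma small_root x (rho : R) : 0 < rho -> (0 < e)%N -> cabs (ev x g) < rho ^+ e ->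
  exists2 z, cabs z < rho & ev (x + z *: b) g = 0.
Proof.
move=> rho0 e0 xr; have [rs srs h] := line_roots x.
suff [r rrs rr] : exists2 r, r \in rs & cabs r < rho.
  by exists r => //; rewrite h (big_rem r) //= subrr mul0r.
apply: contrapT => H; move: xr; apply/negP; rewrite -leNgt.
have := h 0; rewrite scale0r addr0 => ->; rewrite cabs_prod -srs.
have {}H r : r \in rs -> rho <= cabs r.
  by move=> rrs; rewrite leNgt; apply/negP => rr; apply: H; exists r.
elim: rs H {srs h} => [_|r rs IH H]; first by rewrite big_nil expr0.
rewrite big_cons exprS; apply: ler_pM; rewrite ?exprn_ge0 ?(ltW rho0) //.
  by rewrite sub0r cabsN H ?mem_head.
by apply: IH => r' r'rs; apply: H; rewrite inE r'rs orbT.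
Qed.

(** Taylor coefficients of [g] at [x] in the direction [b]. At a zero [x] of [g], the derivative
    [line_coef x 1] is nonzero exactly when 0 is a simple root of the line. *)
Definition line_coef x k := ev x (shift_poly b g)`_k.

Lemma line_expand x z : ev (x + z *: b) g = \sum_(k < e.+1) line_coef x k * z ^+ k.
Proof.
have [_ Fs] := line_monic x; rewrite -shift_polyE horner_coef Fs.
by apply: eq_bigr => k _; rewrite evpE.
Qed.

(* [(P(z) - P(w)) / (z - w)] is [P'(0)] up to terms that are small with z and w. *)
Lemma simple_root_expansive p : line_coef p 1 != 0 ->
  exists2 c : R, 0 < c & exists2 rho : R, 0 < rho <= 1 & exists2 r : R, 0 < r &
  forall y, vabs (y - p) <= r -> forall z w, cabs z <= rho -> cabs w <= rho ->
    c * cabs (z - w) <= cabs (ev (y + z *: b) g - ev (y + w *: b) g).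
Proof.
set al := line_coef p 1 => al0; have al1 : 0 < cabs al by rewrite cabs_gt0.
have al4 : 0 < cabs al / 4 by rewrite divr_gt0.
have [r r0 hr] := ev_near (shift_poly b g)`_1 p al4.
have /choice[M hM] : forall k, exists M, 0 <= M /\
    forall x, vabs x <= vabs p + r -> cabs (line_coef x k) <= M.
  by move=> k; have [M M0 h] := ev_bounded (shift_poly b g)`_k (vabs p + r); exists M.
pose S := \sum_(k < e.+1) M k * (k%:R : R).
have S0 : 0 <= S by apply: sumr_ge0 => k _; rewrite mulr_ge0 //; case: (hM k).
(* The terms of degree at least 2 then cost a quarter of [cabs al], and moving from [p] to [y]
   another quarter; the constant [cabs al / 2] remains. *)
pose rho := Num.min 1 (cabs al / 4 / (S + 1)).
have rho0 : 0 < rho by rewrite lt_min ltr01 divr_gt0 // ltr_wpDl.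
have rho1 : rho <= 1 by rewrite ge_min lexx.
have rhoS : rho * S <= cabs al / 4.
  have : rho * (S + 1) <= cabs al / 4 by rewrite -ler_pdivlMr ?ltr_wpDl // ge_min lexx orbT.
  by rewrite mulrDr mulr1; apply: le_trans; rewrite lerDl ltW.
exists (cabs al / 2); first by rewrite divr_gt0.
exists rho; first by rewrite rho0.
exists (r / 2); first by rewrite divr_gt0.
move=> y yp z w zr wr.
have yr : vabs (y - p) < r by apply: le_lt_trans yp _; rewrite ltr_pdivrMr // ltr_pMr // ltr1n.
have yM : vabs y <= vabs p + r.
  by rewrite -[y](subrK p) addrC; apply: le_trans (vabsD _ _) _; rewrite lerD2l ltW.
have a1 : cabs (al - line_coef y 1) < cabs al / 4 by apply: hr; rewrite vabsC.
(* [z ^ k - w ^ k = (z - w) * D k], with [D 1 = 1] and [D k] of order [rho] for [k > 1]. *)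
pose D k : C := \sum_(i < k) z ^+ (k.-1 - i) * w ^+ i.
have Dk k : (1 < k)%N -> cabs (D k) <= rho * k%:R.
  move=> k1; apply: le_trans (cabs_sum _ _ _) _.
  apply: le_trans (_ : \sum_(i < k) rho <= _); last by rewrite sumr_const card_ord mulr_natr.
  apply: ler_sum => i _; rewrite cabsM !cabsX.
  apply: le_trans (_ : rho ^+ (k.-1 - i) * rho ^+ i <= _).
    by apply: ler_pM; rewrite ?exprn_ge0 ?cabs_ge0 // lerXn2r // nnegrE ?cabs_ge0 // ltW.
  rewrite -exprD subnK; last by rewrite -ltnS prednK // (ltn_trans _ k1).
  by case: (k) k1 => [|[|k']] //= _; rewrite exprS ler_piMr ?exprn_ile1 ?(ltW rho0).
pose T := \sum_(k < e.+1) line_coef y k * D k.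
have E : ev (y + z *: b) g - ev (y + w *: b) g = (z - w) * T.
  rewrite (line_expand y z) (line_expand y w) -sumrB mulr_sumr; apply: eq_bigr => k _.
  by rewrite -mulrBr subrXX mulrCA /D; congr (_ * (_ * _)); apply: eq_bigr => i _; rewrite -subn1 -subnDA add1n.
rewrite E cabsM mulrC ler_wpM2l ?cabs_ge0 //.
have T1 : cabs (T - line_coef y 1) <= cabs al / 4.
  have e0 : (1 < e.+1)%N.
    rewrite ltnS lt0n; apply: contra_neq al0 => e0; have [_ Fs] := line_monic p.
    by rewrite /al /line_coef -evpE nth_default // Fs e0.
  have D1 : D 1%N = 1 by rewrite /D big_ord_recl big_ord0 addr0 !expr0 mulr1.
  rewrite /T (bigD1 (Ordinal e0)) //= D1 mulr1.
  rewrite addrAC subrr add0r; apply: le_trans (cabs_sum _ _ _) _; apply: le_trans rhoS.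
  rewrite mulr_sumr [X in _ <= X](bigD1 (Ordinal e0)) //= -[X in X <= _]add0r; apply: lerD.
    have [M1 _] := hM 1%N; by rewrite !mulr_ge0 // ltW.
  apply: ler_sum => k k1; have [Mk hMk] := hM k; rewrite cabsM.
  have [k0|k0] := posnP k.
    have -> : D k = 0 by rewrite /D k0 big_ord0.
    by rewrite cabs0 mulr0 !mulr_ge0 // ltW.
  rewrite mulrCA; apply: ler_pM; rewrite ?cabs_ge0 ?hMk ?Dk //.
  rewrite ltn_neqAle k0 andbT eq_sym; apply: contra k1 => /eqP k1; exact/eqP/val_inj.
have : cabs al <= cabs (al - line_coef y 1) + cabs (T - line_coef y 1) + cabs T.
  have -> : al = (al - line_coef y 1) - (T - line_coef y 1) + T by ring.
  apply: le_trans (cabsD _ _) _; rewrite lerD2r; apply: le_trans (cabsB _ _) _.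
  by rewrite (_ : _ + T - _ = al - line_coef y 1); last by ring.
move: a1 T1; move: (cabs al) (cabs (al - _)) (cabs (T - _)) (cabs T) => u1 u2 u3 u4 h1 h2 h3.
lra.
Qed.

Lemma simple_root_coef p (rs : seq C) : uniq rs -> 0 \in rs ->
  (forall z, ev (p + z *: b) g = \prod_(r <- rs) (z - r)) -> line_coef p 1 != 0.
Proof.
move=> urs rs0 h; pose Q := \prod_(r <- rem 0 rs) ('X - r%:P).
have E : evp p (shift_poly b g) = 'X * Q.
  apply/eqP; rewrite -subr_eq0; apply/eqP/poly_eq0_ev => z.
  rewrite hornerD hornerN shift_polyE h (big_rem 0) //= hornerM hornerX subr0 /Q horner_prod.
  by under [X in _ - _ * X]eq_bigr do rewrite hornerXsubC; rewrite subrr.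
rewrite /line_coef -evpE E coefXM /= -horner_coef0 -rootE root_prod_XsubC.
by rewrite mem_rem_uniq // inE eqxx.
Qed.

(** In place of an implicit function theorem, [small_root] finds the zero on the line through [y],
    and expansiveness gives its uniqueness and continuity. The sign in [y - w y *: b] makes [w] grow
    by [z] when [y] moves by [z *: b]. *)
Lemma local_coordinate p : ev p g = 0 -> line_coef p 1 != 0 ->
  exists w : Cn -> C, exists2 rho : R, 0 < rho & exists2 r : R, 0 < r &
    [/\ forall y, vabs (y - p) <= r -> cabs (w y) < rho /\ ev (y - w y *: b) g = 0,
        forall y z, vabs (y - p) <= r -> cabs z <= rho -> ev (y - z *: b) g = 0 -> z = w y &
        {within [set y | vabs (y - p) <= r], continuous w}].
Proof.
move=> p0 a0; have [c c0 [rho /andP[rho0 rho1] [r1 r10 hexp]]] := simple_root_expansive a0.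
have e0 : (0 < e)%N.
  rewrite lt0n; apply: contra_neq a0 => e0; have [_ Fs] := line_monic p.
  by rewrite /line_coef -evpE nth_default // Fs e0.
have [r2 r20 hr2] := ev_near g p (exprn_gt0 e rho0).
pose r := Num.min r1 (r2 / 2); have r0 : 0 < r by rewrite lt_min r10 divr_gt0.
have ex y : exists z, vabs (y - p) <= r -> cabs z < rho /\ ev (y - z *: b) g = 0.
  have [yr|_] := leP (vabs (y - p)) r; last by exists 0.
  have [|z zr hz] := @small_root y rho rho0 e0.
    have := hr2 y; rewrite p0 sub0r cabsN; apply; rewrite vabsC; apply: le_lt_trans yr _.
    by rewrite gt_min; apply/orP; right; rewrite ltr_pdivrMr // ltr_pMr // ltr1n.
  by exists (- z); rewrite cabsN scaleNr opprK.
have /choice[w hw] := ex.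
have uq y z : vabs (y - p) <= r -> cabs z <= rho -> ev (y - z *: b) g = 0 -> z = w y.
  move=> yr zr hz; have [wr hwy] := hw y yr.
  have yr1 : vabs (y - p) <= r1 by apply: le_trans yr _; rewrite ge_min lexx.
  have := hexp y yr1 (- z) (- w y); rewrite (cabsN z) (cabsN (w y)) (scaleNr z) (scaleNr (w y)) hz hwy subr0 cabs0 => /(_ zr (ltW wr)).
  rewrite pmulr_rle0 // -opprD cabsN => h.
  by apply/eqP; rewrite -subr_eq0 -cabs_eq0 eq_le h cabs_ge0.
exists w, rho => //; exists r => //; split=> //.
apply/within_ceps => y yr eps eps0; have [wy hy] := hw y yr.
have yr1 : vabs (y - p) <= r1 by apply: le_trans yr _; rewrite ge_min lexx.
have eta0 : 0 < c * eps / e.+1%:R by rewrite divr_gt0 // mulr_gt0.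
have [d d0 hd] : exists2 d : R, 0 < d & forall k, (k < e.+1)%N -> forall d', 0 < d' -> d' <= d ->
    forall y', vabs (y - y') < d' -> cabs (line_coef y k - line_coef y' k) < c * eps / e.+1%:R.
  have [|d d0 hd] := @common_radius R nat (iota 0 e.+1) (fun k d' => forall y', vabs (y - y') < d' ->
      cabs (line_coef y k - line_coef y' k) < c * eps / e.+1%:R).
    move=> k _; have [d d0 hd] := ev_near (shift_poly b g)`_k y eta0; exists d => // d' _ d'd y' yy'.
    by apply: hd; exact: lt_le_trans yy' d'd.
  by exists d => // k ke; apply: hd; rewrite mem_iota.
exists d => // y' y'r yy'; have [wy' hy'] := hw y' y'r.
have := hexp y yr1 (- w y) (- w y'); rewrite (cabsN (w y)) (cabsN (w y')) => /(_ (ltW wy) (ltW wy')).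
rewrite -opprD cabsN (scaleNr (w y)) (scaleNr (w y')) hy sub0r cabsN => H.
suff B : cabs (ev (y - w y' *: b) g) < c * eps.
  by have := le_lt_trans H B; rewrite ltr_pM2l.
rewrite -[ev _ g]subr0 -hy' -!scaleNr (line_expand y) (line_expand y') -sumrB.
apply: le_lt_trans (cabs_sum _ _ _) _.
apply: lt_le_trans (_ : \sum_(k < e.+1) c * eps / e.+1%:R <= _); last first.
  by rewrite sumr_const card_ord -[X in X <= _]mulr_natr divfK // pnatr_eq0.
apply: ltr_sum => [|k _]; first by apply/hasP; exists ord0; rewrite ?mem_index_enum.
rewrite -mulrBl cabsM; apply: le_lt_trans (_ : cabs (line_coef y k - line_coef y' k) * 1 < _).
  rewrite ler_wpM2l ?cabs_ge0 // cabsX cabsN exprn_ile1 ?cabs_ge0 //.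
  by apply: le_trans (ltW wy') rho1.
by rewrite mulr1; apply: (hd k (ltn_ord k) d).
Qed.

End LocalCoordinate.

Section LocalIndex.
Variables (R : realType) (n : nat).
Notation C := (Cplx R).
Notation A := (mpoly n C).
Notation Cn := ('rV[C]_n).
Notation I01 := (`[0, 1]%classic : set R).
Implicit Types (y p : Cn) (u : Cn -> C).

Lemma within_continuous_scale (X : topologicalType) (D : set X) (f : X -> C) (h : X -> Cn) :
  {within D, continuous f} -> {within D, continuous h} -> {within D, continuous (fun t => f t *: h t)}.
Proof.
move=> /subspace_continuousP cf /subspace_continuousP ch; apply/subspace_continuousP => t Dt.
by apply: cvgZ; [exact: cf|exact: ch].
Qed.

Variables (g : A) (b p : Cn) (w : Cn -> C) (rho r : R).
Hypotheses (rho0 : 0 < rho) (r0 : 0 < r).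
Notation B := [set y | vabs (y - p) <= r].
Hypothesis wE : forall y, B y -> cabs (w y) < rho /\ ev (y - w y *: b) g = 0.
Hypothesis wU : forall y z, B y -> cabs z <= rho -> ev (y - z *: b) g = 0 -> z = w y.
Hypothesis wC : {within B, continuous w}.
Hypothesis gp : ev p g = 0.

Lemma coordinate_eq0 y : B y -> w y = 0 <-> ev y g = 0.
Proof.
move=> By; split=> [w0|y0]; first by have [_] := wE By; rewrite w0 scale0r subr0.
by apply/esym/wU; rewrite ?cabs0 ?scale0r ?subr0 // ltW.
Qed.

Lemma coordinate_shift y (l : C) : B y -> B (y + l *: b) -> cabs (w y + l) <= rho ->
  w (y + l *: b) = w y + l.
Proof.
move=> By Byl h; apply/esym/wU => //; rewrite scalerDl opprD addrA addrAC -addrA addrC.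
have [_ <-] := wE By; congr (ev _ g); apply/rowP => i; rewrite !mxE; ring.
Qed.

Lemma centre_in : B p. Proof. by rewrite /= subrr vabs0 ltW. Qed.

Lemma coordinate_centre : w p = 0. Proof. by apply/(coordinate_eq0 centre_in). Qed.

Lemma coordinate_line (z : C) : cabs z <= rho -> B (p + z *: b) -> w (p + z *: b) = z.
Proof.
by move=> zr Bz; rewrite coordinate_shift ?coordinate_centre ?add0r //; exact: centre_in.
Qed.

(* Slide [c] along the hypersurface to [p] with its [w]-coordinate kept: [u \o c] is homotopic to
   [u] along the loop [w \o c] of the line [p + C b]. *)
Lemma local_index : exists2 r2 : R, 0 < r2 <= r & forall u, {within B, continuous u} ->
  (forall y, B y -> ev y g != 0 -> u y != 0) ->
  exists a : int, forall (c : R -> Cn) (k : int), {within I01, continuous c} ->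
    (forall x, 0 <= x <= 1 -> vabs (c x - p) <= r2) -> c 0 = c 1 ->
    wind (fun x => w (c x)) k -> wind (fun x => u (c x)) (a * k).
Proof.
have N0 : 0 < vabs b + 1 by rewrite ltr_wpDl ?vabs_ge0.
(* Displacements by at most [2 * eta] along [b] stay within [r / 2], so deformed loops that start
   within [r / 2] of [p] remain in [B]. *)
pose eta := Num.min rho (r / 4 / (vabs b + 1)).
have eta0 : 0 < eta by rewrite lt_min rho0 !divr_gt0.
have etarho : eta <= rho by rewrite ge_min lexx.
have etab : eta * vabs b <= r / 4.
  have : eta * (vabs b + 1) <= r / 4 by rewrite -ler_pdivlMr // ge_min lexx orbT.
  by rewrite mulrDr mulr1; apply: le_trans; rewrite lerDl ltW.
have [d d0 hd] : exists2 d : R, 0 < d & forall y, B y -> vabs (p - y) < d -> cabs (w y) < eta.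
  move/within_ceps: wC => /(_ p centre_in eta eta0)[d d0 hd]; exists d => // y By py.
  by have := hd y By py; rewrite coordinate_centre sub0r cabsN.
pose r2 := Num.min (r / 2) (d / 2).
have r20 : 0 < r2 by rewrite lt_min !divr_gt0.
have r2r : r2 <= r / 2 by rewrite ge_min lexx.
have r2d : r2 < d by rewrite gt_min; apply/orP; right; rewrite ltr_pdivrMr // ltr_pMr // ltr1n.
have half : r / 2 <= r by rewrite ler_pdivrMr // ler_pMr // ler1n.
have inB y : vabs (y - p) <= r2 -> B y by move=> h; rewrite /=; apply: le_trans h (le_trans r2r half).
have weta y : vabs (y - p) <= r2 -> cabs (w y) < eta.
  by move=> h; apply: hd; [exact: inB|rewrite vabsC; exact: le_lt_trans h r2d].
have lineB (z : C) : cabs z <= eta -> B (p + z *: b).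
  move=> zr; rewrite /= addrAC subrr add0r vabsZ; apply: le_trans (_ : eta * vabs b <= _).
    by rewrite ler_wpM2r ?vabs_ge0.
  by apply: le_trans etab _; rewrite ler_pdivrMr // ler_pMr // ler1n.
exists r2; first by rewrite r20 (le_trans r2r).
move=> u cu u0; pose v (z : C) := u (p + z *: b).
have lineC (D : set C) : {within D, continuous (fun z : C => p + z *: b)}.
  apply: within_continuous_add; first by apply: continuous_subspaceT => z; exact: cst_continuous.
  apply: within_continuous_scale; first by apply: continuous_subspaceT => z.
  by apply: continuous_subspaceT => z; exact: cst_continuous.
have [||a ha] := @punctured_disc_wind R v eta eta0.
- apply: (@within_comp _ _ _ _ B (fun z : C => p + z *: b) u) => // z /= /andP[_ zr]; exact: lineB.
- move=> z /andP[z0 zr]; apply: u0; first exact: lineB.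
  have Bz := lineB z zr; apply/negP => /eqP/(coordinate_eq0 Bz).
  rewrite coordinate_line //; last exact: le_trans zr etarho.
  by move=> ze; rewrite ze cabs0 ltxx in z0.
exists a => c k cc cr c01 wk.
have cB x : I01 x -> B (c x) by rewrite /= in_itv => h; apply: inB; exact: cr.
have cwc : {within I01, continuous (fun x => w (c x))} by exact: (within_comp cB cc wC).
have wc0 x : 0 <= x <= 1 -> w (c x) != 0 by have [th [_ h _]] := wk; move=> /h[].
have [j wj] : exists j, wind (fun x => u (c x)) j.
  apply: wind_ex; last by rewrite c01.
    exact: (within_comp cB cc cu).
  move=> x x01; have Bx : B (c x) by apply: inB; exact: cr.
  by apply: u0 => //; apply: contra (wc0 x x01) => /eqP/(coordinate_eq0 Bx) ->.
suff -> : a * k = j by [].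
have W1 : wind (fun x => v (w (c x))) (a * k).
  apply: ha => //; last by rewrite c01.
  by move=> x x01; rewrite cabs_gt0 wc0 //= ltW // weta // cr.
apply: wind_uniq W1 _.
(* [Y] contracts the loop to [p]; the correction along [b] in [H] restores the [w]-coordinate of
   [c x] at every time, so the deformation never meets the zero set. *)
pose Y (q : R * R) := p + toC (1 - q.1) *: (c q.2 - p).
pose H (q : R * R) := u (Y q + (w (c q.2) - w (Y q)) *: b).
have YE s x : 0 <= s <= 1 -> 0 <= x <= 1 -> vabs (Y (s, x) - p) <= r2.
  move=> /andP[s0 s1] /cr h; rewrite /Y /= addrAC subrr add0r vabsZ cabs_toC ger0_norm ?subr_ge0 //.
  apply: le_trans h; rewrite ler_piMl ?vabs_ge0 // lerBlDr lerDl //.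
have ZB s x : 0 <= s <= 1 -> 0 <= x <= 1 ->
    B (Y (s, x) + (w (c x) - w (Y (s, x))) *: b) /\
    w (Y (s, x) + (w (c x) - w (Y (s, x))) *: b) = w (c x).
  move=> hs hx; have hY := YE s x hs hx; have hc := cr x hx.
  have BZ : B (Y (s, x) + (w (c x) - w (Y (s, x))) *: b).
    rewrite /= addrAC; apply: le_trans (vabsD _ _) _; rewrite vabsZ.
    have h1 : cabs (w (c x) - w (Y (s, x))) <= eta + eta.
      by apply: le_trans (cabsB _ _) _; apply: lerD; apply: ltW; apply: weta.
    apply: le_trans (lerD hY (ler_wpM2r (vabs_ge0 b) h1)) _; rewrite mulrDl.
    move: etab r2r; set eb := eta * _ => h2 h3; lra.
  split; first exact: BZ.
  have E : w (Y (s, x)) + (w (c x) - w (Y (s, x))) = w (c x) by rewrite addrC subrK.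
  rewrite (coordinate_shift (inB _ hY) BZ) E //.
  by apply: le_trans etarho; apply: ltW; exact: weta.
have proj1 : {within I01 `*` I01, continuous (fun q : R * R => q.1)}.
  by apply: continuous_subspaceT => q; exact: cvg_fst.
have proj2 : {within I01 `*` I01, continuous (fun q : R * R => q.2)}.
  by apply: continuous_subspaceT => q; exact: cvg_snd.
have s2 (q : R * R) : (I01 `*` I01) q -> I01 q.2 by case.
have cst (V : topologicalType) (z : V) : {within I01 `*` I01, continuous (fun q : R * R => z)}.
  by apply: continuous_subspaceT => q; exact: cst_continuous.
have cY : {within I01 `*` I01, continuous Y}.
  apply: (@within_continuous_add C _ _ _ (fun=> p) (fun q : R * R => toC (1 - q.1) *: (c q.2 - p))).
    exact: cst.
  apply: (@within_continuous_scale _ _ (fun q : R * R => toC (1 - q.1)) (fun q : R * R => c q.2 - p)).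
    apply: (@within_comp_continuous _ _ _ _ (fun q : R * R => 1 - q.1)); last exact: toC_continuous.
    by apply: within_continuous_sub; [exact: cst|exact: proj1].
  by apply: within_continuous_sub; [exact: (within_comp s2 proj2 cc)|exact: cst].
have cZ : {within I01 `*` I01, continuous (fun q => Y q + (w (c q.2) - w (Y q)) *: b)}.
  apply: (@within_continuous_add C _ _ _ Y (fun q : R * R => (w (c q.2) - w (Y q)) *: b)); first exact: cY.
  apply: (@within_continuous_scale _ _ (fun q : R * R => w (c q.2) - w (Y q)) (fun=> b)); last exact: cst.
  apply: within_continuous_sub; first exact: (within_comp s2 proj2 cwc).
  apply: (@within_comp _ _ _ _ B Y w _ cY wC).
  by move=> [s x] [/=]; rewrite !in_itv /= => hs hx; apply: inB; exact: YE.
have : wind (fun x => H (1, x)) j.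
  apply: (@wind_homotopy R H j).
  - apply: (@within_comp _ _ _ _ B _ u _ cZ cu).
    by move=> [s x] [/=]; rewrite !in_itv /= => hs hx; have [] := ZB s x hs hx.
  - move=> s x hs hx; have [BZ wZ] := ZB s x hs hx; apply: u0 => //.
    by apply/negP => /eqP/(coordinate_eq0 BZ); rewrite wZ => /eqP; apply/negP; exact: wc0.
  - by move=> s hs; rewrite /H /Y /= c01.
  - apply: wind_eq wj => x x01; rewrite /H /Y /= subr0 rmorph1 scale1r.
    by rewrite (_ : p + (c x - p) = c x) ?subrr ?scale0r ?addr0 // addrC subrK.
apply: wind_eq => x x01; rewrite /H /Y /= subrr rmorph0 scale0r addr0.
by rewrite coordinate_centre subr0.
Qed.

End LocalIndex.

(** * Equisingular families *)

Section Family.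
Variables (R : realType) (n : nat).
Notation C := (Cplx R).
Notation Cn := ('rV[C]_n).
Notation I01 := (`[0, 1]%classic : set R).
Implicit Types (x y p : Cn) (s t : R).

(* In the application [Z] is the zero set at time 0; [k t] inverts [h t]. *)
Record equisingular_family (U : set Cn) (h k : R -> Cn -> Cn) (V : R -> set Cn) (Z : set Cn) : Prop := {
  family_open : forall x, U x -> exists2 r : R, 0 < r & forall y, vabs (y - x) <= r -> U y;
  family_continuous : forall x s, U x -> 0 <= s <= 1 -> forall e : R, 0 < e -> exists2 d : R, 0 < d &
    forall y t, U y -> 0 <= t <= 1 -> vabs (x - y) < d -> `|s - t| < d -> vabs (h s x - h t y) < e;
  family_inverse : forall t x, 0 <= t <= 1 -> U x -> k t (h t x) = x;
  family_inverse_continuous : forall t, 0 <= t <= 1 -> {within h t @` U, continuous (k t)};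
  family_closed : forall z, ~ Z z -> exists2 e : R, 0 < e & forall z', vabs (z - z') < e -> ~ Z z';
  family_zero : forall t x, 0 <= t <= 1 -> U x -> V t x <-> Z (h t x) }.

Variables (U : set Cn) (h k : R -> Cn -> Cn) (V : R -> set Cn) (Z : set Cn).
Hypothesis F : equisingular_family U h k V Z.

Lemma family_slice t (D : set Cn) : 0 <= t <= 1 -> D `<=` U -> {within D, continuous (h t)}.
Proof.
move=> t01 DU; apply/within_veps => x Dx e e0.
have [d d0 hd] := family_continuous F (DU x Dx) t01 e0; exists d => // y Dy xy.
by apply: hd => //; [exact: DU|rewrite subrr normr0].
Qed.

(* Invariance of domain enters here. *)
Lemma family_image s x (e : R) : 0 <= s <= 1 -> U x -> 0 < e -> exists2 d : R, 0 < d &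
  forall z, vabs (h s x - z) < d -> (h s @` U) z /\ vabs (x - k s z) < e.
Proof.
move=> s01 Ux e0; have [r r0 hr] := family_open F Ux.
have BU : [set y | vabs (y - x) <= r] `<=` U by move=> y; exact: hr.
have /vnbhsP[d1 d10 hd1] : nbhs (h s x) (h s @` [set y | vabs (y - x) <= r]).
  apply: (@complex_embedding_interior R n r x (h s) (k s)) => //.
  - exact: family_slice.
  - by move=> y /hr; exact: (family_inverse F).
  - apply: continuous_subspaceW (family_inverse_continuous F s01).
    by move=> _ [y /BU Uy <-]; exists y.
have /within_veps := family_inverse_continuous F s01.
have hx : (h s @` U) (h s x) by exists x.
move=> /(_ _ hx e e0)[d2 d20 hd2]; exists (Num.min d1 d2); first by rewrite lt_min d10.
move=> z; rewrite lt_min => /andP[z1 z2].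
have hz : (h s @` U) z by have [y /BU Uy <-] := hd1 z z1; exists y.
by split=> //; have := hd2 z hz z2; rewrite (family_inverse F).
Qed.

Section Tubes.
Variables (T : topologicalType) (K : set T) (kap : T -> Cn) (s : R).
Hypotheses (cK : compact K) (ckap : continuous kap) (KU : forall z, K z -> U (kap z)) (s01 : 0 <= s <= 1).

Lemma tube_near z (e : R) : K z -> 0 < e -> exists2 N, nbhs z N & exists2 d : R, 0 < d &
  forall (y : T) t, N y -> K y -> 0 <= t <= 1 -> `|s - t| < d ->
    vabs (kap z - kap y) < e /\ vabs (h s (kap z) - h t (kap y)) < e.
Proof.
move=> Kz e0; have [d d0 hd] := family_continuous F (KU Kz) s01 e0.
exists (kap @^-1` [set y | vabs (kap z - y) < Num.min d e]).
  by apply: ckap; apply/vnbhsP; exists (Num.min d e) => //; rewrite lt_min d0.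
exists d => // y t /=; rewrite lt_min => /andP[yd ye] Ky t01 st.
by split=> //; apply: hd => //; exact: KU.
Qed.

(** By [family_closed] and joint continuity of [h], lying off [V t] is an open condition on point
    and time. *)
Lemma tube_avoid : (forall z, K z -> ~ V s (kap z)) ->
  exists2 d : R, 0 < d & forall t, 0 <= t <= 1 -> `|s - t| < d -> forall z, K z -> ~ V t (kap z).
Proof.
move=> KV; apply: (tube (Q := fun z t => ~ V t (kap z)) cK) => z Kz.
have nz : ~ Z (h s (kap z)) by move=> hz; apply: (KV z Kz); apply/(family_zero F s01 (KU Kz)).
have [e e0 he] := family_closed F nz; have [N Nz [d d0 hd]] := tube_near Kz e0.
exists N => //; exists d => // y t Ny Ky t01 st; have [_ /he nzt] := hd y t Ny Ky t01 st.
by move=> /(family_zero F t01 (KU Ky)).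
Qed.

(** The point [k s (h t (kap z))] tends to [kap z] as [t] tends to [s], uniformly on [K]; only the
    inverse at time [s] enters. The map [kap] allows [K] to be a ball or a disc on a line. *)
Lemma tube_transition (Q : T -> Cn -> Prop) :
  (forall z, K z -> exists2 N, nbhs z N & exists2 e : R, 0 < e & forall (y : T) x, N y -> K y ->
     vabs (kap z - x) < e -> Q y x) ->
  exists2 d : R, 0 < d & forall t, 0 <= t <= 1 -> `|s - t| < d -> forall z, K z ->
    (h s @` U) (h t (kap z)) /\ Q z (k s (h t (kap z))).
Proof.
move=> hQ; apply: (tube (Q := fun z t => (h s @` U) (h t (kap z)) /\ Q z (k s (h t (kap z)))) cK) => z Kz.
have [N1 zN1 [e e0 he]] := hQ z Kz; have [d1 d10 hd1] := family_image s01 (KU Kz) e0.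
have [N2 zN2 [d d0 hd]] := tube_near Kz d10.
exists (N1 `&` N2); first exact: filterI.
exists d => // y t [Ny1 Ny2] Ky t01 st; have [_ zy] := hd y t Ny2 Ky t01 st.
by have [im near] := hd1 _ zy; split=> //; exact: he.
Qed.

End Tubes.
End Family.

(** * Comparison of two close times near a simple point *)

Section Transition.
Variables (R : realType) (n : nat).
Notation C := (Cplx R).
Notation A := (mpoly n C).
Notation Cn := ('rV[C]_n).
Notation I01 := (`[0, 1]%classic : set R).
Implicit Types (x y p b : Cn) (s t : R).

(** The polynomial [c] discards the lines of direction [b] that may meet [W] in multiple points. *)
Definition reduced_along b (W : set Cn) e (g : A) := [/\ g \is ishomog1 e mdeg, ev b g = 1,
  forall x, ev x g = 0 <-> W x &
  exists2 c : A, c != 0 & forall x, ev x c != 0 -> exists rs : seq C, [/\ uniq rs, size rs = e &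
    forall z, ev (x + z *: b) g = \prod_(r <- rs) (z - r)]].

Variables (U : set Cn) (h k : R -> Cn -> Cn) (V : R -> set Cn) (Z : set Cn).
Hypothesis F : equisingular_family U h k V Z.
Variables (s t : R) (b p : Cn) (gs gt : A) (es et : nat).
Hypotheses (s01 : 0 <= s <= 1) (t01 : 0 <= t <= 1).
Hypotheses (gsV : forall x, ev x gs = 0 <-> V s x) (gtV : reduced_along b (V t) et gt).
Variables (w : Cn -> C) (rho r r2 : R).
Hypotheses (rho0 : 0 < rho) (r0 : 0 < r) (r20 : 0 < r2) (r2r : r2 <= r).
Notation B := [set y | vabs (y - p) <= r].
Notation B4 := [set y | vabs (y - p) <= 4 * r].
Hypothesis wE : forall y, B y -> cabs (w y) < rho /\ ev (y - w y *: b) gs = 0.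
Hypothesis wU : forall y z, B y -> cabs z <= rho -> ev (y - z *: b) gs = 0 -> z = w y.
Hypothesis wC : {within B, continuous w}.
Hypothesis gp : ev p gs = 0.
Hypothesis index : forall u : Cn -> C, {within B, continuous u} ->
  (forall y, B y -> ev y gs != 0 -> u y != 0) ->
  exists a : int, forall (c : R -> Cn) (k : int), {within I01, continuous c} ->
    (forall x : R, 0 <= x <= 1 -> vabs (c x - p) <= r2) -> c 0 = c 1 ->
    wind (fun x : R => w (c x)) k -> wind (fun x : R => u (c x)) (a * k).
Hypothesis B4U : forall y, B4 y -> U y.
Notation psi := (fun x => k s (h t x)).
Hypothesis near_id : forall x, B4 x -> (h s @` U) (h t x) /\ vabs (psi x - x) <= r2 / 2.

Let in4 y : B y -> B4 y.
Proof. by move=> /= h1; apply: le_trans h1 _; move: r0; lra. Qed.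

Lemma transition_inverse x : B4 x -> [/\ U (psi x), h s (psi x) = h t x & k t (h s (psi x)) = x].
Proof.
move=> Bx; have [[y Uy hy] _] := near_id Bx.
have -> : psi x = y by rewrite -hy (family_inverse F).
by rewrite hy (family_inverse F) //; exact: B4U.
Qed.

Lemma transition_zero x : B4 x -> V t x <-> V s (psi x).
Proof.
move=> Bx; have [Up hp _] := transition_inverse Bx.
by rewrite (family_zero F t01 (B4U Bx)) (family_zero F s01 Up) hp.
Qed.

Lemma transition_continuous : {within B4, continuous psi}.
Proof.
apply: (@within_comp _ _ _ B4 (h s @` U) (h t) (k s)); first by move=> x /near_id[].
  by apply: (family_slice F t01) => y; exact: B4U.
exact: (family_inverse_continuous F s01).
Qed.

(** [psi] moves points by at most [r2 / 2], so the near-identity theorem with radius [2 * r] covers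
    [B]; the passage between real and complex norms doubles this to the [4 * r] of [B4]. *)
Lemma transition_onto y : B y -> exists2 x, B4 x & psi x = y.
Proof.
move=> By; have r00 : 0 < 2 * r by rewrite mulr_gt0.
have E : 2 * (2 * r) = 4 * r by ring.
have := @complex_near_identity_image R n (2 * r) (r2 / 2) p y psi r00; rewrite E.
apply; first exact: transition_continuous.
  by move=> x /near_id[].
apply: le_trans By _; move: r20 r2r; lra.
Qed.

(** [index] is applied to [gt] carried to time [s] by the inverse [k t (h s y)] of [psi], which is
    available on [B] because [psi] covers it. Loops within [r2 / 2] of [p] stay within [r2] after
    [psi]. *)
Lemma transition_index : exists a : int, forall (c : R -> Cn) (j : int), {within I01, continuous c} ->
  (forall x : R, 0 <= x <= 1 -> vabs (c x - p) <= r2 / 2) -> c 0 = c 1 ->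
  wind (fun x : R => w (psi (c x))) j -> wind (fun x : R => ev (c x) gt) (a * j).
Proof.
have [_ _ gtE _] := gtV.
have BU : B `<=` U by move=> y /in4/B4U.
have [||a ha] := index (u := fun y => ev (k t (h s y)) gt).
- apply: (@within_comp_continuous _ _ _ B (fun y => k t (h s y)) (fun y => ev y gt)); last exact: ev_continuous.
  apply: (@within_comp _ _ _ B (h t @` U) (h s) (k t)).
  + move=> y /transition_onto[x Bx <-]; have [_ -> _] := transition_inverse Bx.
    by exists x => //; exact: B4U.
  + exact: (family_slice F s01 BU).
  + exact: (family_inverse_continuous F t01).
- move=> y By; apply: contra => /eqP; have [x Bx xy] := transition_onto By.
  have [_ _] := transition_inverse Bx; rewrite xy => -> /gtE /(transition_zero Bx).
  by rewrite xy => /gsV ->.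
exists a => c j cc cr c01 wj.
have half : r2 / 2 <= r by apply: le_trans r2r; move: r20; lra.
have cB4 (x : R) : 0 <= x <= 1 -> B4 (c x) by move=> /cr h1; apply: in4; exact: le_trans h1 half.
apply: (@wind_eq _ (fun x : R => ev (k t (h s (psi (c x)))) gt)).
  by move=> x /cB4/transition_inverse[_ _ ->].
apply: (ha (fun x : R => psi (c x)) j); [|move=> x x01|by rewrite c01|exact: wj].
  apply: (@within_comp _ _ _ I01 B4 c psi _ cc transition_continuous).
  by move=> x; rewrite /= in_itv /=; exact: cB4.
have [_ n1] := near_id (cB4 x x01).
apply: le_trans (vabs_distD (c x) _ _) _; rewrite (splitr r2); exact: lerD n1 (cr x x01).
Qed.

Variable sig : R.
Hypotheses (sig0 : 0 < sig) (sigb : sig * vabs b <= r2 / 4).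
Hypothesis circle_near : forall z : C, cabs z = sig -> cabs (w (psi (p + z *: b)) - z) < sig.

Let near_psi x : vabs (x - p) <= r2 / 2 -> B4 x /\ B (psi x).
Proof.
move=> xp; have half : r2 / 2 <= r by apply: le_trans r2r; move: r20; lra.
have B4x : B4 x by apply: in4; exact: le_trans xp half.
split=> //; have [_ n1] := near_id B4x; apply: le_trans (vabs_distD x _ _) _.
by apply: le_trans r2r; rewrite (splitr r2); exact: lerD.
Qed.

Let w_neq0 x : vabs (x - p) <= r2 / 2 -> w (psi x) != 0 <-> ev x gt != 0.
Proof.
have [_ _ gtE _] := gtV.
move=> /near_psi[B4x Bx]; split; apply: contra => /eqP.
  by move=> /gtE /(transition_zero B4x) /gsV /(coordinate_eq0 rho0 wE wU Bx) ->.
by move=> /(coordinate_eq0 rho0 wE wU Bx) /gsV /(transition_zero B4x) /gtE ->.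
Qed.

Let disc_in (z : C) : cabs z <= sig -> vabs (p + z *: b - p) <= r2 / 4.
Proof.
move=> zs; rewrite addrAC subrr add0r vabsZ; apply: le_trans sigb.
by rewrite ler_wpM2r ?vabs_ge0.
Qed.

Let quarter : r2 / 4 <= r2 / 2.
Proof. by rewrite ler_pM2l // lef_pV2 ?posrE // ler_nat. Qed.

Lemma psi_line_continuous (D : set C) x : (forall z, D z -> vabs (x + z *: b - p) <= r2 / 2) ->
  {within D, continuous (fun z : C => w (psi (x + z *: b)))}.
Proof.
move=> hD; apply: (@within_comp _ _ _ D [set y | vabs (y - p) <= r2 / 2] (fun z : C => x + z *: b) (fun y => w (psi y)) hD).
  apply: within_continuous_add; first by apply: continuous_subspaceT => z; exact: cst_continuous.
  apply: within_continuous_scale; first by apply: continuous_subspaceT => z.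
  by apply: continuous_subspaceT => z; exact: cst_continuous.
apply: (@within_comp _ _ _ _ B psi w _ _ wC); first by move=> y /near_psi[].
by apply: continuous_subspaceW transition_continuous => y /near_psi[].
Qed.

Lemma wind_psi_circle : wind (fun x : R => w (psi (p + (0 + toC sig * cis (2 * pi * x)) *: b))) 1.
Proof.
have cs (x : R) : cabs (0 + toC sig * cis (2 * pi * x)) = sig.
  by rewrite add0r cabsM cabs_cis mulr1 cabs_toC gtr0_norm.
apply: (@wind_rouche R (fun x : R => 0 + toC sig * cis (2 * pi * x)) (fun x : R => w (psi (p + (0 + toC sig * cis (2 * pi * x)) *: b))) 1).
- by apply: continuous_subspaceT; exact: circle_continuous.
- apply: (@within_comp _ _ _ _ [set z : C | cabs z <= sig] (fun x : R => 0 + toC sig * cis (2 * pi * x)) (fun z => w (psi (p + z *: b)))).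
  + by move=> x _; rewrite /= cs.
  + by apply: continuous_subspaceT; exact: circle_continuous.
  + by apply: psi_line_continuous => z zs; apply: le_trans (disc_in zs) quarter.
- by move=> x x01; rewrite cabsC cs; apply: circle_near.
- by rewrite mulr0 cis0 cis_1.
- by rewrite mulr0 cis0 cis_1.
- by apply: wind_eq (wind_cis 1 sig0) => x _; rewrite add0r mulr1z mulr1.
Qed.

Lemma line_wind (rs : seq C) x z0 (d : R) : 0 < d ->
  (forall z, ev (x + z *: b) gt = \prod_(r <- rs) (z - r)) ->
  (forall z, z \in rs -> cabs (z - z0) != d) ->
  wind (fun y : R => ev (x + (z0 + toC d * cis (2 * pi * y)) *: b) gt) (count (fun z => cabs (z - z0) < d) rs).
Proof.
move=> d0 hrs hd; apply: wind_eq (wind_roots d0 (oner_neq0 C) hd) => y _.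
rewrite hrs scale1r horner_prod; apply: eq_bigr => z _; exact: hornerXsubC.
Qed.

Lemma circle_nonroot (rs : seq C) : (forall z, ev (p + z *: b) gt = \prod_(r <- rs) (z - r)) ->
  forall z, z \in rs -> cabs z != sig.
Proof.
move=> hrs z zrs; apply/negP => /eqP zs.
have /w_neq0 : vabs (p + z *: b - p) <= r2 / 2 by apply: le_trans quarter; apply: disc_in; rewrite zs.
rewrite hrs (big_rem z) //= subrr mul0r eqxx => -[/(_ _)/negP H _].
have := circle_near zs; have [->|/H] // := eqVneq (w (psi (p + z *: b))) 0.
by rewrite sub0r cabsN zs ltxx.
Qed.

Lemma circle_loop_continuous x z0 (d : R) :
  {within I01, continuous (fun y : R => x + (z0 + toC d * cis (2 * pi * y)) *: b)}.
Proof.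
apply: within_continuous_add; first by apply: continuous_subspaceT => z; exact: cst_continuous.
apply: within_continuous_scale; first by apply: continuous_subspaceT; exact: circle_continuous.
by apply: continuous_subspaceT => z; exact: cst_continuous.
Qed.

Lemma circle_loop_closed x z0 (d : R) :
  x + (z0 + toC d * cis (2 * pi * 0)) *: b = x + (z0 + toC d * cis (2 * pi * 1)) *: b.
Proof. by rewrite mulr0 cis0 cis_1. Qed.

Lemma line_root_mem (rs : seq C) x : (forall z, ev (x + z *: b) gt = \prod_(r <- rs) (z - r)) ->
  forall z, ev (x + z *: b) gt = 0 <-> z \in rs.
Proof.
move=> hrs z; rewrite hrs; split=> [/eqP|zrs]; last by rewrite (big_rem z) //= subrr mul0r.
by rewrite prodf_seq_eq0 => /hasP[z' zrs /=]; rewrite subr_eq0 => /eqP ->.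
Qed.

(** Without a root, [w] after [psi] would have no zero on the disc, hence winding number 0 on the
    boundary circle instead of 1. *)
Lemma disc_has_root (rs : seq C) : (forall z, ev (p + z *: b) gt = \prod_(r <- rs) (z - r)) ->
  exists2 z, z \in rs & cabs z < sig.
Proof.
move=> hrs; apply: contrapT => H.
have W0 : wind (fun x : R => w (psi (p + (0 + toC sig * cis (2 * pi * x)) *: b))) 0.
  apply: (@wind_disc R (fun z : C => w (psi (p + z *: b))) 0 sig (ltW sig0)).
    by apply: psi_line_continuous => z /=; rewrite subr0 => zs; apply: le_trans (disc_in zs) quarter.
  move=> z; rewrite subr0 => zs; have xp := le_trans (disc_in zs) quarter.
  apply/(w_neq0 xp); apply/negP => /eqP/(line_root_mem hrs) zrs.
  move: zs; rewrite le_eqVlt (negbTE (circle_nonroot hrs zrs)) => zs; apply: H; by exists z.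
by have := wind_uniq W0 wind_psi_circle.
Qed.

Lemma separating_radius (rs : seq C) (z0 : C) : exists2 d : R, 0 < d &
  forall z, z \in rs -> z != z0 -> d < cabs (z - z0).
Proof.
have [z zrs|d d0 hd] := @common_radius R C rs (fun z d => z != z0 -> d < cabs (z - z0)).
  have [->|zz0] := eqVneq z z0; first by exists 1.
  have zz : 0 < cabs (z - z0) by rewrite cabs_gt0 subr_eq0.
  exists (cabs (z - z0) / 2); first by rewrite divr_gt0.
  by move=> d' _ h1 _; apply: le_lt_trans h1 _; rewrite ltr_pdivrMr // ltr_pMr // ltr1n.
by exists d => // z zrs; exact: hd.
Qed.

Theorem stable_root_count (rs : seq C) : (forall z, ev (p + z *: b) gt = \prod_(r <- rs) (z - r)) ->
  count (fun z => cabs z < sig) rs = 1%N.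
Proof.
move=> hrs; have [a ha] := transition_index.
have [gth gtb gtE [c c0 hc]] := gtV.
set m := count _ rs.
have am : a = m.
  have W1 : wind (fun x : R => ev (p + (0 + toC sig * cis (2 * pi * x)) *: b) gt) (a * 1).
    apply: (ha (fun x : R => p + (0 + toC sig * cis (2 * pi * x)) *: b)).
    - exact: circle_loop_continuous.
    - move=> x _; apply: le_trans quarter; apply: disc_in.
      by rewrite add0r cabsM cabs_cis mulr1 cabs_toC gtr0_norm.
    - exact: circle_loop_closed.
    - exact: wind_psi_circle.
  have W2 := @line_wind rs p 0 sig sig0 hrs.
  rewrite -[a]mulr1 (wind_uniq W1 (W2 _)).
    by congr Posz; apply: eq_count => z; rewrite subr0.
  by move=> z zrs; rewrite subr0; exact: (circle_nonroot hrs zrs).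
have [z1 z1rs z1s] := disc_has_root hrs.
set y1 := p + z1 *: b; have y10 : ev y1 gt = 0 by apply/(line_root_mem hrs).
have y1p : vabs (y1 - p) <= r2 / 4 by apply: disc_in; exact: ltW.
have et0 : (0 < et)%N.
  have [rs' srs' hrs'] := line_roots gth gtb p; rewrite -srs'.
  by have /(line_root_mem hrs') := y10; case: (rs').
have N0 : 0 < vabs b + 1 by rewrite ltr_wpDl ?vabs_ge0.
(* The distances from [p] to [y1], from there to [x1], and along the new line add up to at most
   [r2 / 4 + r2 / 16 + r2 / 8 <= r2 / 2], the radius for which the index is known. *)
pose eta := r2 / 16 / (vabs b + 1); have eta0 : 0 < eta by rewrite !divr_gt0.
have etab : eta * vabs b <= r2 / 16.
  have : eta * (vabs b + 1) <= r2 / 16 by rewrite /eta divfK // gt_eqF.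
  by rewrite mulrDr mulr1; apply: le_trans; rewrite lerDl ltW.
have [d d0 hd] := ev_near gt y1 (exprn_gt0 et eta0).
have r216 : 0 < r2 / 16 by rewrite divr_gt0.
have dd0 : 0 < Num.min d (r2 / 16) by rewrite lt_min d0.
(* The line through [p] may have multiple roots near [y1]. A generic base point [x1] close to [y1]
   gives simple roots, and since [ev x1 gt] is small, one of them, [z2], is close to 0. *)
have [x1] := mpoly_nonzero_near y1 c0 dd0; rewrite lt_min => /andP[x1d x1r] /hc[rs1 [urs1 _ hrs1]].
have [|z2 z2eta z2r] := @small_root R n gt et b gth gtb x1 eta eta0 et0.
  by have := hd x1 x1d; rewrite y10 sub0r cabsN.
have z2rs : z2 \in rs1 by apply/(line_root_mem hrs1).
have [d1 d10 hd1] := separating_radius rs1 z2.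
pose d2 := Num.min d1 eta; have d20 : 0 < d2 by rewrite lt_min d10.
have sep z : z \in rs1 -> z != z2 -> d2 < cabs (z - z2).
  by move=> zrs zz2; rewrite gt_min hd1.
have far : forall z, z \in rs1 -> cabs (z - z2) != d2.
  move=> z zrs; have [->|zz2] := eqVneq z z2; first by rewrite subrr cabs0 lt_eqF.
  by rewrite gt_eqF // sep.
have := line_wind d20 hrs1 far.
have -> : count (fun z => cabs (z - z2) < d2) rs1 = 1%N.
  rewrite (@eq_in_count _ _ (pred1 z2)) ?count_uniq_mem ?z2rs // => z zrs /=.
  have [->|zz2] := eqVneq z z2; first by rewrite subrr cabs0 d20.
  by apply/negbTE; rewrite -leNgt ltW // sep.
move=> W1.
have c2p (x : R) : vabs (x1 + (z2 + toC d2 * cis (2 * pi * x)) *: b - p) <= r2 / 2.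
  have -> : x1 + (z2 + toC d2 * cis (2 * pi * x)) *: b - p =
      (x1 - y1) + (y1 - p) + (z2 + toC d2 * cis (2 * pi * x)) *: b.
    by rewrite addrA subrK addrAC.
  have H : vabs ((z2 + toC d2 * cis (2 * pi * x)) *: b) <= r2 / 16 + r2 / 16.
    rewrite vabsZ; apply: le_trans (_ : (eta + eta) * vabs b <= _); last by rewrite mulrDl; exact: lerD.
    rewrite ler_wpM2r ?vabs_ge0 //; apply: le_trans (cabsD _ _) _; apply: lerD; first exact: ltW.
    by rewrite cabsM cabs_cis mulr1 cabs_toC gtr0_norm // ge_min lexx orbT.
  apply: le_trans (vabsD _ _) _; apply: le_trans (lerD (vabsD _ _) H) _.
  rewrite [vabs (x1 - y1)]vabsC; move: x1r y1p; move: (vabs (y1 - x1)) (vabs (y1 - p)) => v1 v2 h1 h2; move: r20; lra.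
have [j wj] : exists j, wind (fun x : R => w (psi (x1 + (z2 + toC d2 * cis (2 * pi * x)) *: b))) j.
  apply: wind_ex.
  - apply: (@within_comp _ _ _ I01 [set z : C | vabs (x1 + z *: b - p) <= r2 / 2]
      (fun x : R => z2 + toC d2 * cis (2 * pi * x)) (fun z => w (psi (x1 + z *: b)))).
    + by move=> x _; exact: c2p.
    + by apply: continuous_subspaceT; exact: circle_continuous.
    + exact: psi_line_continuous.
  - move=> x x01; apply/(w_neq0 (c2p x)).
    by have [th [_ hth _]] := W1; have [] := hth x x01.
  - by rewrite (circle_loop_closed x1 z2 d2).
have W2 := ha (fun x : R => x1 + (z2 + toC d2 * cis (2 * pi * x)) *: b) j
  (@circle_loop_continuous x1 z2 d2) (fun (x : R) _ => c2p x) (circle_loop_closed x1 z2 d2) wj.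
(* The small circle about [z2] encloses one simple root, so its winding number 1 is a multiple of
   [a]; as [a = m] is a natural number, [m = 1]. *)
have E : a * j = 1 by exact: (wind_uniq W2 W1).
have /eqP : (`|a| * `|j|)%N = 1%N by rewrite -abszM E.
by rewrite muln_eq1 am absz_nat => /andP[/eqP].
Qed.

End Transition.

(** * Local constancy of the degree *)

Section LocalConstancy.
Variables (R : realType) (n : nat).
Notation C := (Cplx R).
Notation A := (mpoly n C).
Notation Cn := ('rV[C]_n).
Implicit Types (y p b : Cn) (s t : R).

Variables (U : set Cn) (h k : R -> Cn -> Cn) (V : R -> set Cn) (Z : set Cn).
Hypothesis F : equisingular_family U h k V Z.
Variables (s : R) (b : Cn) (gs : A) (es : nat).
Hypotheses (s01 : 0 <= s <= 1) (gsR : reduced_along b (V s) es gs).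

Lemma line_continuous (x b' : Cn) : continuous (fun z : C => x + z *: b').
Proof.
apply/continuous_subspace_setT; apply: within_continuous_add.
  by apply: continuous_subspaceT => z; exact: cst_continuous.
apply: within_continuous_scale; first by apply: continuous_subspaceT => z.
by apply: continuous_subspaceT => z; exact: cst_continuous.
Qed.

(** The statement covers every small [sig], since the discs about the different roots must later
    share one radius. *)
Lemma simple_root_stable p : U p -> ev p gs = 0 -> line_coef gs b p 1 != 0 ->
  exists2 sig0 : R, 0 < sig0 & forall sig : R, 0 < sig -> sig <= sig0 ->
  exists2 d : R, 0 < d & forall t, 0 <= t <= 1 -> `|s - t| < d ->
  forall (gt : A) (et : nat) (rs : seq C), reduced_along b (V t) et gt ->
    (forall z, ev (p + z *: b) gt = \prod_(r <- rs) (z - r)) ->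
    count (fun z => cabs z < sig) rs = 1%N.
Proof.
move=> Up gp al0; have [gsh gsb gsV _] := gsR.
have [R0 R00 hR0] := family_open F Up.
have [w [rho rho0 [r1 r10 [wE1 wU1 wC1]]]] := local_coordinate gsh gsb gp al0.
pose r := Num.min r1 (R0 / 4); have r0 : 0 < r by rewrite lt_min r10 divr_gt0.
pose B := [set y | vabs (y - p) <= r].
have BB1 y : B y -> vabs (y - p) <= r1 by move=> By; apply: le_trans By _; rewrite ge_min lexx.
have wE y : B y -> cabs (w y) < rho /\ ev (y - w y *: b) gs = 0 by move/BB1; exact: wE1.
have wU y (z : C) : B y -> cabs z <= rho -> ev (y - z *: b) gs = 0 -> z = w y by move/BB1; exact: wU1.
have wC : {within B, continuous w} by apply: continuous_subspaceW wC1 => y; exact: BB1.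
have B4U y : vabs (y - p) <= 4 * r -> U y.
  move=> y4; apply: hR0; apply: le_trans y4 _; have : r <= R0 / 4 by rewrite ge_min lexx orbT.
  by move: r0; lra.
have [r2 /andP[r20 r2r] index] := local_index rho0 r0 wE wU wC gp.
have N0 : 0 < vabs b + 1 by rewrite ltr_wpDl ?vabs_ge0.
exists (Num.min rho (r2 / 4 / (vabs b + 1))); first by rewrite lt_min rho0 !divr_gt0.
move=> sig sig0; rewrite le_min => /andP[sigrho sigr2].
have sigb : sig * vabs b <= r2 / 4.
  have : sig * (vabs b + 1) <= r2 / 4 by rewrite -ler_pdivlMr.
  by rewrite mulrDr mulr1; apply: le_trans; rewrite lerDl ltW.
have cid : continuous (@id Cn) by move=> y; exact: cvg_id.
have K4U y : [set y | vabs (y - p) <= 4 * r] y -> U y by exact: B4U.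
(* First tube: [psi] is close to the identity on the whole ball of radius [4 * r]. *)
have [|d3 d30 hd3] := @tube_transition _ _ _ _ _ _ _ F _ [set y | vabs (y - p) <= 4 * r] id s
    (@vball_compact R n p (4 * r)) cid K4U s01 (fun z y => vabs (y - z) <= r2 / 2).
  move=> z _; exists [set y | vabs (z - y) < r2 / 4].
    by apply/vnbhsP; exists (r2 / 4) => //; rewrite divr_gt0.
  exists (r2 / 4); first by rewrite divr_gt0.
  move=> y x /= zy _ zx; apply: le_trans (vabs_distD z x y) _; rewrite vabsC.
  by move: (vabs (z - x)) (vabs (z - y)) zx zy => v1 v2; lra.
have lineB (z : C) : cabs z <= sig -> vabs (p + z *: b - p) <= r2 / 4.
  move=> zs; rewrite addrAC subrr add0r vabsZ; apply: le_trans sigb.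
  by rewrite ler_wpM2r ?vabs_ge0.
have K1U (z : C) : [set z : C | cabs z <= sig] z -> U (p + z *: b).
  by move=> /lineB zs; apply: B4U; apply: le_trans zs _; move: r20 r2r; lra.
(* Second tube: as [w (p + z *: b) = z], the value of [w] after [psi] stays within [sig] of the
   parameter [z]. *)
have [|d4 d40 hd4] := @tube_transition _ _ _ _ _ _ _ F _ [set z : C | cabs z <= sig]
    (fun z => p + z *: b) s (@cdisc_compact R sig) (@line_continuous p b) K1U s01
    (fun z x => cabs (w x - z) < sig).
  move=> z zs; have zB := lineB z zs.
  have Bz : B (p + z *: b) by apply: le_trans zB _; move: r20 r2r; lra.
  have wz : w (p + z *: b) = z.
    by apply: (coordinate_line rho0 r0 wE wU gp) => //; exact: le_trans zs sigrho.
  have sig2 : 0 < sig / 2 by rewrite divr_gt0.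
  move/within_ceps: (wC) => /(_ _ Bz _ sig2)[d d0 hd].
  exists [set z' : C | cabs (z - z') < sig / 2]; first by apply/cnbhsP; exists (sig / 2).
  exists (Num.min d (r / 2)); first by rewrite lt_min d0 divr_gt0.
  move=> z' x /= zz' _; rewrite lt_min => /andP[xd xr].
  have Bx : B x.
    apply: le_trans (vabs_distD (p + z *: b) x p) _; rewrite vabsC.
    by apply: le_trans (lerD (ltW xr) zB) _; move: r20 r2r; lra.
  have := hd x Bx xd; rewrite wz => h1.
  rewrite (splitr sig); apply: le_lt_trans (cabs_distD z _ _) _; apply: ltrD => //.
  by rewrite cabsC.
exists (Num.min d3 d4); first by rewrite lt_min d30.
move=> t t01; rewrite lt_min => /andP[st3 st4] gt et rs gtR hrs.
apply: (@stable_root_count R n U h k V Z F s t b p gs gt et s01 t01 gsV gtR w rho r r2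
  rho0 r0 r20 r2r wE wU wC index B4U _ sig sig0 sigb _ rs hrs).
- by move=> y; exact: (hd3 t t01 st3 y).
- move=> z zs; have zl : [set z : C | cabs z <= sig] z by rewrite /= zs.
  by have [] := hd4 t t01 st4 z zl.
Qed.

Lemma sum_count_exchange (I J : eqType) (rs : seq I) (ts : seq J) (P : I -> J -> bool) :
  (\sum_(i <- rs) count (P i) ts = \sum_(j <- ts) count (P^~ j) rs)%N.
Proof.
under eq_bigr do rewrite -sum1_count big_mkcond.
under [RHS]eq_bigr do rewrite -sum1_count big_mkcond.
exact: exchange_big.
Qed.

Variables (x0 : Cn) (rs0 : seq C) (L : R).
Hypotheses (urs0 : uniq rs0) (hrs0 : forall z, ev (x0 + z *: b) gs = \prod_(r <- rs0) (z - r)).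
Hypotheses (L0 : 0 < L) (x0U : forall z : C, cabs z <= L -> U (x0 + z *: b)).
Hypothesis bU : forall z : C, cabs z <= L^-1 -> U (b + z *: x0) /\ ev (b + z *: x0) gs != 0.

(** A root of modulus above [L] rescales by homogeneity to the point [b + z^-1 *: x0] of [V t],
    which lies close to [b]. Thus a compact set near [b] controls the roots near infinity. *)
Lemma finite_roots_bounded t (g : A) e : g \is ishomog1 e mdeg -> (forall x, ev x g = 0 <-> V t x) ->
  (forall z : C, cabs z <= L^-1 -> ~ V t (b + z *: x0)) ->
  forall z : C, ev (x0 + z *: b) g = 0 -> cabs z <= L.
Proof.
move=> gh gV hV z gz; rewrite leNgt; apply/negP => Lz.
have z0 : z != 0 by rewrite -cabs_gt0; exact: lt_trans Lz.
apply: (hV z^-1); first by rewrite cabsV lef_pV2 ?posrE ?(lt_trans L0 Lz) ?(ltW Lz).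
apply/gV; have -> : b + z^-1 *: x0 = z^-1 *: (x0 + z *: b).
  by rewrite scalerDr scalerA mulVf // scale1r addrC.
by rewrite (ev_homog _ _ gh) gz mulr0.
Qed.

(** Roots at times [s] and [t] are matched when closer than [sig]: each has exactly one partner, and
    counting the pairs in two ways equates the degrees. The clause on [b] keeps the direction usable
    at time [t]. *)
Theorem local_constancy : exists2 d : R, 0 < d & forall t, 0 <= t <= 1 -> `|s - t| < d ->
  ~ V t b /\ forall (gt : A) (et : nat), reduced_along b (V t) et gt -> et = es.
Proof.
have [gsh gsb gsV _] := gsR.
have K2U (z : C) : [set z : C | cabs z <= L^-1] z -> U (b + z *: x0) by move=> /bU[].
have [|d2 d20 hd2] := @tube_avoid _ _ _ _ _ _ _ F _ [set z : C | cabs z <= L^-1]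
    (fun z => b + z *: x0) s (@cdisc_compact R L^-1) (@line_continuous b x0) K2U s01.
  by move=> z /bU[_ /eqP gz] /gsV.
have gs_avoid (z : C) : cabs z <= L^-1 -> ~ V s (b + z *: x0) by move=> /bU[_ /eqP gz] /gsV.
have rs0L r : r \in rs0 -> cabs r <= L.
  by move=> rrs; apply: (finite_roots_bounded gsh gsV gs_avoid); rewrite hrs0 (big_rem r) //= subrr mul0r.
(* Separation by more than [2 * sig] makes the discs disjoint, so a root at time [t] has at most one
   partner. *)
pose P (r : C) (sig : R) := (forall r', r' \in rs0 -> r' != r -> 2 * sig < cabs (r' - r)) /\
  exists2 d : R, 0 < d & forall t, 0 <= t <= 1 -> `|s - t| < d ->
  forall (gt : A) (et : nat) (rs : seq C), reduced_along b (V t) et gt ->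
    (forall z, ev (x0 + r *: b + z *: b) gt = \prod_(r <- rs) (z - r)) ->
    count (fun z => cabs z < sig) rs = 1%N.
have [r rrs|sig sig0 hsig] := @common_radius R C rs0 P.
  have pU := x0U (rs0L r rrs).
  have hp (z : C) : ev (x0 + r *: b + z *: b) gs = \prod_(r' <- map (fun r' => r' - r) rs0) (z - r').
    rewrite -addrA -scalerDl hrs0 big_map; apply: eq_bigr => r' _; ring.
  have [||sig0 sig00 hsig] := @simple_root_stable (x0 + r *: b) pU.
  - by rewrite hrs0 (big_rem r) //= subrr mul0r.
  - apply: (simple_root_coef _ _ hp); first by rewrite map_inj_uniq // => u v /addIr.
    by apply/mapP; exists r; rewrite ?subrr.
  have [d1 d10 hd1] := separating_radius rs0 r.
  exists (Num.min sig0 (d1 / 2)); first by rewrite lt_min sig00 divr_gt0.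
  move=> sig s1; rewrite le_min => /andP[s2 s3]; split; last exact: hsig.
  move=> r' r'rs rr'; apply: le_lt_trans (hd1 r' r'rs rr').
  by rewrite mulrC -ler_pdivlMr.
have {}hsig r : r \in rs0 -> P r sig by move=> rrs; exact: hsig.
have [d3 d30 hd3] : exists2 d : R, 0 < d & forall r, r \in rs0 -> forall d', 0 < d' -> d' <= d ->
    forall t, 0 <= t <= 1 -> `|s - t| < d' ->
    forall (gt : A) (et : nat) (rs : seq C), reduced_along b (V t) et gt ->
    (forall z, ev (x0 + r *: b + z *: b) gt = \prod_(r <- rs) (z - r)) ->
    count (fun z => cabs z < sig) rs = 1%N.
  apply: common_radius => r /hsig[_ [d d0 hd]]; exists d => // d' _ d'd t t01 st.
  by apply: hd => //; exact: lt_le_trans st d'd.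
(* The bounded part of the line outside the discs: free of [V s], hence of [V t] for [t] near [s],
   so a root at time [t] has at least one partner. *)
pose K1 : set C := [set z : C | cabs z <= L] `&` \bigcap_(r in [set` rs0]) [set z | sig <= cabs (z - r)].
have cK1 : compact K1.
  apply: compact_closedI; first exact: cdisc_compact.
  apply: closed_bigI => r _.
  rewrite (_ : [set z | _] = (fun z : C => cabs (z - r)) @^-1` [set u | sig <= u]) //.
  apply: closed_comp; last exact: closed_ge.
  move=> z _; apply: (@continuous_comp _ _ _ (fun z : C => z - r) (@cabs R)).
    by apply: (@continuousB _ _ _ id (fun=> r)) => //; exact: cst_continuous.
  exact: cabs_continuous.
have K1U z : K1 z -> U (x0 + z *: b) by move=> [zL _]; exact: x0U.
have [|d1 d10 hd1] := @tube_avoid _ _ _ _ _ _ _ F _ K1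
    (fun z => x0 + z *: b) s cK1 (@line_continuous x0 b) K1U s01.
  move=> z [_ zK] /gsV; rewrite hrs0 => /eqP; rewrite prodf_seq_eq0 => /hasP[r rrs /=].
  by have := zK r rrs; rewrite /= => h1 /eqP h2; rewrite h2 cabs0 leNgt sig0 in h1.
exists (Num.min d1 (Num.min d2 d3)); first by rewrite !lt_min d10 d20.
move=> t t01; rewrite !lt_min => /andP[st1 /andP[st2 st3]]; split.
  by have := hd2 t t01 st2 0; rewrite scale0r addr0; apply; rewrite /= cabs0 invr_ge0 ltW.
move=> gt et gtR; have [gth gtb gtV _] := gtR.
have [rs srs hrs] := line_roots gth gtb x0.
have cnt r : r \in rs0 -> count (fun z => cabs (z - r) < sig) rs = 1%N.
  move=> rrs; rewrite -(hd3 r rrs d3 d30 (lexx _) t t01 st3 gt et (map (fun r' => r' - r) rs) gtR).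
    by rewrite count_map; apply: eq_count.
  move=> z; rewrite -addrA -scalerDl hrs big_map; apply: eq_bigr => r' _; ring.
have cnt' z : z \in rs -> count (fun r => cabs (z - r) < sig) rs0 = 1%N.
  move=> zrs; have gz : ev (x0 + z *: b) gt = 0 by rewrite hrs (big_rem z) //= subrr mul0r.
  have zL : cabs z <= L by apply: (finite_roots_bounded gth gtV (hd2 t t01 st2)).
  have [r rrs zr] : exists2 r, r \in rs0 & cabs (z - r) < sig.
    apply: contrapT => H; apply: (hd1 t t01 st1 z); last exact/gtV.
    split=> // r /= rrs; rewrite leNgt; apply/negP => zr; apply: H; by exists r.
  rewrite (@eq_in_count _ _ (pred1 r)) ?count_uniq_mem ?rrs // => r' r'rs /=.
  have [->|rr'] := eqVneq r' r; first by rewrite zr.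
  apply/negbTE; rewrite -leNgt; have [h1 _] := hsig r rrs; have {h1} h1 := h1 r' r'rs rr'.
  rewrite leNgt; apply/negP => zr'.
  have h2 := cabs_distD z r' r; rewrite [cabs (r' - z)]cabsC in h2.
  have := lt_le_trans h1 h2; rewrite ltNge => /negP; apply.
  by rewrite mulr2n mulrDl mul1r ltW // ltrD.
have srs0 : size rs0 = es.
  have [rs1 srs1 hrs1] := line_roots gsh gsb x0; rewrite -srs1.
  have E : \prod_(r <- rs0) ('X - r%:P) = \prod_(r <- rs1) ('X - r%:P) :> {poly C}.
    apply/eqP; rewrite -subr_eq0; apply/eqP/poly_eq0_ev => z.
    rewrite hornerD hornerN !horner_prod; under eq_bigr do rewrite hornerXsubC.
    by under [X in _ - X]eq_bigr do rewrite hornerXsubC; rewrite -hrs0 -hrs1 subrr.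
  by have := congr1 (fun q : {poly C} => size q) E; rewrite !size_prod_XsubC => -[].
have -> : et = (\sum_(z <- rs) count (fun r => (cabs (z - r) < sig)%R) rs0)%N.
  by rewrite -srs -sum1_size big_seq [RHS]big_seq; apply: eq_bigr => z /cnt' ->.
rewrite -(sum_count_exchange rs0 rs (fun r z => cabs (z - r) < sig)) -srs0 -sum1_size.
by rewrite big_seq [RHS]big_seq; apply: eq_bigr => r /cnt ->.
Qed.

End LocalConstancy.

(** * From the equisingular family to constancy of the multiplicity *)

Section Assembly.
Variables (R : realType) (n : nat).
Notation C := (Cplx R).
Notation A := (mpoly n C).
Notation Cn := ('rV[C]_n).
Implicit Types (y p b : Cn) (s t : R).

Lemma reduced_multiplicity (V : set Cn) (f : A) d b : f \is ishomog1 d mdeg -> ev b f != 0 ->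
  (forall x, ev x f = 0 <-> V x) -> exists g, reduced_along b V (multiplicity V) g.
Proof.
move=> fh fb fV; have [e [g [c c0 [gh gb gf NS rs]]]] := squarefree_part fh fb.
have gV x : ev x g = 0 <-> V x by split=> [/gf/fV|/fV/gf].
have g0 : g != 0 by apply: contra_eq_neq gb => ->; rewrite rmorph0 eq_sym oner_neq0.
have -> : multiplicity V = e.
  apply: (homogeneous_multiplicity gh g0 gV) => p pV; apply: NS => x /fV; exact: pV.
by exists g; split=> //; exists c.
Qed.

(** The family lives near 0, while the discs in use may be large; a dilation preserves cones and
    brings any bounded region into the domain. *)
Lemma family_scale (U : set Cn) (h k : R -> Cn -> Cn) (V : R -> set Cn) (Z : set Cn) (eps : R) :
  0 < eps -> (forall t x, 0 <= t <= 1 -> V t (toC eps *: x) <-> V t x) ->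
  equisingular_family U h k V Z ->
  equisingular_family [set x | U (toC eps *: x)] (fun t x => h t (toC eps *: x))
    (fun t x => toC eps^-1 *: k t x) V Z.
Proof.
move=> eps0 conic F.
have epsE (x y : Cn) : vabs (toC eps *: x - toC eps *: y) = eps * vabs (x - y).
  by rewrite -scalerBr vabsZ cabs_toC gtr0_norm.
split.
- move=> x /(family_open F)[r r0 hr]; exists (r / eps); first by rewrite divr_gt0.
  by move=> y xy; apply: hr; rewrite epsE mulrC -ler_pdivlMr.
- move=> x s Ux s01 e e0; have [d d0 hd] := family_continuous F Ux s01 e0.
  exists (Num.min d (d / eps)); first by rewrite lt_min d0 divr_gt0.
  move=> y t Uy t01; rewrite !lt_min => /andP[_ xy] /andP[st _].
  by apply: hd => //; rewrite epsE mulrC -ltr_pdivlMr.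
- move=> t x t01 Ux; rewrite (family_inverse F) // scalerA -rmorphM mulVf ?gt_eqF //.
  by rewrite rmorph1 scale1r.
- move=> t t01; apply: within_continuous_scale; first by apply: continuous_subspaceT => x; exact: cst_continuous.
  apply: continuous_subspaceW (family_inverse_continuous F t01).
  by move=> _ [x Ux <-]; exists (toC eps *: x).
- exact: (family_closed F).
- by move=> t x t01 Ux; rewrite -(family_zero F t01 Ux); apply: iff_sym; exact: conic.
Qed.

Section HomogeneousFamily.
Variables (U : set Cn) (h k : R -> Cn -> Cn) (V : R -> set Cn) (Z : set Cn).
Variables (f : R -> A) (d : R -> nat).
Hypothesis F : equisingular_family U h k V Z.
Hypothesis U0 : U 0.
Hypothesis fh : forall t, 0 <= t <= 1 -> f t \is ishomog1 (d t) mdeg.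
Hypothesis f0 : forall t, 0 <= t <= 1 -> f t != 0.
Hypothesis fV : forall t x, 0 <= t <= 1 -> ev x (f t) = 0 <-> V t x.

Lemma multiplicity_locally_constant s : 0 <= s <= 1 -> exists2 e : R, 0 < e &
  forall t, 0 <= t <= 1 -> `|s - t| < e -> multiplicity (V t) = multiplicity (V s).
Proof.
move=> s01; have [b fb] := mpoly_nonzero_ev (f0 s01).
have [gs gsR] := reduced_multiplicity (fh s01) fb (fun x => fV x s01).
have [gsh gsb gsV [c c0 hc]] := gsR.
have [x0 /hc[rs0 [urs0 _ hrs0]]] := mpoly_nonzero_ev c0.
have [dl dl0 hdl] := ev_near gs b (@ltr01 R).
have N0 : 0 < vabs x0 + 1 by rewrite ltr_wpDl ?vabs_ge0.
(* For [cabs z <= L^-1] the point [b + z *: x0] is so close to [b] that [gs], which is 1 at [b], has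
   no zero there. *)
pose L := 2 * (vabs x0 + 1) / dl; have L0 : 0 < L by rewrite divr_gt0 // mulr_gt0.
have Lx : L^-1 * vabs x0 < dl.
  rewrite /L invf_div mulrAC ltr_pdivrMr ?mulr_gt0 // ltr_pM2l //.
  by have := vabs_ge0 x0; move: (vabs x0) => v; lra.
clearbody L.
have bnz (z : C) : cabs z <= L^-1 -> ev (b + z *: x0) gs != 0.
  move=> zL; have := hdl (b + z *: x0); rewrite opprD addrA subrr sub0r vabsN vabsZ gsb.
  have zx : cabs z * vabs x0 < dl by apply: le_lt_trans Lx; rewrite ler_wpM2r ?vabs_ge0.
  by move=> /(_ zx); apply: contraTneq => ->; rewrite subr0 cabs1 ltxx.
have [R0 R00 hR0] := family_open F U0.
(* Bounds both families of points that must enter [U] after the dilation: [x0 + z *: b] for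
   [cabs z <= L] and [b + z *: x0] for [cabs z <= L^-1]. *)
pose M := vabs x0 + L * vabs b + vabs b + L^-1 * vabs x0 + 1.
have M0 : 0 < M.
  by rewrite /M ltr_wpDl // !addr_ge0 ?mulr_ge0 ?vabs_ge0 // ?invr_ge0 ltW.
pose eps := R0 / M; have eps0 : 0 < eps by rewrite divr_gt0.
have inU x : vabs x <= M -> U (toC eps *: x).
  move=> xM; apply: hR0; rewrite subr0 vabsZ cabs_toC gtr0_norm // /eps mulrAC ler_pdivrMr //.
  by rewrite ler_wpM2l // ltW.
have conic t x : 0 <= t <= 1 -> V t (toC eps *: x) <-> V t x.
  move=> t01; rewrite -!(fV _ t01) (ev_homog _ _ (fh t01)); split=> [/eqP|->]; last by rewrite mulr0.
  by rewrite mulf_eq0 expf_eq0 fmorph_eq0 (gt_eqF eps0) andbF => /eqP.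
have F' := family_scale eps0 conic F.
have [||e e0 he] := @local_constancy R n _ _ _ V Z F' s b gs _ s01 gsR x0 rs0 L urs0 hrs0 L0.
- move=> z zL; apply: inU; apply: le_trans (vabsD _ _) _; rewrite vabsZ.
  have h1 : cabs z * vabs b <= L * vabs b by rewrite ler_wpM2r ?vabs_ge0.
  have h2 : 0 <= L^-1 * vabs x0 by rewrite mulr_ge0 ?vabs_ge0 // invr_ge0 ltW.
  have h3 := vabs_ge0 b; rewrite /M; move: h1 h2 h3.
  by move: (cabs z * vabs b) (L * vabs b) (L^-1 * vabs x0) (vabs b) (vabs x0) => v1 v2 v3 v4 v5; lra.
- move=> z zL; split; last exact: bnz.
  apply: inU; apply: le_trans (vabsD _ _) _; rewrite vabsZ.
  have h1 : cabs z * vabs x0 <= L^-1 * vabs x0 by rewrite ler_wpM2r ?vabs_ge0.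
  have h2 : 0 <= L * vabs b by rewrite mulr_ge0 ?vabs_ge0 // ltW.
  have h3 := vabs_ge0 x0; rewrite /M; move: h1 h2 h3.
  by move: (cabs z * vabs x0) (L * vabs b) (L^-1 * vabs x0) (vabs b) (vabs x0) => v1 v2 v3 v4 v5; lra.
exists e => // t t01 st; have [nV heq] := he t t01 st.
have fbt : ev b (f t) != 0 by apply/negP => /eqP/(fV _ t01).
have [gt gtR] := reduced_multiplicity (fh t01) fbt (fun x => fV x t01).
exact: (heq gt _ gtR).
Qed.

End HomogeneousFamily.

(** Connectedness through the intermediate value theorem: otherwise the indicator of [mu x = mu 0]
    would be continuous and take the value 1/2. *)
Lemma locally_constant_interval (T : eqType) (mu : R -> T) :
  (forall s, 0 <= s <= 1 -> exists2 e : R, 0 < e & forall t, 0 <= t <= 1 -> `|s - t| < e -> mu t = mu s) ->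
  forall t, 0 <= t <= 1 -> mu t = mu 0.
Proof.
move=> loc t /andP[t0 t1]; apply/eqP; apply: contraT => mut.
pose g (x : R) : R := (mu x == mu 0)%:R.
have cg : {within `[0, t], continuous g}.
  apply/subspace_continuousP => x; rewrite /= in_itv /= => /andP[x0 xt] B gB.
  have x01 : 0 <= x <= 1 by rewrite x0 (le_trans xt).
  have [e e0 he] := loc x x01; apply/nbhs_normP; exists e => // y /= xy.
  rewrite in_itv /= => /andP[y0 yt].
  have gE : g y = g x.
    have y01 : 0 <= y <= 1 by rewrite y0 (le_trans yt).
    by rewrite /g (he y y01 xy).
  change (B (g y)); rewrite gE; exact: nbhs_singleton gB.
have [|c _ gc] := @IVT R g 0 t (2^-1) t0 cg.
  rewrite /g eqxx (negbTE mut) ge_min le_max; apply/andP; split; apply/orP.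
    by right; rewrite invr_ge0.
  by left; rewrite invf_le1 // ler1n.
have := gc; rewrite /g; case: eqP => _ /eqP.
  by rewrite eq_sym invr_eq1 (eqr_nat R 2 1).
by rewrite eq_sym invr_eq0 (eqr_nat R 2 0).
Qed.

End Assembly.

Theorem theorem5p18 (R : realType) (n : nat)
    (F : 'rV[Cplx R]_n -> R -> Cplx R)
    (F_subanalytic : subanalytic_fun F)
    (F_homogeneous : forall t : R, 0 <= t <= 1 ->
       homogeneous_polynomial_fun (fun x => F x t))
    (F_nonzero : forall t : R, 0 <= t <= 1 -> exists x, F x t != 0)
    (F_at0 : forall t : R, 0 <= t <= 1 -> F 0 t = 0)
    (F_equisingular : topologically_V_equisingular (fun t x => F x t)) :
  forall t : R, 0 <= t <= 1 ->
    multiplicity (zero_set (fun x => F x t)) =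
    multiplicity (zero_set (fun x => F x 0)).
Proof.
have [U [phi [oU [U0 [cphi hphi]]]]] := F_equisingular.
(* Polynomial and degree as functions of time, with arbitrary values outside [0,1]. *)
have /choice[fd hfd] : forall t : R, exists fd : mpoly n (Cplx R) * nat, 0 <= t <= 1 ->
    fd.1 \is ishomog1 fd.2 mdeg /\ forall x, F x t = ev x fd.1.
  move=> t; have [t01|nt] := boolP (0 <= t <= 1); last by exists (0, 0%N).
  by have [d [P [Ph PE]]] := F_homogeneous t t01; exists (P, d).
have /choice[k hk] : forall t : R, exists k : 'rV[Cplx R]_n -> 'rV[Cplx R]_n, 0 <= t <= 1 ->
    (forall x, U x -> k (phi (x, t)) = x) /\ {within (fun x => phi (x, t)) @` U, continuous k}.
  move=> t; have [t01|nt] := boolP (0 <= t <= 1); last by exists id.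
  by have [[_ [k hk]] _] := hphi t t01; exists k.
have z01 : 0 <= (0 : R) <= 1 by rewrite lexx ler01.
pose V t : set 'rV[Cplx R]_n := zero_set (fun x => F x t).
have fV t x : 0 <= t <= 1 -> ev x (fd t).1 = 0 <-> V t x by move=> t01; have [_ E] := hfd t t01; rewrite -E.
have Fam : equisingular_family U (fun t x => phi (x, t)) k V (V 0).
  split.
  - move=> x Ux; have /vnbhsP[e e0 he] : nbhs x U by exact: open_nbhs_nbhs.
    exists (e / 2); first by rewrite divr_gt0.
    move=> y xy; apply: he; rewrite vabsC; apply: le_lt_trans xy _.
    by rewrite ltr_pdivrMr // ltr_pMr // ltr1n.
  - move=> x s Ux s01 e e0; move/subspace_continuousP: cphi => /(_ (x, s) (conj Ux s01)).
    have : nbhs (phi (x, s)) [set z | vabs (phi (x, s) - z) < e] by apply/vnbhsP; exists e.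
    move=> He /(_ _ He)[[N1 N2] /= [/vnbhsP[d1 d10 h1] /nbhs_normP[d2 /= d20 h2]] hN].
    exists (Num.min d1 d2); first by rewrite lt_min d10.
    move=> y t Uy t01; rewrite !lt_min => /andP[xy _] /andP[_ st].
    by apply: (hN (y, t)) => //; split; [exact: h1|exact: h2].
  - by move=> t x t01 Ux; have [h1 _] := hk t t01; exact: h1.
  - by move=> t t01; have [] := hk t t01.
  - move=> z nz; have z0 : ev z (fd 0).1 != 0 by apply/negP => /eqP/(fV 0 z z01).
    have zp : 0 < cabs (ev z (fd 0).1) by rewrite cabs_gt0.
    have [e e0 he] := ev_near (fd 0).1 z zp; exists e => // z' zz' /(fV 0 z' z01) z'0.
    by have := he z' zz'; rewrite z'0 subr0 ltxx.
  (* The converse needs injectivity of [phi (., t)] on [U]: the image point in [V 0] comes from some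
     point of [V t], which must be [x]. *)
  - move=> t x t01 Ux; have [_ [_ E]] := hphi t t01; have [kK _] := hk t t01; split=> hx.
      have : ((fun x => phi (x, t)) @` (V t `&` U)) (phi (x, t)) by exists x.
      by rewrite E => -[].
    have : (V 0 `&` ((fun x => phi (x, t)) @` U)) (phi (x, t)) by split=> //; exists x.
    rewrite -E => -[x' [Vx' Ux'] /(congr1 (k t))].
    by rewrite !kK // => <-.
have f0 t : 0 <= t <= 1 -> (fd t).1 != 0.
  move=> t01; have [x] := F_nonzero t t01; have [_ ->] := hfd t t01.
  by apply: contraNneq => ->; rewrite rmorph0.
apply: (locally_constant_interval (mu := fun t => multiplicity (V t))) => s s01.
apply: (@multiplicity_locally_constant R n U _ k V (V 0) (fun t => (fd t).1) (fun t => (fd t).2) Fam U0) => //.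
by move=> t t01; have [] := hfd t t01.
Qed.
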